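(* Let $(\mathcal C,\mathcal W)$ be a relative ECGW category and $n\ge 0$. Then $S_n\mathcal C$ is a relative ECGW category, with ECGW structure inherited from that of $\mathcal C^{\mathcal S_n}$, and with acyclic objects the pointwise acyclic ones (those staircases all of whose entries are in $\mathcal W$).
   Context: DOUBLE CATEGORIES. A double category $\mathcal C$ has objects, two categories $\mathcal M,\mathcal E$ on these objects (maps: m-morphisms $\rightarrowtail$, resp. e-morphisms $\rightsquigarrow$), and squares with two opposite m-sides and two opposite e-sides, composable in both directions, with identities and interchange. $(A,B;A',B')$ denotes a diagram of m-morphisms $A\rightarrowtail B$, $A'\rightarrowtail B'$ and e-morphisms $A\rightsquigarrow A'$, $B\rightsquigarrow B'$; it ''is a square'' if it bounds a square of $\mathcal C$. $\mathrm{Ar}_\circlearrowleft\mathcal M$ (resp. $\mathrm{Ar}_\circlearrowleft\mathcal E$) has objects the m- (resp. e-)morphisms and maps the squares. $\mathcal C$ has shared isomorphisms if there is a groupoid $I$ with identity-on-objects functors $\mathcal M\leftarrow I\to\mathcal E$ creating isomorphisms (so $I$ is identified with the isomorphisms of both), and for isomorphisms $f,f'$ and m-morphisms $g,g'$ there is a (unique) square with e-sides $f,f'$ and m-sides $g,g'$ iff the corresponding diagram commutes in $\mathcal M$; similarly for $\mathcal E$. A double subcategory is full if it contains all m-, e-morphisms and squares between its objects. ECGW CATEGORIES. For a category $\mathcal X$, $\mathrm{Ar}_\triangle\mathcal X$ has objects the morphisms of $\mathcal X$ and maps $(A\to B)\to(A'\to B')$ the commutative squares with $A\to A'$ an isomorphism.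 If all morphisms of $\mathcal X$ are monic, a class of good squares is a class of commutative squares, all pullbacks, containing all squares of $\mathrm{Ar}_\triangle\mathcal X$; $\mathrm{Ar}_g\mathcal X$ has objects the morphisms and maps the good squares. An ECGW category is a double category $\mathcal C=(\mathcal M,\mathcal E)$ with shared isomorphisms, with classes of good squares in $\mathcal M$ and $\mathcal E$ and equivalences of categories $k:\mathrm{Ar}_\circlearrowleft\mathcal E\to\mathrm{Ar}_g\mathcal M$, $c:\mathrm{Ar}_\circlearrowleft\mathcal M\to\mathrm{Ar}_g\mathcal E$. Here $k$ sends $p:A\rightsquigarrow A'$ to some $k(p):\ker p\rightarrowtail A'$, and a square $(A,B;A',B')$ with e-sides $p,p'$ to a good square with sides $k(p),k(p')$, $A'\rightarrowtail B'$ and an induced $\ker p\rightarrowtail\ker p'$; $c$ sends $i:A\rightarrowtail B$ to some $c(i):\mathrm{coker}\,i\rightsquigarrow B$, and a square $(A,B;A',B')$ with m-sides $i,i'$ to a good square with sides $c(i),c(i')$, $B\rightsquigarrow B'$ and an induced $\mathrm{coker}\,i\rightsquigarrow\mathrm{coker}\,i'$. Write $B/A=\mathrm{coker}(A\rightarrowtail B)$, $B\backslash A=\ker(A\rightsquigarrow B)$. Axioms: (Z) $\mathcal M,\mathcal E$ have initial objects which agree (denoted $\varnothing$). (M) All m- and e-morphisms are monic (in $\mathcal M$, resp. $\mathcal E$). (D) $k$ sends a square into $\mathrm{Ar}_\triangle\mathcal M$ iff $c$ sends it into $\mathrm{Ar}_\triangle\mathcal E$; such squares are called distinguished. (K) For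 each $f:A\rightarrowtail B$ there is a distinguished square $(\varnothing,B/A;A,B)$ with sides $f,c(f)$; for each $g:A\rightsquigarrow B$ there is a distinguished square $(\varnothing,A;B\backslash A,B)$ with sides $g,k(g)$. ($\star$) For a span $C\leftarrowtail A\rightarrowtail B$, if the category of good squares in $\mathcal M$ completing it to $B\rightarrowtail D\leftarrowtail C$ (maps: $D\rightarrowtail D'$ under $B,C$) is nonempty, it has an initial object $D=B\star_AC$ (the $\star$-pushout), and the induced maps $B/A\rightarrowtail(B\star_AC)/C$, $C/A\rightarrowtail(B\star_AC)/B$ are isomorphisms; dually for e-spans. (PO) For every m-span that category is nonempty (not required for e-spans). (PBL) If $(B,C;B',C')$ and the composite $(A,C;A',C')$ are squares, so is $(A,B;A',B')$; similarly for e-direction composites. (POL) If in a commutative diagram with rows $A\rightarrowtail B\rightarrowtail D$ and $C\rightarrowtail B\star_AC\rightarrowtail E$ (left square the $\star$-pushout square) the outer square is good, so is the right one; same for e-morphisms when the $\star$-pushout exists. A kernel-cokernel pair $A\rightarrowtail B\leftsquigarrow C$ consists of an m-morphism and its cokernel (equivalently, an e-morphism and its kernel). FUNCTOR CATEGORIES. For a double category $\mathcal D$, $\mathcal C^{\mathcal D}$ has as objects double functors $\mathcal D\to\mathcal C$; as m-morphisms the m-natural transformations $F\Rightarrow G$ (m-morphisms $Fx\rightarrowtail Gx$ natural for m-morphisms of $\mathcal D$, with squares $(Fx,Gx;Fy,Gy)$ for each e-morphism $x\rightsquigarrow y$, functorial and natural) whose naturality squares at m-morphisms are good; e-morphisms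 dually; squares are modifications (compatible families of squares of $\mathcal C$ indexed by objects of $\mathcal D$). A cube of m-morphisms from a square with vertices $A,B,C,D$ ($A$ initial, $D$ final vertex) to one with vertices $A',B',C',D'$ is good if all faces are good and the induced square with vertices $B\star_AC,\ B'\star_{A'}C',\ D,\ D'$ is good; dually for e-morphisms. $\mathcal C^{\mathcal D}$ is ECGW with good squares those whose component cubes at m- (resp. e-)morphisms of $\mathcal D$ are good cubes, and $k,c,\star$ pointwise. STAIRCASES. $\mathcal S_n$ is the double category generated by objects $A_{i,j}$ ($0\le i\le j\le n$), m-morphisms $A_{i,j}\rightarrowtail A_{i,j+1}$, e-morphisms $A_{i+1,j}\rightsquigarrow A_{i,j}$ and squares $(A_{i+1,j},A_{i+1,j+1};A_{i,j},A_{i,j+1})$. $S_n\mathcal C\subseteq\mathcal C^{\mathcal S_n}$ is the full double subcategory of functors (''staircases'') sending each $A_{i,i}$ to $\varnothing$ and all squares of $\mathcal S_n$ to distinguished squares of $\mathcal C$. RELATIVE ECGW CATEGORIES. A class of acyclic objects $\mathcal W$ in an ECGW category contains all initial objects and satisfies: for every kernel-cokernel pair $A\rightarrowtail B\leftsquigarrow C$, if two of $A,B,C$ are in $\mathcal W$, so is the third. A relative ECGW category is an ECGW category with a class of acyclic objects. *)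

(* Defs.v *)
From Stdlib Require Import FunctionalExtensionality ProofIrrelevance.
From mathcomp Require Import all_boot.

Set Implicit Arguments.
Unset Strict Implicit.
Unset Printing Implicit Defensive.

(* Primitive records make transposition of double categories (below) a
   definitional involution, so that each dual notion is literally the original
   one applied to the transpose. *)
Set Primitive Projections.

Declare Scope cat_scope.
Delimit Scope cat_scope with cat.
Local Open Scope cat_scope.

(** * Categories *)

(* Composition is written in diagrammatic order. *)
Record category (ob : Type) := Category {
  hom : ob -> ob -> Type;
  idm : forall a, hom a a;
  compose : forall a b c, hom a b -> hom b c -> hom a c;
  compose1m : forall a b (f : hom a b), compose (idm a) f = f;
  composem1 : forall a b (f : hom a b), compose f (idm b) = f;
  composeA : forall a b c d (f : hom a b) (g : hom b c) (h : hom c d),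
    compose f (compose g h) = compose (compose f g) h }.

Arguments idm {ob} _ a.
Arguments compose {ob} _ {a b c} _ _.

Notation "f ;; g" := (compose _ f g) (at level 50, left associativity) : cat_scope.

Section CategoryNotions.
Context {ob : Type} (X : category ob).

Definition is_iso a b (f : hom X a b) : Prop :=
  exists g : hom X b a, f ;; g = idm X a /\ g ;; f = idm X b.

Definition is_monic a b (f : hom X a b) : Prop :=
  forall x (u v : hom X x a), u ;; f = v ;; f -> u = v.

Definition is_initial z : Prop :=
  forall a, exists f : hom X z a, forall g : hom X z a, g = f.

(* Squares are listed as (top, left, right, bottom):
     a -f-> b
     |g     |h
     c -k-> d   *)
Definition is_pullback a b c d
    (f : hom X a b) (g : hom X a c) (h : hom X b d) (k : hom X c d) : Prop :=
  f ;; h = g ;; k /\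
  forall x (u : hom X x b) (v : hom X x c), u ;; h = v ;; k ->
    exists w : hom X x a, (w ;; f = u /\ w ;; g = v) /\
      forall w' : hom X x a, w' ;; f = u -> w' ;; g = v -> w' = w.

End CategoryNotions.

Record functor {ob ob' : Type} (X : category ob) (Y : category ob') := Functor {
  fobj : ob -> ob';
  fmap : forall a b, hom X a b -> hom Y (fobj a) (fobj b);
  fmap_id : forall a, fmap (idm X a) = idm Y (fobj a);
  fmap_comp : forall a b c (f : hom X a b) (g : hom X b c),
    fmap (f ;; g) = fmap f ;; fmap g }.

Section Equivalences.
Context {ob ob' : Type} {X : category ob} {Y : category ob'}.

Definition naturally_isomorphic (F G : functor X Y) : Prop :=
  exists eta : forall a, hom Y (fobj F a) (fobj G a),
    (forall a, is_iso (eta a)) /\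
    (forall a b (f : hom X a b), fmap F f ;; eta b = eta a ;; fmap G f).

End Equivalences.

Definition functor_id {ob : Type} (X : category ob) : functor X X :=
  @Functor _ _ X X (fun a => a) (fun a b f => f)
    (fun a => erefl) (fun a b c f g => erefl).

Lemma functor_comp_id {ob ob' ob'' : Type} {X : category ob} {Y : category ob'}
    {Z : category ob''} (F : functor X Y) (G : functor Y Z) a :
  fmap G (fmap F (idm X a)) = idm Z (fobj G (fobj F a)).
Proof. by rewrite !fmap_id. Qed.

Lemma functor_comp_comp {ob ob' ob'' : Type} {X : category ob}
    {Y : category ob'} {Z : category ob''} (F : functor X Y) (G : functor Y Z)
    a b c (f : hom X a b) (g : hom X b c) :
  fmap G (fmap F (f ;; g)) = fmap G (fmap F f) ;; fmap G (fmap F g).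
Proof. by rewrite !fmap_comp. Qed.

Definition functor_comp {ob ob' ob'' : Type} {X : category ob}
    {Y : category ob'} {Z : category ob''}
    (F : functor X Y) (G : functor Y Z) : functor X Z :=
  @Functor _ _ X Z (fun a => fobj G (fobj F a)) (fun a b f => fmap G (fmap F f))
    (functor_comp_id F G) (functor_comp_comp F G).

Definition is_equivalence {ob ob' : Type} {X : category ob} {Y : category ob'}
    (F : functor X Y) : Prop :=
  exists G : functor Y X,
    naturally_isomorphic (functor_comp F G) (functor_id X) /\
    naturally_isomorphic (functor_comp G F) (functor_id Y).

(** * Good squares *)

(* A square (f, g, h, k), read as the map (g, h) : f -> k of the arrow category,
   lies in Ar_triangle when g is an isomorphism.  A commutative square carries
   no preferred direction, hence [good_tr]; [good_comp] (with [good_triangle],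
   which provides identities) says that good squares are the maps of a
   category Ar_g. *)
Record good_class {ob : Type} (X : category ob) := GoodClass {
  good : forall a b c d,
    hom X a b -> hom X a c -> hom X b d -> hom X c d -> Prop;
  good_comm : forall a b c d (f : hom X a b) (g : hom X a c) (h : hom X b d)
    (k : hom X c d), good f g h k -> f ;; h = g ;; k;
  good_pullback : forall a b c d (f : hom X a b) (g : hom X a c) (h : hom X b d)
    (k : hom X c d), good f g h k -> is_pullback f g h k;
  good_tr : forall a b c d (f : hom X a b) (g : hom X a c) (h : hom X b d)
    (k : hom X c d), good f g h k -> good g f k h;
  good_triangle : forall a b c d (f : hom X a b) (g : hom X a c)
    (h : hom X b d) (k : hom X c d),
    f ;; h = g ;; k -> is_iso g -> good f g h k;
  good_comp : forall a b c d a' b' (f : hom X a b) (g : hom X a c)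
    (h : hom X b d) (k : hom X c d) (g' : hom X c a') (h' : hom X d b')
    (k' : hom X a' b'),
    good f g h k -> good k g' h' k' -> good f (g ;; g') (h ;; h') k' }.

Record arrow {ob : Type} (X : category ob) := Arrow {
  dom : ob; cod : ob; arr : hom X dom cod }.
Arguments Arrow {ob X dom cod} arr.

Section GoodArrowCategory.
Context {ob : Type} {X : category ob} (G : good_class X).

Record good_map (u v : arrow X) := GoodMap {
  gm_dom : hom X (dom u) (dom v);
  gm_cod : hom X (cod u) (cod v);
  gm_good : good G (arr u) gm_dom gm_cod (arr v) }.

Lemma good_map_ext u v (s t : good_map u v) :
  gm_dom s = gm_dom t -> gm_cod s = gm_cod t -> s = t.
Proof.
case: s t => [a b p] [a' b' p'] /= ea eb; case: _ / ea in p' *.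
case: _ / eb in p' *; by rewrite (proof_irrelevance _ p p').
Qed.

Lemma good_id u :
  good G (arr u) (idm X (dom u)) (idm X (cod u)) (arr u).
Proof.
apply: good_triangle; first by rewrite compose1m composem1.
by exists (idm X (dom u)); rewrite compose1m.
Qed.

Program Definition good_arrows : category (arrow X) :=
  @Category (arrow X) good_map
    (fun u => @GoodMap u u _ _ (good_id u))
    (fun u v w s t =>
       @GoodMap u w (gm_dom s ;; gm_dom t) (gm_cod s ;; gm_cod t) _) _ _ _.
Next Obligation. by move=> u v w s t; exact: (good_comp (gm_good s) (gm_good t)). Qed.
Next Obligation. by move=> u v s; apply: good_map_ext => /=; rewrite compose1m. Qed.
Next Obligation. by move=> u v s; apply: good_map_ext => /=; rewrite composem1. Qed.
Next Obligation. by move=> *; apply: good_map_ext => /=; rewrite composeA. Qed.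

End GoodArrowCategory.

(** * Double categories *)

(* [sq f g p q] is the type of squares
     A  >-f-> B
     ~p       ~q
     A' >-g-> B'
   with m-sides f, g and e-sides p, q, i.e. with boundary (A, B; A', B'). *)
Record predouble := PreDouble {
  obj :> Type;
  mcat : category obj;
  ecat : category obj;
  sq : forall A B A' B',
    hom mcat A B -> hom mcat A' B' -> hom ecat A A' -> hom ecat B B' -> Type;
  hid : forall A A' (p : hom ecat A A'), sq (idm mcat A) (idm mcat A') p p;
  vid : forall A B (f : hom mcat A B), sq f f (idm ecat A) (idm ecat B);
  hcomp : forall A B C A' B' C' (f : hom mcat A B) (f' : hom mcat B C)
    (g : hom mcat A' B') (g' : hom mcat B' C')
    (p : hom ecat A A') (q : hom ecat B B') (r : hom ecat C C'),
    sq f g p q -> sq f' g' q r -> sq (f ;; f') (g ;; g') p r;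
  vcomp : forall A B A' B' A'' B'' (f : hom mcat A B) (g : hom mcat A' B')
    (h : hom mcat A'' B'') (p : hom ecat A A') (p' : hom ecat A' A'')
    (q : hom ecat B B') (q' : hom ecat B' B''),
    sq f g p q -> sq g h p' q' -> sq f h (p ;; p') (q ;; q') }.

Arguments sq P {A B A' B'} _ _ _ _ : rename.
Arguments hid P {A A'} p : rename.
Arguments vid P {A B} f : rename.

Definition tr (P : predouble) : predouble :=
  @PreDouble P (ecat P) (mcat P)
    (fun A B A' B' p q f g => sq P f g p q)
    (fun A B f => vid P f)
    (fun A A' p => hid P p)
    (fun _ _ _ _ _ _ _ _ _ _ _ _ _ s t => vcomp s t)
    (fun _ _ _ _ _ _ _ _ _ _ _ _ _ s t => hcomp s t).

(* A square together with its m-sides.  Equations between squares whose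
   boundaries agree only propositionally are stated in [hsq] or, for e-sides,
   in [vsq]. *)
Record hsq (P : predouble) A B A' B' (p : hom (ecat P) A A')
    (q : hom (ecat P) B B') := HSq {
  htop : hom (mcat P) A B;
  hbot : hom (mcat P) A' B';
  hcell : sq P htop hbot p q }.
Arguments HSq {P A B A' B' p q htop hbot} hcell.

Definition vsq (P : predouble) A B A' B' (f : hom (mcat P) A B)
    (g : hom (mcat P) A' B') := @hsq (tr P) _ _ _ _ f g.

Definition VSq {P : predouble} {A B A' B'} {f : hom (mcat P) A B}
    {g : hom (mcat P) A' B'} {p : hom (ecat P) A A'} {q : hom (ecat P) B B'}
    (s : sq P f g p q) : vsq f g := @HSq (tr P) _ _ _ _ f g p q s.

Record hcomp_laws (P : predouble) : Prop := HCompLaws {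
  hcomp1s : forall A B A' B' (f : hom (mcat P) A B) (g : hom (mcat P) A' B')
    (p : hom (ecat P) A A') (q : hom (ecat P) B B') (s : sq P f g p q),
    HSq (hcomp (hid P p) s) = HSq s;
  hcomps1 : forall A B A' B' (f : hom (mcat P) A B) (g : hom (mcat P) A' B')
    (p : hom (ecat P) A A') (q : hom (ecat P) B B') (s : sq P f g p q),
    HSq (hcomp s (hid P q)) = HSq s;
  hcompA : forall A B C D A' B' C' D'
    (f1 : hom (mcat P) A B) (f2 : hom (mcat P) B C) (f3 : hom (mcat P) C D)
    (g1 : hom (mcat P) A' B') (g2 : hom (mcat P) B' C') (g3 : hom (mcat P) C' D')
    (p : hom (ecat P) A A') (q : hom (ecat P) B B') (r : hom (ecat P) C C')
    (t : hom (ecat P) D D')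
    (s1 : sq P f1 g1 p q) (s2 : sq P f2 g2 q r) (s3 : sq P f3 g3 r t),
    HSq (hcomp s1 (hcomp s2 s3)) = HSq (hcomp (hcomp s1 s2) s3) }.

Record double_laws (P : predouble) : Prop := DoubleLaws {
  dl_h : hcomp_laws P;
  dl_v : hcomp_laws (tr P);
  dl_id : forall A, hid P (idm (ecat P) A) = vid P (idm (mcat P) A);
  dl_hid : forall A A' A'' (p : hom (ecat P) A A') (q : hom (ecat P) A' A''),
    hid P (p ;; q) = vcomp (hid P p) (hid P q);
  dl_vid : forall A B C (f : hom (mcat P) A B) (g : hom (mcat P) B C),
    vid P (f ;; g) = hcomp (vid P f) (vid P g);
  dl_interchange : forall A B C A' B' C' A'' B'' C''
    (f : hom (mcat P) A B) (f' : hom (mcat P) B C)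
    (g : hom (mcat P) A' B') (g' : hom (mcat P) B' C')
    (h : hom (mcat P) A'' B'') (h' : hom (mcat P) B'' C'')
    (p : hom (ecat P) A A') (q : hom (ecat P) B B') (r : hom (ecat P) C C')
    (p' : hom (ecat P) A' A'') (q' : hom (ecat P) B' B'')
    (r' : hom (ecat P) C' C'')
    (s : sq P f g p q) (t : sq P f' g' q r)
    (s' : sq P g h p' q') (t' : sq P g' h' q' r'),
    vcomp (hcomp s t) (hcomp s' t') = hcomp (vcomp s s') (vcomp t t') }.

Record double_category := Double {
  predouble_of :> predouble;
  double_lawsP : double_laws predouble_of }.

Definition thin (P : predouble) : Prop :=
  forall A B A' B' (f : hom (mcat P) A B) (g : hom (mcat P) A' B')
    (p : hom (ecat P) A A') (q : hom (ecat P) B B') (s t : sq P f g p q), s = t.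

Lemma HSq_ext (P : predouble) (tP : thin P) A B A' B' (p : hom (ecat P) A A')
    (q : hom (ecat P) B B') (s t : hsq p q) :
  htop s = htop t -> hbot s = hbot t -> s = t.
Proof.
case: s t => [a b s] [a' b' t] /= ea eb; case: _ / ea in t *.
case: _ / eb in t *; by rewrite (tP _ _ _ _ _ _ _ _ s t).
Qed.

Lemma thin_tr P : thin P -> thin (tr P).
Proof. by move=> tP A B A' B' f g p q s t; exact: tP. Qed.

Lemma thin_hcomp_laws P : thin P -> hcomp_laws P.
Proof.
by move=> tP; split=> *; apply: HSq_ext => //=;
   rewrite ?compose1m ?composem1 ?composeA.
Qed.

Lemma thin_double_laws P : thin P -> double_laws P.
Proof.
move=> tP; split; try by move=> *; exact: tP.
  exact: thin_hcomp_laws.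
exact: thin_hcomp_laws (thin_tr tP).
Qed.

(* Ar_circlearrowleft E: objects the e-morphisms, maps the squares. *)
Section SquareCategory.
Context (P : predouble) (L : hcomp_laws P).

Definition square_arrows : category (arrow (ecat P)) :=
  @Category (arrow (ecat P)) (fun p q => hsq (arr p) (arr q))
    (fun p => HSq (hid P (arr p)))
    (fun p q r s t => HSq (hcomp (hcell s) (hcell t)))
    (fun p q s => hcomp1s L (hcell s))
    (fun p q s => hcomps1 L (hcell s))
    (fun p q r t s1 s2 s3 => hcompA L (hcell s1) (hcell s2) (hcell s3)).

End SquareCategory.

(** * Double functors and shared isomorphisms *)

Record dfunctor (D C : predouble) := DFunctor {
  dobj :> D -> C;
  dm : forall x y, hom (mcat D) x y -> hom (mcat C) (dobj x) (dobj y);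
  de : forall x y, hom (ecat D) x y -> hom (ecat C) (dobj x) (dobj y);
  dsq : forall x y x' y' (f : hom (mcat D) x y) (g : hom (mcat D) x' y')
    (p : hom (ecat D) x x') (q : hom (ecat D) y y'),
    sq D f g p q -> sq C (dm f) (dm g) (de p) (de q);
  dm_id : forall x, dm (idm (mcat D) x) = idm (mcat C) (dobj x);
  dm_comp : forall x y z (f : hom (mcat D) x y) (g : hom (mcat D) y z),
    dm (f ;; g) = dm f ;; dm g;
  de_id : forall x, de (idm (ecat D) x) = idm (ecat C) (dobj x);
  de_comp : forall x y z (f : hom (ecat D) x y) (g : hom (ecat D) y z),
    de (f ;; g) = de f ;; de g;
  dsq_hid : forall x y (p : hom (ecat D) x y),
    HSq (dsq (hid D p)) = HSq (hid C (de p));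
  dsq_vid : forall x y (f : hom (mcat D) x y),
    VSq (dsq (vid D f)) = VSq (vid C (dm f));
  dsq_hcomp : forall x y z x' y' z' (f : hom (mcat D) x y)
    (f' : hom (mcat D) y z) (g : hom (mcat D) x' y') (g' : hom (mcat D) y' z')
    (p : hom (ecat D) x x') (q : hom (ecat D) y y') (r : hom (ecat D) z z')
    (s : sq D f g p q) (t : sq D f' g' q r),
    HSq (dsq (hcomp s t)) = HSq (hcomp (dsq s) (dsq t));
  dsq_vcomp : forall x y x' y' x'' y'' (f : hom (mcat D) x y)
    (g : hom (mcat D) x' y') (h : hom (mcat D) x'' y'')
    (p : hom (ecat D) x x') (p' : hom (ecat D) x' x'')
    (q : hom (ecat D) y y') (q' : hom (ecat D) y' y'')
    (s : sq D f g p q) (t : sq D g h p' q'),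
    VSq (dsq (vcomp s t)) = VSq (vcomp (dsq s) (dsq t)) }.

Definition tr_dfunctor D C (F : dfunctor D C) : dfunctor (tr D) (tr C) :=
  @DFunctor (tr D) (tr C) (dobj F) (@de _ _ F) (@dm _ _ F)
    (fun _ _ _ _ _ _ _ _ s => dsq F s)
    (de_id F) (@de_comp _ _ F) (dm_id F) (@dm_comp _ _ F)
    (@dsq_vid _ _ F) (@dsq_hid _ _ F)
    (fun _ _ _ _ _ _ _ _ _ _ _ _ _ s t => dsq_vcomp F s t)
    (fun _ _ _ _ _ _ _ _ _ _ _ _ _ s t => dsq_hcomp F s t).

Record shared_isos (P : predouble) := SharedIsos {
  si_I : category P;
  si_groupoid : forall A B (f : hom si_I A B), is_iso f;
  si_m : forall A B, hom si_I A B -> hom (mcat P) A B;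
  si_m_id : forall A, si_m (idm si_I A) = idm (mcat P) A;
  si_m_comp : forall A B C (f : hom si_I A B) (g : hom si_I B C),
    si_m (f ;; g) = si_m f ;; si_m g;
  si_e : forall A B, hom si_I A B -> hom (ecat P) A B;
  si_e_id : forall A, si_e (idm si_I A) = idm (ecat P) A;
  si_e_comp : forall A B C (f : hom si_I A B) (g : hom si_I B C),
    si_e (f ;; g) = si_e f ;; si_e g;
  si_m_creates : forall A B (f : hom (mcat P) A B),
    is_iso f -> exists! i : hom si_I A B, si_m i = f;
  si_e_creates : forall A B (f : hom (ecat P) A B),
    is_iso f -> exists! i : hom si_I A B, si_e i = f;
  si_m_sq : forall A B A' B' (f : hom si_I A A') (f' : hom si_I B B')
    (g : hom (mcat P) A B) (g' : hom (mcat P) A' B'),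
    inhabited (sq P g g' (si_e f) (si_e f')) <-> si_m f ;; g' = g ;; si_m f';
  si_m_sq_unique : forall A B A' B' (f : hom si_I A A') (f' : hom si_I B B')
    (g : hom (mcat P) A B) (g' : hom (mcat P) A' B')
    (s t : sq P g g' (si_e f) (si_e f')), s = t;
  si_e_sq : forall A B A' B' (f : hom si_I A B) (f' : hom si_I A' B')
    (p : hom (ecat P) A A') (p' : hom (ecat P) B B'),
    inhabited (sq P (si_m f) (si_m f') p p') <-> p ;; si_e f' = si_e f ;; p';
  si_e_sq_unique : forall A B A' B' (f : hom si_I A B) (f' : hom si_I A' B')
    (p : hom (ecat P) A A') (p' : hom (ecat P) B B')
    (s t : sq P (si_m f) (si_m f') p p'), s = t }.

(** * ECGW categories *)

(* The functor k : Ar_circlearrowleft E -> Ar_g M, given by its values on objects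
   and on maps; c is a [kernel_functor] on the transpose, with [ker] and [kmor]
   there meaning coker and c. *)
Record kernel_functor (P : predouble) (G : good_class (mcat P)) :=
  KernelFunctor {
  ker : forall A A', hom (ecat P) A A' -> P;
  kmor : forall A A' (p : hom (ecat P) A A'), hom (mcat P) (ker p) A';
  kmap : forall A B A' B' (f : hom (mcat P) A B) (g : hom (mcat P) A' B')
    (p : hom (ecat P) A A') (q : hom (ecat P) B B'),
    sq P f g p q -> hom (mcat P) (ker p) (ker q);
  kmap_good : forall A B A' B' (f : hom (mcat P) A B) (g : hom (mcat P) A' B')
    (p : hom (ecat P) A A') (q : hom (ecat P) B B') (s : sq P f g p q),
    good G (kmor p) (kmap s) g (kmor q);
  kmap_id : forall A A' (p : hom (ecat P) A A'),
    kmap (hid P p) = idm (mcat P) (ker p);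
  kmap_comp : forall A B C A' B' C' (f : hom (mcat P) A B)
    (f' : hom (mcat P) B C) (g : hom (mcat P) A' B') (g' : hom (mcat P) B' C')
    (p : hom (ecat P) A A') (q : hom (ecat P) B B') (r : hom (ecat P) C C')
    (s : sq P f g p q) (t : sq P f' g' q r),
    kmap (hcomp s t) = kmap s ;; kmap t }.

Section KernelFunctor.
Context (P : predouble) (L : hcomp_laws P) (G : good_class (mcat P))
  (k : kernel_functor G).

Program Definition kernel_as_functor :
    functor (square_arrows L) (good_arrows G) :=
  @Functor _ _ (square_arrows L) (good_arrows G)
    (fun p => Arrow (kmor k (arr p)))
    (fun p q s =>
       @GoodMap _ _ G (Arrow (kmor k (arr p))) (Arrow (kmor k (arr q)))
         (kmap k (hcell s)) (hbot s) (kmap_good k (hcell s))) _ _.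
Next Obligation. by move=> p; apply: good_map_ext => //=; exact: kmap_id. Qed.
Next Obligation.
by move=> p q r s t; apply: good_map_ext => //=; exact: kmap_comp.
Qed.

End KernelFunctor.

Section StarPushouts.
Context {ob : Type} {X : category ob} (G : good_class X).

(* [h, k] exhibit D as an initial good completion of the span [f, g]. *)
Definition is_star A B C D (f : hom X A B) (g : hom X A C) (h : hom X B D)
    (k : hom X C D) : Prop :=
  good G f g h k /\
  forall D' (h' : hom X B D') (k' : hom X C D'), good G f g h' k' ->
    exists! u : hom X D D', h ;; u = h' /\ k ;; u = k'.

Definition completable A B C (f : hom X A B) (g : hom X A C) : Prop :=
  exists D (h : hom X B D) (k : hom X C D), good G f g h k.

Definition axiom_PO : Prop :=
  forall A B C (f : hom X A B) (g : hom X A C), completable f g.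

Definition axiom_POL : Prop :=
  forall A B C S D E (f : hom X A B) (g : hom X A C) (h : hom X B S)
    (k : hom X C S) (m : hom X B D) (n : hom X S E) (v : hom X D E),
  is_star f g h k -> m ;; v = h ;; n ->
  good G (f ;; m) g v (k ;; n) -> good G m h v n.

(* The cube with initial face (f, g, h, k), final face (f', g', h', k') and
   connecting edges a, b, c, d. *)
Definition good_cube A B C D A' B' C' D'
    (f : hom X A B) (g : hom X A C) (h : hom X B D) (k : hom X C D)
    (f' : hom X A' B') (g' : hom X A' C') (h' : hom X B' D') (k' : hom X C' D')
    (a : hom X A A') (b : hom X B B') (c : hom X C C') (d : hom X D D') : Prop :=
  good G f g h k /\ good G f' g' h' k' /\
  good G f a b f' /\ good G g a c g' /\ good G h b d h' /\ good G k c d k' /\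
  exists S (p : hom X B S) (q : hom X C S)
         S' (p' : hom X B' S') (q' : hom X C' S')
         (u : hom X S D) (u' : hom X S' D') (t : hom X S S'),
    (is_star f g p q /\ is_star f' g' p' q') /\
    (p ;; u = h /\ q ;; u = k) /\ (p' ;; u' = h' /\ q' ;; u' = k') /\
    (p ;; t = b ;; p' /\ q ;; t = c ;; q') /\
    good G u t d u'.

End StarPushouts.

Section HalfAxioms.
Context (P : predouble) (Gm : good_class (mcat P)) (Ge : good_class (ecat P))
  (k : kernel_functor Gm) (c : @kernel_functor (tr P) Ge).

Definition is_empty (Z : P) : Prop :=
  is_initial (mcat P) Z /\ is_initial (ecat P) Z.

Definition distinguished A B A' B' (f : hom (mcat P) A B)
    (g : hom (mcat P) A' B') (p : hom (ecat P) A A') (q : hom (ecat P) B B')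
    (s : sq P f g p q) : Prop := is_iso (kmap k s).

Definition axiom_K : Prop :=
  forall A B (f : hom (mcat P) A B) Z, is_empty Z ->
  exists (u : hom (mcat P) Z (ker c f)) (v : hom (ecat P) Z A)
         (s : sq P u f v (kmor c f)), distinguished s.

(* The "induced map" is the m-morphism n for which (coker f, coker k; B, D) is
   a square. *)
Definition induced_iso A B C D (f : hom (mcat P) A B) (h : hom (mcat P) B D)
    (k : hom (mcat P) C D) : Prop :=
  exists n : hom (mcat P) (ker c f) (ker c k),
    inhabited (sq P n h (kmor c f) (kmor c k)) /\ is_iso n.

Definition axiom_star : Prop :=
  forall A B C (f : hom (mcat P) A B) (g : hom (mcat P) A C),
  completable Gm f g ->
  (exists D (h : hom (mcat P) B D) (k : hom (mcat P) C D), is_star Gm f g h k) /\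
  (forall D (h : hom (mcat P) B D) (k : hom (mcat P) C D), is_star Gm f g h k ->
     induced_iso f h k /\ induced_iso g k h).

Definition axiom_PBL : Prop :=
  forall A B C A' B' C' (f : hom (mcat P) A B) (g : hom (mcat P) B C)
    (f' : hom (mcat P) A' B') (g' : hom (mcat P) B' C')
    (p : hom (ecat P) A A') (q : hom (ecat P) B B') (r : hom (ecat P) C C'),
  inhabited (sq P g g' q r) -> inhabited (sq P (f ;; g) (f' ;; g') p r) ->
  inhabited (sq P f f' p q).

Definition axiom_D : Prop :=
  forall A B A' B' (f : hom (mcat P) A B) (g : hom (mcat P) A' B')
    (p : hom (ecat P) A A') (q : hom (ecat P) B B') (s : sq P f g p q),
  is_iso (kmap k s) <->
  is_iso (kmap c (s : @sq (tr P) _ _ _ _ p q f g)).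

End HalfAxioms.

Record ecgw (C : double_category) := Ecgw {
  goodm : good_class (mcat C);
  goode : good_class (ecat C);
  kerf : kernel_functor goodm;
  cokf : @kernel_functor (tr C) goode;
  kerf_equiv : is_equivalence (kernel_as_functor (dl_h (double_lawsP C)) kerf);
  cokf_equiv : is_equivalence (kernel_as_functor (dl_v (double_lawsP C)) cokf);
  ecgw_isos : shared_isos C;
  ecgw_Z : exists Z : C, is_empty Z;
  ecgw_Mm : forall A B (f : hom (mcat C) A B), is_monic f;
  ecgw_Me : forall A B (p : hom (ecat C) A B), is_monic p;
  ecgw_D : axiom_D kerf cokf;
  ecgw_Km : axiom_K kerf cokf;
  ecgw_Ke : @axiom_K (tr C) goode goodm cokf kerf;
  ecgw_starm : axiom_star goodm cokf;
  ecgw_stare : @axiom_star (tr C) goode goodm kerf;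
  ecgw_PO : axiom_PO goodm;
  ecgw_PBLm : axiom_PBL C;
  ecgw_PBLe : axiom_PBL (tr C);
  ecgw_POLm : axiom_POL goodm;
  ecgw_POLe : axiom_POL goode }.

(* Faithfulness of k together with (M) makes ECGW categories thin. *)
Lemma ecgw_thin (C : double_category) (X : ecgw C) : thin C.
Proof.
move=> A B A' B' f g p q s t.
have [G [[eta [ei en]] _]] := kerf_equiv X.
pose L := dl_h (double_lawsP C).
pose s0 : hom (square_arrows L) (Arrow p) (Arrow q) := HSq s.
pose t0 : hom (square_arrows L) (Arrow p) (Arrow q) := HSq t.
have e : fmap (kernel_as_functor L (kerf X)) s0
       = fmap (kernel_as_functor L (kerf X)) t0.
  apply: good_map_ext => //=; apply: (@ecgw_Mm _ X _ _ (kmor (kerf X) q)).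
  have := good_comm (kmap_good (kerf X) s).
  by rewrite (good_comm (kmap_good (kerf X) t)) => ->.
have e2 : eta (Arrow p) ;; t0 = eta (Arrow p) ;; s0.
  apply: etrans (etrans (esym (en _ _ t0)) _) (en _ _ s0).
  exact: (f_equal (fun z => compose _ (fmap G z) (eta (Arrow q))) (esym e)).
have [j [_ j2]] := ei (Arrow p).
have inj (u v : hom (square_arrows L) (Arrow p) (Arrow q)) :
    eta (Arrow p) ;; u = eta (Arrow p) ;; v -> u = v.
  move=> euv; apply: etrans (etrans (esym (compose1m u)) _) (compose1m v).
  apply: etrans (f_equal (fun z => compose _ z u) (esym j2)) _.
  apply: etrans _ (f_equal (fun z => compose _ z v) j2).
  apply: etrans (etrans (esym (composeA _ _ _)) _) (composeA _ _ _).
  exact: (f_equal (compose _ j) euv).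
have est : t0 = s0 := inj _ _ e2.
pose T := {fg : hom (mcat C) A B * hom (mcat C) A' B' & sq C fg.1 fg.2 p q}.
pose pk (u : hsq p q) : T :=
  existT (fun fg : hom (mcat C) A B * hom (mcat C) A' B' =>
            sq C fg.1 fg.2 p q) (htop u, hbot u) (hcell u).
exact: esym (EqdepTheory.inj_pairT2 _ _ _ _ _ (f_equal pk est)).
Qed.

(** * Functor double categories *)

Record mnat (D C : predouble) (G : good_class (mcat C)) (F F' : dfunctor D C) :=
  MNat {
  nt :> forall x, hom (mcat C) (F x) (F' x);
  nt_sq : forall x y (e : hom (ecat D) x y),
    sq C (nt x) (nt y) (de F e) (de F' e);
  nt_nat : forall x y (h : hom (mcat D) x y), dm F h ;; nt y = nt x ;; dm F' h;
  nt_sq_id : forall x, VSq (nt_sq (idm (ecat D) x)) = VSq (vid C (nt x));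
  nt_sq_comp : forall x y z (e : hom (ecat D) x y) (e' : hom (ecat D) y z),
    VSq (nt_sq (e ;; e')) = VSq (vcomp (nt_sq e) (nt_sq e'));
  nt_sq_nat : forall x y x' y' (h : hom (mcat D) x y) (h' : hom (mcat D) x' y')
    (e : hom (ecat D) x x') (e' : hom (ecat D) y y') (s : sq D h h' e e'),
    HSq (hcomp (dsq F s) (nt_sq e')) = HSq (hcomp (nt_sq e) (dsq F' s));
  nt_good : forall x y (h : hom (mcat D) x y),
    good G (dm F h) (nt x) (nt y) (dm F' h) }.

Definition enat (D C : predouble) (G : good_class (ecat C))
    (F F' : dfunctor D C) : Type :=
  @mnat (tr D) (tr C) G (tr_dfunctor F) (tr_dfunctor F').

Record modification (D C : predouble) (Gm : good_class (mcat C))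
    (Ge : good_class (ecat C)) (F F' H H' : dfunctor D C)
    (a : mnat Gm F F') (b : mnat Gm H H') (p : enat Ge F H) (q : enat Ge F' H') :=
  Modification {
  md :> forall x, sq C (a x) (b x) (p x) (q x);
  md_m : forall x y (h : hom (mcat D) x y),
    HSq (hcomp (nt_sq p h : sq C (dm F h) (dm H h) (p x) (p y)) (md y)) =
    HSq (hcomp (md x) (nt_sq q h : sq C (dm F' h) (dm H' h) (q x) (q y)));
  md_e : forall x y (e : hom (ecat D) x y),
    VSq (vcomp (nt_sq a e) (md y)) = VSq (vcomp (md x) (nt_sq b e)) }.

Section MNatCategory.
Context (D C : predouble) (tC : thin C) (G : good_class (mcat C)).

Lemma mnat_ext (F F' : dfunctor D C) (a b : mnat G F F') :
  (forall x, a x = b x) -> a = b.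
Proof.
case: a b => [n s p1 p2 p3 p4 p5] [n' s' p1' p2' p3' p4' p5'] /= e.
have en : n = n' by apply: functional_extensionality_dep.
case: _ / en in s' p1' p2' p3' p4' p5' {e} *.
have es : s = s'.
  by do 3![apply: functional_extensionality_dep => ?]; exact: tC.
case: _ / es in p2' p3' p4' *.
by f_equal; exact: proof_irrelevance.
Qed.

Program Definition thin_mnat (F F' : dfunctor D C)
    (n : forall x, hom (mcat C) (F x) (F' x))
    (s : forall x y (e : hom (ecat D) x y), sq C (n x) (n y) (de F e) (de F' e))
    (g : forall x y (h : hom (mcat D) x y),
       good G (dm F h) (n x) (n y) (dm F' h)) : mnat G F F' :=
  @MNat D C G F F' n s _ _ _ _ g.
Next Obligation. by move=> F F' n s g x y h; exact: good_comm (g _ _ h). Qed.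
Next Obligation.
by move=> F F' n s g x; apply: (HSq_ext (thin_tr tC)) => /=; rewrite de_id.
Qed.
Next Obligation.
by move=> F F' n s g x y z e e'; apply: (HSq_ext (thin_tr tC)) => /=; rewrite de_comp.
Qed.
Next Obligation.
by move=> F F' n s g x y x' y' h h' e e' t; apply: (HSq_ext tC) => /=;
   exact: good_comm (g _ _ _).
Qed.

Program Definition mnat_id (F : dfunctor D C) : mnat G F F :=
  @thin_mnat F F (fun x => idm (mcat C) (F x)) (fun x y e => hid C (de F e)) _.
Next Obligation.
by move=> F x y h; exact: (good_id G (Arrow (dm F h))).
Qed.

Program Definition mnat_comp (F F' F'' : dfunctor D C) (a : mnat G F F')
    (b : mnat G F' F'') : mnat G F F'' :=
  @thin_mnat F F'' (fun x => a x ;; b x)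
    (fun x y e => hcomp (nt_sq a e) (nt_sq b e)) _.
Next Obligation.
by move=> F F' F'' a b x y h; exact: good_comp (nt_good a h) (nt_good b h).
Qed.

Program Definition mnat_category : category (dfunctor D C) :=
  @Category (dfunctor D C) (@mnat D C G) mnat_id mnat_comp _ _ _.
Next Obligation. by move=> F F' a; apply: mnat_ext => x /=; rewrite compose1m. Qed.
Next Obligation. by move=> F F' a; apply: mnat_ext => x /=; rewrite composem1. Qed.
Next Obligation. by move=> *; apply: mnat_ext => x /=; rewrite composeA. Qed.

End MNatCategory.

Section FunctorCategory.
Context (C : double_category) (X : ecgw C) (D : double_category).

Let tC : thin C := ecgw_thin X.

Definition fun_mcat : category (dfunctor D C) := mnat_category D tC (goodm X).

(* The e-side is [mnat_category] for the transposes, with the double functors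
   kept untransposed as objects. *)
Definition fun_ecat : category (dfunctor D C) :=
  let E := mnat_category (tr D) (thin_tr tC) (goode X) in
  @Category (dfunctor D C) (fun F F' => enat (goode X) F F')
    (fun F => idm E (tr_dfunctor F))
    (fun F F' F'' p q => compose E p q)
    (fun F F' p => @compose1m _ E (tr_dfunctor F) (tr_dfunctor F') p)
    (fun F F' p => @composem1 _ E (tr_dfunctor F) (tr_dfunctor F') p)
    (fun F F' F'' F''' p q r => @composeA _ E (tr_dfunctor F) (tr_dfunctor F')
       (tr_dfunctor F'') (tr_dfunctor F''') p q r).

Definition fun_sq (F F' H H' : dfunctor D C) (a : hom fun_mcat F F')
    (b : hom fun_mcat H H') (p : hom fun_ecat F H) (q : hom fun_ecat F' H') :=
  modification a b p q.

Program Definition thin_modification (F F' H H' : dfunctor D C)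
    (a : hom fun_mcat F F') (b : hom fun_mcat H H') (p : hom fun_ecat F H)
    (q : hom fun_ecat F' H')
    (m : forall x, sq C (nt a x) (nt b x) (nt p x) (nt q x)) : fun_sq a b p q :=
  @Modification D C _ _ F F' H H' a b p q m _ _.
Next Obligation.
by move=> F F' H H' a b p q m x y h; apply: (HSq_ext tC) => /=; exact: nt_nat.
Qed.
Next Obligation.
move=> F F' H H' a b p q m x y e; apply: (HSq_ext (thin_tr tC)) => /=.
  exact: (nt_nat p e).
exact: (nt_nat q e).
Qed.

Definition fun_predouble : predouble :=
  @PreDouble (dfunctor D C) fun_mcat fun_ecat fun_sq
    (fun F H p =>
       @thin_modification F F H H (idm fun_mcat F) (idm fun_mcat H) p p
         (fun x => hid C (nt p x)))
    (fun F F' a =>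
       @thin_modification F F' F F' a a (idm fun_ecat F) (idm fun_ecat F')
         (fun x => vid C (nt a x)))
    (fun F F' F'' H H' H'' a a' b b' p q r s t =>
       @thin_modification F F'' H H'' (a ;; a') (b ;; b') p r
         (fun x => hcomp (md s x) (md t x)))
    (fun F F' H H' K K' a b c p p' q q' s t =>
       @thin_modification F F' K K' a c (p ;; p') (q ;; q')
         (fun x => vcomp (md s x) (md t x))).

Lemma fun_thin : thin fun_predouble.
Proof.
move=> F F' H H' a b p q [s p1 p2] [t p1' p2'].
have e : s = t by apply: functional_extensionality_dep => x; exact: tC.
by case: _ / e in p1' p2' *; f_equal; exact: proof_irrelevance.
Qed.

(* The double category C^D. *)
Definition fun_double : double_category := Double (thin_double_laws fun_thin).

Definition fun_goodm (F F' H H' : dfunctor D C) (a : hom fun_mcat F F')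
    (b : hom fun_mcat F H) (c : hom fun_mcat F' H') (d : hom fun_mcat H H') :
    Prop :=
  forall x y (h : hom (mcat D) x y),
    good_cube (goodm X) (nt a x) (nt b x) (nt c x) (nt d x)
      (nt a y) (nt b y) (nt c y) (nt d y) (dm F h) (dm F' h) (dm H h) (dm H' h).

Definition fun_goode (F F' H H' : dfunctor D C) (a : hom fun_ecat F F')
    (b : hom fun_ecat F H) (c : hom fun_ecat F' H') (d : hom fun_ecat H H') :
    Prop :=
  forall x y (h : hom (ecat D) x y),
    good_cube (goode X) (nt a x) (nt b x) (nt c x) (nt d x)
      (nt a y) (nt b y) (nt c y) (nt d y) (de F h) (de F' h) (de H h) (de H' h).

End FunctorCategory.

(** * Full double subcategories *)

Section FullSub.
Context (C : double_category) (Q : C -> Prop).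

Definition full_cat (K : category C) : category {A : C | Q A} :=
  @Category {A : C | Q A} (fun A B => hom K (sval A) (sval B))
    (fun A => idm K (sval A)) (fun A B D f g => compose K f g)
    (fun A B f => compose1m f) (fun A B f => composem1 f)
    (fun A B D E f g h => composeA f g h).

Definition full_predouble : predouble :=
  @PreDouble {A : C | Q A} (full_cat (mcat C)) (full_cat (ecat C))
    (fun A B A' B' f g p q => sq C f g p q)
    (fun A A' p => hid C p) (fun A B f => vid C f)
    (fun _ _ _ _ _ _ _ _ _ _ _ _ _ s t => hcomp s t)
    (fun _ _ _ _ _ _ _ _ _ _ _ _ _ s t => vcomp s t).

End FullSub.

(** * Staircases *)

Section Staircases.
Local Open Scope nat_scope.
Variable n : nat.

(* The pair (i, j) stands for A_{i,j}. *)
Definition stair_ob : Type := {p : nat * nat | p.1 <= p.2 <= n}.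

Definition stair_m (x y : stair_ob) : bool :=
  ((sval x).1 == (sval y).1) && ((sval x).2 <= (sval y).2).

Definition stair_e (x y : stair_ob) : bool :=
  ((sval x).2 == (sval y).2) && ((sval y).1 <= (sval x).1).

Lemma stair_m_refl x : stair_m x x. Proof. by rewrite /stair_m eqxx leqnn. Qed.
Lemma stair_e_refl x : stair_e x x. Proof. by rewrite /stair_e eqxx leqnn. Qed.

Lemma stair_m_trans x y z : stair_m x y -> stair_m y z -> stair_m x z.
Proof.
by move=> /andP[/eqP e h] /andP[/eqP e' h']; rewrite /stair_m e e' eqxx /=;
   exact: leq_trans h h'.
Qed.

Lemma stair_e_trans x y z : stair_e x y -> stair_e y z -> stair_e x z.
Proof.
by move=> /andP[/eqP e h] /andP[/eqP e' h']; rewrite /stair_e e e' eqxx /=;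
   exact: leq_trans h' h.
Qed.

Definition stair_mcat : category stair_ob :=
  @Category stair_ob (fun x y => stair_m x y) stair_m_refl stair_m_trans
    (fun _ _ _ => bool_irrelevance _ _) (fun _ _ _ => bool_irrelevance _ _)
    (fun _ _ _ _ _ _ _ => bool_irrelevance _ _).

Definition stair_ecat : category stair_ob :=
  @Category stair_ob (fun x y => stair_e x y) stair_e_refl stair_e_trans
    (fun _ _ _ => bool_irrelevance _ _) (fun _ _ _ => bool_irrelevance _ _)
    (fun _ _ _ _ _ _ _ => bool_irrelevance _ _).

(* In the double category generated by the unit squares of the grid
   0 <= i <= j <= n there is at most one m- (resp. e-) morphism between two
   objects, namely a chain of generators along a row (resp. a column), and every
   boundary bounds exactly one square: it is a rectangle inside the grid, and
   pastings of unit squares filling it agree by interchange. *)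
Definition stair_predouble : predouble :=
  @PreDouble stair_ob stair_mcat stair_ecat
    (fun _ _ _ _ _ _ _ _ => unit)
    (fun _ _ _ => tt) (fun _ _ _ => tt)
    (fun _ _ _ _ _ _ _ _ _ _ _ _ _ _ _ => tt)
    (fun _ _ _ _ _ _ _ _ _ _ _ _ _ _ _ => tt).

Lemma stair_thin : thin stair_predouble.
Proof. by move=> A B A' B' f g p q [] []. Qed.

Definition stair : double_category := Double (thin_double_laws stair_thin).

End Staircases.

Section SnC.
Context (C : double_category) (X : ecgw C) (n : nat).

(* The symbol for the empty object denotes any initial object, so that the
   subcategory of staircases is replete and closed under pointwise k and c. *)
Definition is_staircase (F : dfunctor (stair n) C) : Prop :=
  (forall x : stair n, (sval x).1 = (sval x).2 -> is_empty (F x)) /\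
  (forall (x y x' y' : stair n) (f : hom (mcat (stair n)) x y)
     (g : hom (mcat (stair n)) x' y') (p : hom (ecat (stair n)) x x')
     (q : hom (ecat (stair n)) y y') (s : sq (stair n) f g p q),
     distinguished (kerf X) (dsq F s)).

Definition Sn_predouble : predouble :=
  @full_predouble (fun_double X (stair n)) is_staircase.

Lemma Sn_thin : thin Sn_predouble.
Proof.
by move=> A B A' B' f g p q s t; exact: (@fun_thin C X (stair n)).
Qed.

Definition Sn : double_category := Double (thin_double_laws Sn_thin).

(* [Y] is the restriction of the structure of C^{S_n}: the same good squares,
   and kernels, cokernels and star-pushouts computed entrywise.  Two arrows of C
   whose endpoints agree only propositionally are compared in [arrow]. *)
Record inherited (Y : ecgw Sn) : Prop := Inherited {
  inh_goodm : forall (F F' H H' : Sn) (a : hom (mcat Sn) F F')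
    (b : hom (mcat Sn) F H) (c : hom (mcat Sn) F' H') (d : hom (mcat Sn) H H'),
    good (goodm Y) a b c d <-> fun_goodm a b c d;
  inh_goode : forall (F F' H H' : Sn) (a : hom (ecat Sn) F F')
    (b : hom (ecat Sn) F H) (c : hom (ecat Sn) F' H') (d : hom (ecat Sn) H H'),
    good (goode Y) a b c d <-> fun_goode a b c d;
  inh_ker : forall (F F' : Sn) (p : hom (ecat Sn) F F') x,
    Arrow (nt (kmor (kerf Y) p) x) = Arrow (kmor (kerf X) (nt p x));
  inh_kmap : forall (F F' H H' : Sn) (a : hom (mcat Sn) F F')
    (b : hom (mcat Sn) H H') (p : hom (ecat Sn) F H) (q : hom (ecat Sn) F' H')
    (s : sq Sn a b p q) x,
    Arrow (nt (kmap (kerf Y) s) x) = Arrow (kmap (kerf X) (md s x));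
  inh_coker : forall (F F' : Sn) (a : hom (mcat Sn) F F') x,
    Arrow (nt (kmor (cokf Y) a) x) = Arrow (kmor (cokf X) (nt a x));
  inh_cmap : forall (F F' H H' : Sn) (a : hom (mcat Sn) F F')
    (b : hom (mcat Sn) H H') (p : hom (ecat Sn) F H) (q : hom (ecat Sn) F' H')
    (s : sq Sn a b p q) x,
    Arrow (nt (kmap (cokf Y) (s : @sq (tr Sn) _ _ _ _ p q a b)) x) =
    Arrow (kmap (cokf X)
      (md s x : @sq (tr C) _ _ _ _ (nt p x) (nt q x) (nt a x) (nt b x)));
  inh_starm : forall (F F' H H' : Sn) (a : hom (mcat Sn) F F')
    (b : hom (mcat Sn) F H) (c : hom (mcat Sn) F' H') (d : hom (mcat Sn) H H'),
    is_star (goodm Y) a b c d ->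
    forall x, is_star (goodm X) (nt a x) (nt b x) (nt c x) (nt d x);
  inh_stare : forall (F F' H H' : Sn) (a : hom (ecat Sn) F F')
    (b : hom (ecat Sn) F H) (c : hom (ecat Sn) F' H') (d : hom (ecat Sn) H H'),
    is_star (goode Y) a b c d ->
    forall x, is_star (goode X) (nt a x) (nt b x) (nt c x) (nt d x) }.

End SnC.

(** * Acyclic objects *)

Section Acyclic.
Context (C : double_category) (X : ecgw C).

Definition kernel_cokernel_pair (A B K : C) (i : hom (mcat C) A B)
    (p : hom (ecat C) K B) : Prop :=
  exists j : hom (ecat C) K (ker (cokf X) i),
    is_iso j /\ j ;; (kmor (cokf X) i : hom (ecat C) _ _) = p.

Record acyclic_class (W : C -> Prop) : Prop := AcyclicClass {
  ac_empty : forall Z, is_empty Z -> W Z;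
  ac_two_of_three : forall (A B K : C) (i : hom (mcat C) A B)
    (p : hom (ecat C) K B), kernel_cokernel_pair i p ->
    (W A -> W B -> W K) /\ (W A -> W K -> W B) /\ (W B -> W K -> W A) }.

End Acyclic.

Definition pointwise_acyclic (C : double_category) (X : ecgw C) (n : nat)
    (W : C -> Prop) (F : Sn X n) : Prop := forall x, W (sval F x).

(* Main.v *)
Require Import Defs.
From Stdlib Require Import IndefiniteDescription ProofIrrelevance.
From mathcomp Require Import all_boot.

Set Implicit Arguments.
Unset Strict Implicit.
Unset Printing Implicit Defensive.

Local Open Scope cat_scope.

(** An m-natural transformation restricts, along an m-morphism of the indexing
    category, to a good square and, along an e-morphism, to a square of C, that
    is, to a good square of kernels.  So everything reduces to good cubes.  The
    key fact is that a cube with good faces is good exactly when the square of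
    cokernels in one of its three directions is good, the direction being
    irrelevant: with S the star-pushout inside a good square (A, B; C, D), the
    object D/S is both (D/C)/(B/A) and (D/B)/(C/A).  Hence good cubes form a
    class of good squares in Ar_g M, kernels and cokernels of staircases can be
    taken entrywise, and fullness of k and c on staircases follows from that on
    entries.

    For the entrywise star-pushout S of a span of staircases, (POL) gives the
    goodness of naturality squares along m-morphisms, and the e-morphism
    S_x ~> S_y is the cokernel of the m-morphism from the star-pushout of the
    kernels to S_y: a cokernel of a map of star-pushouts is a star-pushout, so
    this cokernel is S_x, and (D) makes the e-morphism unique.  A square is
    distinguished when its map of kernels, or equivalently of cokernels, is
    invertible, which entrywise kernels, cokernels and star-pushouts preserve. *)

(** * Categories and good squares *)

(** Only (PO) distinguishes m-morphisms from e-morphisms. The remaining axioms are self-dual, and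
    transposition is a definitional involution, so statements are proved once over a [predouble] and
    their duals are instances; for the same reason functors are studied over an arbitrary indexing
    double category, which may be a transpose.

    Thinness turns squares into propositions and monicity fixes most of their sides, so naturality
    and functoriality of constructed data cost little. The work lies in the existence of squares.
    The recurring method is to exhibit a good square of kernels or cokernels, lift it by fullness,
    and recognize the missing side of the lift by uniqueness. The hard instance is a square between
    entries of a star-pushout of functors: initiality yields its m-morphisms but says nothing about
    e-morphisms or squares, and these are reached by pasting good cubes of kernels. *)

Section Categories.
Context {ob : Type} {X : category ob}.

Lemma iso_id a : is_iso (idm X a).
Proof. by exists (idm X a); rewrite compose1m. Qed.

Lemma iso_comp a b c (f : hom X a b) (g : hom X b c) :
  is_iso f -> is_iso g -> is_iso (f ;; g).
Proof.
move=> [f' [f1 f2]] [g' [g1 g2]]; exists (g' ;; f'); split.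
  by rewrite -composeA (composeA g g' f') g1 compose1m.
by rewrite -composeA (composeA f' f g) f2 compose1m.
Qed.

Lemma iso_inv a b (f : hom X a b) (g : hom X b a) :
  f ;; g = idm X a -> g ;; f = idm X b -> is_iso g.
Proof. by move=> e1 e2; exists f. Qed.

Lemma iso_monic a b (f : hom X a b) : is_iso f -> is_monic f.
Proof.
move=> [g [e _]] x u v /(f_equal (fun w => w ;; g)).
by rewrite -!composeA e !composem1.
Qed.

Lemma iso_epic a b c (f : hom X a b) (u v : hom X b c) :
  is_iso f -> f ;; u = f ;; v -> u = v.
Proof.
move=> [g [_ e]] /(f_equal (fun w => g ;; w)).
by rewrite !composeA e !compose1m.
Qed.

Lemma iso_cancel_l a b c (f : hom X a b) (g : hom X b c) :
  is_iso f -> is_iso (f ;; g) -> is_iso g.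
Proof.
move=> [f' [f1 f2]] fg; have -> : g = f' ;; (f ;; g).
  by rewrite composeA f2 compose1m.
by apply: iso_comp fg; exists f.
Qed.

Lemma iso_cancel_r a b c (f : hom X a b) (g : hom X b c) :
  is_iso g -> is_iso (f ;; g) -> is_iso f.
Proof.
move=> [g' [g1 g2]] fg; have -> : f = (f ;; g) ;; g'.
  by rewrite -composeA g1 composem1.
by apply: (iso_comp fg); exists g.
Qed.

Lemma iso_factors a a' b (i : hom X a b) (i' : hom X a' b) u u' :
  is_monic i -> is_monic i' -> i = u ;; i' -> i' = u' ;; i -> is_iso u.
Proof.
move=> mi mi' e e'; exists u'; split.
  by apply: mi; rewrite -composeA -e' -e compose1m.
by apply: mi'; rewrite -composeA -e -e' compose1m.
Qed.

Lemma initial_endo z (u : hom X z z) : is_initial X z -> u = idm X z.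
Proof. by move=> /(_ z) [f e]; rewrite (e u) (e (idm X z)). Qed.

Lemma initial_uniq z a (u v : hom X z a) : is_initial X z -> u = v.
Proof. by move=> /(_ a) [f e]; rewrite (e u) (e v). Qed.

Lemma initial_iso z z' (f : hom X z z') :
  is_initial X z -> is_initial X z' -> is_iso f.
Proof.
by move=> iz iz'; have [g _] := iz' z; exists g; split; exact: initial_endo.
Qed.

Lemma initial_monic_iso a z (f : hom X a z) :
  is_monic f -> is_initial X z -> is_iso f.
Proof.
move=> mf iz; have [g _] := iz a; exists g; split; last exact: initial_endo.
by apply: mf; rewrite -composeA (initial_endo (g ;; f) iz) composem1 compose1m.
Qed.

Lemma initial_transport z z' (f : hom X z z') :
  is_iso f -> is_initial X z -> is_initial X z'.
Proof.
move=> [g [e1 e2]] iz a; have [h eh] := iz a; exists (g ;; h) => k.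
by rewrite -(eh (f ;; k)) composeA e2 compose1m.
Qed.

End Categories.

Section GoodSquares.
Context {ob : Type} {X : category ob} (G : good_class X).

Lemma good_flip a b c d (f : hom X a b) (g : hom X a c) (h : hom X b d)
    (k : hom X c d) : good G f g h k -> good G g f k h.
Proof. exact: good_tr. Qed.

Lemma good_iso_top a b c d (f : hom X a b) (g : hom X a c) (h : hom X b d)
    (k : hom X c d) : f ;; h = g ;; k -> is_iso f -> good G f g h k.
Proof. by move=> e i; apply: good_tr; apply: good_triangle. Qed.

Lemma good_hcomp a b c d b' d' (f : hom X a b) (g : hom X a c) (h : hom X b d)
    (k : hom X c d) (f' : hom X b b') (l : hom X b' d') (k' : hom X d d') :
  good G f g h k -> good G f' h l k' -> good G (f ;; f') g l (k ;; k').
Proof.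
by move=> /good_flip s /good_flip t; apply: good_tr; apply: good_comp s t.
Qed.

(** Paste along [k] the square with sides [k], an identity, [u] and [k ;; u], which lies in the
    triangle class. *)
Lemma good_extend a b c d d' (f : hom X a b) (g : hom X a c) (h : hom X b d)
    (k : hom X c d) (u : hom X d d') :
  good G f g h k -> good G f g (h ;; u) (k ;; u).
Proof.
move=> s; have := good_comp s (@good_triangle _ _ G _ _ _ _ k (idm X c) u
  (k ;; u) (esym (compose1m _)) (iso_id c)).
by rewrite composem1.
Qed.

(** Supplies the good completion by which a map of spans induces a map of star-pushouts. The leg [f]
    is pasted directly, the leg [g] through a square with an identity side. *)
Lemma good_legs a b c a' b' c' d (f : hom X a b) (g : hom X a c)
    (f' : hom X a' b') (g' : hom X a' c') (u : hom X a a') (v : hom X b b')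
    (w : hom X c c') (h : hom X b' d) (k : hom X c' d) :
  good G f u v f' -> good G g u w g' -> good G f' g' h k ->
  good G f g (v ;; h) (w ;; k).
Proof.
move=> sf sg s; have t := good_comp sf s.
have e : g ;; w = u ;; g' := good_comm sg.
have tg : good G g (idm X a) w (u ;; g').
  by apply: good_triangle (iso_id _); rewrite compose1m.
by have := good_comp tg (good_flip t); rewrite compose1m => /good_flip.
Qed.

Lemma star_tr A B C D (f : hom X A B) (g : hom X A C) (h : hom X B D)
    (k : hom X C D) : is_star G f g h k -> is_star G g f k h.
Proof.
move=> [s i]; split; first exact: good_tr.
move=> D' h' k' /good_flip /i [u [[e1 e2] e]]; exists u; split=> // v [e3 e4].
exact: e.
Qed.

(** A good square stays good after composition with [u], so the uniqueness in initiality applies to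
    [u] and [v]. *)
Lemma star_epi A B C D E (f : hom X A B) (g : hom X A C) (h : hom X B D)
    (k : hom X C D) (u v : hom X D E) :
  is_star G f g h k -> h ;; u = h ;; v -> k ;; u = k ;; v -> u = v.
Proof.
move=> [s i] e1 e2; have [w [_ ew]] := i _ _ _ (good_extend u s).
by rewrite -(ew u) // -(ew v).
Qed.

Lemma star_desc A B C D E (f : hom X A B) (g : hom X A C) (h : hom X B D)
    (k : hom X C D) (h' : hom X B E) (k' : hom X C E) :
  is_star G f g h k -> good G f g h' k' ->
  exists u, h ;; u = h' /\ k ;; u = k'.
Proof. by move=> [s i] /i [u [e _]]; exists u. Qed.

Lemma star_iso A B C D D' (f : hom X A B) (g : hom X A C) (h : hom X B D)
    (k : hom X C D) (d : hom X D D') :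
  is_star G f g h k -> is_iso d -> is_star G f g (h ;; d) (k ;; d).
Proof.
move=> [s i] [d' [e1 e2]]; split; first exact: good_extend.
move=> E h' k' /i [u [[eh ek] eu]]; exists (d' ;; u); split.
  by split; rewrite -composeA (composeA d) e1 compose1m.
move=> v [eh' ek']; rewrite (eu (d ;; v)) ?composeA ?e2 ?compose1m //.
Qed.

Lemma star_uniq A B C D D' (f : hom X A B) (g : hom X A C) (h : hom X B D)
    (k : hom X C D) (h' : hom X B D') (k' : hom X C D') :
  is_star G f g h k -> is_star G f g h' k' ->
  exists u : hom X D D', is_iso u /\ (h ;; u = h' /\ k ;; u = k').
Proof.
move=> s s'; have [u [e1 e2]] := star_desc s s'.1.
have [v [e3 e4]] := star_desc s' s.1.
exists u; split=> //; exists v; split.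
  by apply: (star_epi s); rewrite composeA ?e1 ?e2 ?e3 ?e4 composem1.
by apply: (star_epi s'); rewrite composeA ?e1 ?e2 ?e3 ?e4 ?e1 ?e2 composem1.
Qed.

Lemma star_desc_iso A B C D D' (f : hom X A B) (g : hom X A C) (h : hom X B D)
    (k : hom X C D) (h' : hom X B D') (k' : hom X C D') (u : hom X D D') :
  is_star G f g h k -> is_star G f g h' k' -> h ;; u = h' -> k ;; u = k' ->
  is_iso u.
Proof.
move=> s s' e1 e2; have [v [iv [e3 e4]]] := star_uniq s s'.
by have -> : u = v by apply: (star_epi s); rewrite ?e1 ?e2 ?e3 ?e4.
Qed.

End GoodSquares.

(** Fullness of [k] without the equation on kernels: since [kmor k q] is monic in the intended use,
    the kernel map of the lift can only be [a]. *)
Definition kernel_full (P : predouble) (G : good_class (mcat P))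
    (k : kernel_functor G) : Prop :=
  forall A B A' B' (p : hom (ecat P) A A') (q : hom (ecat P) B B')
    (a : hom (mcat P) (ker k p) (ker k q)) (g : hom (mcat P) A' B'),
  good G (kmor k p) a g (kmor k q) ->
  exists f : hom (mcat P) A B, inhabited (sq P f g p q).

(** Faithfulness of [k] on boundaries: [g] already fixes the map of kernels. Uniqueness of the
    square itself is kept apart as thinness. *)
Definition top_unique (P : predouble) : Prop :=
  forall A B A' B' (f f' : hom (mcat P) A B) (g : hom (mcat P) A' B')
    (p : hom (ecat P) A A') (q : hom (ecat P) B B'),
  inhabited (sq P f g p q) -> inhabited (sq P f' g p q) -> f = f'.

(* The self-dual part of [ecgw], that is, everything except (PO), over a
   predouble category: a structure on [P] is then one on [tr P], and each lemma
   below has a dual, obtained by applying it to [dual X]. *)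
Record core (P : predouble) := Core {
  co_thin : thin P;
  gm : good_class (mcat P);
  ge : good_class (ecat P);
  kf : kernel_functor gm;
  cf : @kernel_functor (tr P) ge;
  kf_full : kernel_full kf;
  cf_full : kernel_full cf;
  top_uniq : top_unique P;
  left_uniq : top_unique (tr P);
  co_isos : shared_isos P;
  co_Z : exists Z : P, is_empty Z;
  mm : forall A B (f : hom (mcat P) A B), is_monic f;
  me : forall A B (p : hom (ecat P) A B), is_monic p;
  co_D : axiom_D kf cf;
  co_Km : axiom_K kf cf;
  co_Ke : @axiom_K (tr P) ge gm cf kf;
  co_starm : axiom_star gm cf;
  co_stare : @axiom_star (tr P) ge gm kf;
  co_PBLm : axiom_PBL P;
  co_PBLe : axiom_PBL (tr P);
  co_POLm : axiom_POL gm;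
  co_POLe : axiom_POL ge }.

Arguments kf_full {P} X [A B A' B' p q a g] _ : rename.
Arguments cf_full {P} X [A B A' B' p q a g] _ : rename.
Arguments top_uniq {P} X [A B A' B' f f' g p q] _ _ : rename.
Arguments left_uniq {P} X [A B A' B' f f' g p q] _ _ : rename.
Arguments mm {P} X [A B] f [x u v] _ : rename.
Arguments me {P} X [A B] p [x u v] _ : rename.
Arguments co_D {P} X [A B A' B' f g p q] s : rename.
Arguments co_Km {P} X [A B] f [Z] _ : rename.
Arguments co_Ke {P} X [A B] f [Z] _ : rename.

(** * Duality by transposition *)

Section Dual.
Context (P : predouble).

Lemma dual_si_m_sq (S : shared_isos P) A B A' B' (f : hom (si_I S) A A')
    (f' : hom (si_I S) B B') (g : hom (mcat (tr P)) A B)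
    (g' : hom (mcat (tr P)) A' B') :
  inhabited (sq (tr P) g g' (si_m f) (si_m f')) <->
  si_e f ;; g' = g ;; si_e f'.
Proof.
split=> [/si_e_sq e|e]; first exact: esym.
by apply/si_e_sq; exact: esym.
Qed.

Lemma dual_si_e_sq (S : shared_isos P) A B A' B' (f : hom (si_I S) A B)
    (f' : hom (si_I S) A' B') (p : hom (ecat (tr P)) A A')
    (p' : hom (ecat (tr P)) B B') :
  inhabited (sq (tr P) (si_e f) (si_e f') p p') <->
  p ;; si_m f' = si_m f ;; p'.
Proof.
split=> [/si_m_sq e|e]; first exact: esym.
by apply/si_m_sq; exact: esym.
Qed.

Definition dual_isos (S : shared_isos P) : shared_isos (tr P) :=
  @SharedIsos (tr P) (si_I S) (@si_groupoid _ S) (@si_e _ S) (si_e_id S)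
    (@si_e_comp _ S) (@si_m _ S) (si_m_id S) (@si_m_comp _ S)
    (@si_e_creates _ S) (@si_m_creates _ S) (@dual_si_m_sq S)
    (fun A B A' B' f f' p p' s t => @si_e_sq_unique _ S A A' B B' f f' p p' s t)
    (@dual_si_e_sq S)
    (fun A B A' B' f f' p p' s t => @si_m_sq_unique _ S A A' B B' f f' p p' s t).

Lemma dual_Z : (exists Z : P, is_empty Z) -> exists Z : tr P, is_empty Z.
Proof. by move=> [Z [a b]]; exists Z. Qed.

Lemma dual_D (Gm : good_class (mcat P)) (Ge : good_class (ecat P))
    (k : kernel_functor Gm) (c : @kernel_functor (tr P) Ge) :
  axiom_D k c -> @axiom_D (tr P) Ge Gm c k.
Proof. by move=> d A B A' B' f g p q s; exact: iff_sym (d _ _ _ _ p q f g s). Qed.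

Definition dual (X : core P) : core (tr P) :=
  @Core (tr P) (thin_tr (co_thin X)) (ge X) (gm X) (cf X) (kf X)
    (cf_full X) (kf_full X) (left_uniq X) (top_uniq X) (dual_isos (co_isos X))
    (dual_Z (co_Z X)) (me X) (mm X) (dual_D (co_D X))
    (co_Ke X) (co_Km X) (@co_stare _ X) (@co_starm _ X) (@co_PBLe _ X) (@co_PBLm _ X)
    (@co_POLe _ X) (@co_POLm _ X).

End Dual.

(** * Kernel-cokernel pairs *)

(** In a thin double category only the existence of a square matters. *)
Definition sqr (P : predouble) A B A' B' (f : hom (mcat P) A B)
    (g : hom (mcat P) A' B') (p : hom (ecat P) A A') (q : hom (ecat P) B B') :=
  inhabited (sq P f g p q).

(** Stated for arbitrary representatives, because iterated quotients are rarely the chosen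
    cokernels. The notion is symmetric by [kcp_dual]. *)
Definition kcp (P : predouble) (X : core P) K B F (i : hom (mcat P) K B)
    (p : hom (ecat P) F B) : Prop :=
  exists j : hom (mcat P) K (ker (kf X) p), is_iso j /\ j ;; kmor (kf X) p = i.

Definition iso_pair (P : predouble) (X : core P) A B (u : hom (mcat P) A B)
    (v : hom (ecat P) A B) : Prop :=
  exists i : hom (si_I (co_isos X)) A B,
    si_m i = u /\ si_e i = v.

Section Squares.
Context {P : predouble} (X : core P).

Lemma sqr_hid A A' (p : hom (ecat P) A A') : sqr (idm _ A) (idm _ A') p p.
Proof. exact: (inhabits (hid P p)). Qed.

Lemma sqr_vid A B (f : hom (mcat P) A B) : sqr f f (idm _ A) (idm _ B).
Proof. exact: (inhabits (vid P f)). Qed.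

Lemma sqr_hcomp A B C A' B' C' (f : hom (mcat P) A B) (f' : hom (mcat P) B C)
    (g : hom (mcat P) A' B') (g' : hom (mcat P) B' C')
    (p : hom (ecat P) A A') (q : hom (ecat P) B B') (r : hom (ecat P) C C') :
  sqr f g p q -> sqr f' g' q r -> sqr (f ;; f') (g ;; g') p r.
Proof. by move=> [s] [t]; exact: (inhabits (hcomp s t)). Qed.

Lemma sqr_vcomp A B A' B' A'' B'' (f : hom (mcat P) A B)
    (g : hom (mcat P) A' B') (h : hom (mcat P) A'' B'') (p : hom (ecat P) A A')
    (p' : hom (ecat P) A' A'') (q : hom (ecat P) B B')
    (q' : hom (ecat P) B' B'') :
  sqr f g p q -> sqr g h p' q' -> sqr f h (p ;; p') (q ;; q').
Proof. by move=> [s] [t]; exact: (inhabits (vcomp s t)). Qed.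

Lemma sqr_hcancel A B C A' B' C' (f : hom (mcat P) A B) (f' : hom (mcat P) B C)
    (g : hom (mcat P) A' B') (g' : hom (mcat P) B' C')
    (p : hom (ecat P) A A') (q : hom (ecat P) B B') (r : hom (ecat P) C C') :
  sqr f' g' q r -> sqr (f ;; f') (g ;; g') p r -> sqr f g p q.
Proof. move=> s t; exact: (@co_PBLm _ X _ _ _ _ _ _ _ _ _ _ _ _ _ s t). Qed.

Lemma sqr_vcancel A B A' B' A'' B'' (f : hom (mcat P) A B)
    (g : hom (mcat P) A' B') (h : hom (mcat P) A'' B'') (p : hom (ecat P) A A')
    (p' : hom (ecat P) A' A'') (q : hom (ecat P) B B')
    (q' : hom (ecat P) B' B'') :
  sqr g h p' q' -> sqr f h (p ;; p') (q ;; q') -> sqr f g p q.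
Proof. move=> s t; exact: (@co_PBLe _ X _ _ _ _ _ _ _ _ _ _ _ _ _ s t). Qed.

Lemma iso_pair_m A B (u : hom (mcat P) A B) :
  is_iso u -> exists v, iso_pair X u v.
Proof.
by move=> /(si_m_creates (co_isos X)) [i [e _]]; exists (si_e i), i.
Qed.

Lemma iso_pair_e A B (v : hom (ecat P) A B) :
  is_iso v -> exists u, iso_pair X u v.
Proof.
by move=> /(si_e_creates (co_isos X)) [i [e _]]; exists (si_m i), i.
Qed.

Lemma iso_pair_iso_m A B (u : hom (mcat P) A B) v : iso_pair X u v -> is_iso u.
Proof.
move=> [i [<- _]]; have [j [e1 e2]] := si_groupoid i.
by exists (si_m j); rewrite -!si_m_comp e1 e2 !si_m_id.
Qed.

Lemma iso_pair_iso_e A B (u : hom (mcat P) A B) v : iso_pair X u v -> is_iso v.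
Proof.
move=> [i [_ <-]]; have [j [e1 e2]] := si_groupoid i.
by exists (si_e j); rewrite -!si_e_comp e1 e2 !si_e_id.
Qed.

Lemma iso_pair_id A : iso_pair X (idm _ A) (idm _ A).
Proof. by exists (idm _ A); rewrite si_m_id si_e_id. Qed.

Lemma iso_pair_uniq_e A B (u : hom (mcat P) A B) v v' :
  iso_pair X u v -> iso_pair X u v' -> v = v'.
Proof.
move=> iv; have iu := iso_pair_iso_m iv; case: iv => [i [ei <-]] [j [ej <-]].
have [l [_ el]] := si_m_creates (co_isos X) iu.
by rewrite -(el i ei) -(el j ej).
Qed.

Lemma iso_pair_comp A B C (u : hom (mcat P) A B) v (u' : hom (mcat P) B C) v' :
  iso_pair X u v -> iso_pair X u' v' -> iso_pair X (u ;; u') (v ;; v').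
Proof.
by move=> [i [<- <-]] [j [<- <-]]; exists (i ;; j); rewrite si_m_comp si_e_comp.
Qed.

Lemma iso_pair_sqr_e A B A' B' (u : hom (mcat P) A A') v
    (u' : hom (mcat P) B B') v' (g : hom (mcat P) A B)
    (g' : hom (mcat P) A' B') :
  iso_pair X u v -> iso_pair X u' v' ->
  (sqr g g' v v' <-> u ;; g' = g ;; u').
Proof. by move=> [i [<- <-]] [j [<- <-]]; exact: si_m_sq. Qed.

Lemma iso_pair_sqr_m A B A' B' (u : hom (mcat P) A B) v
    (u' : hom (mcat P) A' B') v' (p : hom (ecat P) A A')
    (p' : hom (ecat P) B B') :
  iso_pair X u v -> iso_pair X u' v' ->
  (sqr u u' p p' <-> p ;; v' = v ;; p').
Proof. by move=> [i [<- <-]] [j [<- <-]]; exact: si_e_sq. Qed.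

Lemma iso_pair_tr A B (u : hom (mcat P) A B) v :
  iso_pair X u v <-> iso_pair (dual X) v u.
Proof. by split=> -[i [e1 e2]]; exists i. Qed.

Lemma is_empty_m A Z (f : hom (mcat P) Z A) :
  is_iso f -> is_empty Z -> is_empty A.
Proof.
move=> i [e1 e2]; have [v /iso_pair_iso_e iv] := iso_pair_m i.
by split; [exact: initial_transport i e1 | exact: initial_transport iv e2].
Qed.

Lemma is_empty_e A Z (f : hom (ecat P) Z A) :
  is_iso f -> is_empty Z -> is_empty A.
Proof. by move=> /iso_pair_e [u /iso_pair_iso_m i]; exact: is_empty_m i. Qed.

Lemma is_empty_m_iso A B (f : hom (mcat P) A B) :
  is_empty A -> is_empty B -> is_iso f.
Proof. by move=> [e _] [e' _]; exact: initial_iso. Qed.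

Lemma is_empty_e_iso A B (f : hom (ecat P) A B) :
  is_empty A -> is_empty B -> is_iso f.
Proof. by move=> [_ e] [_ e']; exact: initial_iso. Qed.

Lemma is_empty_below_m A Z (f : hom (mcat P) A Z) :
  is_empty Z -> is_iso f /\ is_empty A.
Proof.
move=> z; have [g [e1 e2]] : is_iso f by apply: initial_monic_iso (mm X f) z.1.
by split; [exists g | apply: (is_empty_m _ z); exists f; split; first exact: e2].
Qed.

Lemma sqr_top_iso A B A' B' (f : hom (mcat P) A B) (f' : hom (mcat P) B A)
    (g : hom (mcat P) A' B') (g' : hom (mcat P) B' A') (p : hom (ecat P) A A')
    (q : hom (ecat P) B B') :
  sqr f g p q -> sqr f' g' q p -> g ;; g' = idm _ A' -> g' ;; g = idm _ B' ->
  is_iso f.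
Proof.
move=> s s' e e'; exists f'; split.
  apply: (top_uniq X (sqr_hcomp s s')); rewrite e; exact: sqr_hid.
apply: (top_uniq X (sqr_hcomp s' s)); rewrite e'; exact: sqr_hid.
Qed.

End Squares.

Section CokernelOfIdentity.
Context {P : predouble} (X : core P).

(** The distinguished square of (K) for the identity has an invertible kernel map. Its inverse
    lifts, by fullness, to a square backwards over the identity of [B], and the tops of the two
    squares are mutually inverse. *)
Lemma coker_id_empty B : is_empty (ker (cf X) (idm (mcat P) B) : P).
Proof.
have [Z z] := co_Z X.
have [u [v [s [b [b1 b2]]]]] := co_Km X (idm (mcat P) B) z.
have t := good_comm (kmap_good (kf X) s); rewrite composem1 in t.
have gb : good (gm X) (kmor (kf X) (kmor (cf X) (idm (mcat P) B))) b
    (idm _ B) (kmor (kf X) v).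
  apply: good_triangle; last by exists (kmap (kf X) s).
  by rewrite composem1 t composeA b2 compose1m.
have [u' s'] := kf_full X gb.
apply: (is_empty_m X _ z); apply: (sqr_top_iso X (inhabits s) s');
  exact: compose1m.
Qed.

(** The cokernels of [i] and of the identity are both empty, so fullness of [c] gives squares both
    ways between [i] and the identity. Their left sides form an e-isomorphism, whose m-counterpart
    is [i]. *)
Lemma coker_empty_iso A B (i : hom (mcat P) A B) :
  is_empty (ker (cf X) i : P) -> is_iso i.
Proof.
move=> z; have z1 := coker_id_empty B.
have [j _] := z.2 (ker (cf X) (idm (mcat P) B)).
have [j' _] := z1.2 (ker (cf X) i).
have [p s] : exists p : hom (ecat P) A B, sqr i (idm _ B) p (idm _ B).
  apply: (@cf_full _ X _ _ _ _ i (idm (mcat P) B) j).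
  apply: good_triangle; last exact: is_empty_e_iso.
  exact: (initial_uniq _ _ z.2).
have [p' s'] : exists p' : hom (ecat P) B A, sqr (idm _ B) i p' (idm _ B).
  apply: (@cf_full _ X _ _ _ _ (idm (mcat P) B) i j').
  apply: good_triangle; last exact: is_empty_e_iso.
  exact: (initial_uniq _ _ z1.2).
have ip : is_iso p.
  by apply: (@sqr_top_iso _ (dual X) _ _ _ _ p p' _ _ _ _ s s'); exact: compose1m.
have [u up] := iso_pair_e X ip.
have /(iso_pair_sqr_e _ _ up (iso_pair_id X B)) := s.
by rewrite !composem1 => <-; exact: iso_pair_iso_m up.
Qed.

(** The dual of (K) compares the cokernel of this kernel with that of an endomorphism of [Z],
    necessarily the identity; so it is empty. *)
Lemma ker_from_empty_iso Z A (v : hom (ecat P) Z A) :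
  is_empty Z -> is_iso (kmor (kf X) v).
Proof.
move=> z; have [u [w [s [b [b1 b2]]]]] := co_Ke X v (conj z.2 z.1).
apply: coker_empty_iso.
have e : is_empty (ker (cf X) w : P).
  have -> : w = idm (mcat P) Z by exact: initial_endo z.1.
  exact: coker_id_empty.
by apply: is_empty_e (kmap (cf X) s) _ e => //; exists b.
Qed.

(** The distinguished square of (K) identifies the kernel of [c(i)] with the kernel of an e-morphism
    from the empty object to [A], hence with [A]. *)
Lemma kcp_coker A B (i : hom (mcat P) A B) : kcp X i (kmor (cf X) i : hom (ecat P) _ _).
Proof.
have [Z z] := co_Z X.
have [u [v [s si]]] := co_Km X i z.
have t := good_comm (kmap_good (kf X) s).
have [w [w1 w2]] := ker_from_empty_iso v z.
exists (w ;; kmap (kf X) s); split.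
  by apply: iso_comp => //; exists (kmor (kf X) v).
by rewrite -composeA -t composeA w2 compose1m.
Qed.

Lemma kcp_ker F B (p : hom (ecat P) F B) : kcp X (kmor (kf X) p) p.
Proof. by exists (idm _ _); split; [exact: iso_id | rewrite compose1m]. Qed.

End CokernelOfIdentity.

Section KernelCokernelPairs.
Context {P : predouble} (X : core P).

(** Read as an e-isomorphism, the comparison of [K] with the kernel of [p] bounds squares from [i]
    to that kernel and back. The functor [c] turns them into factorizations of the two cokernels
    through each other. *)
Lemma kcp_to_dual K B F (i : hom (mcat P) K B) (p : hom (ecat P) F B) :
  kcp X i p -> @kcp (tr P) (dual X) _ _ _ p i.
Proof.
move=> [j [ij e]]; have [l [il el]] := @kcp_coker _ (dual X) _ _ p.
have [je jp] := iso_pair_m X ij.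
have [j' [j1 j2]] := ij.
have [je' jp'] := iso_pair_m X (iso_inv j1 j2).
have [s] : sqr i (kmor (kf X) p) je (idm _ B).
  by apply/(iso_pair_sqr_e _ _ jp (iso_pair_id X B)); rewrite composem1.
have [s'] : sqr (kmor (kf X) p) i je' (idm _ B).
  apply/(iso_pair_sqr_e _ _ jp' (iso_pair_id X B)).
  by rewrite composem1 -e composeA j2 compose1m.
have t := good_comm (kmap_good (cf X) s).
have t' := good_comm (kmap_good (cf X) s').
rewrite /= composem1 in t; rewrite /= composem1 in t'.
exists (l ;; kmap (cf X) s'); split.
  by apply: iso_comp il (iso_factors _ _ t' t); exact: me.
by rewrite /= -composeA -t'.
Qed.

End KernelCokernelPairs.

Lemma kcp_dual (P : predouble) (X : core P) K B F (i : hom (mcat P) K B)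
    (p : hom (ecat P) F B) : kcp X i p <-> @kcp (tr P) (dual X) _ _ _ p i.
Proof.
split; first exact: kcp_to_dual.
exact: (@kcp_to_dual (tr P) (dual X) _ _ _ p i).
Qed.

Section PairsAndSquares.
Context {P : predouble} (X : core P).

Lemma kcp_iso_l K K' B F (j : hom (mcat P) K' K) (i : hom (mcat P) K B)
    (p : hom (ecat P) F B) : is_iso j -> kcp X i p -> kcp X (j ;; i) p.
Proof.
move=> ij [l [il e]]; exists (j ;; l); split; first exact: iso_comp.
by rewrite -composeA e.
Qed.

Lemma kcp_iso_r K B F F' (j : hom (ecat P) F' F) (i : hom (mcat P) K B)
    (p : hom (ecat P) F B) : is_iso j -> kcp X i p -> kcp X i (j ;; p).
Proof.
move=> ij /kcp_dual [l [il e]]; apply/kcp_dual; exists (j ;; l).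
split; first exact: iso_comp.
by rewrite /= -composeA e.
Qed.

Lemma kcp_uniq_l K K' B F (i : hom (mcat P) K B) (i' : hom (mcat P) K' B)
    (p : hom (ecat P) F B) :
  kcp X i p -> kcp X i' p -> exists j, is_iso j /\ i = j ;; i'.
Proof.
move=> [j [ij <-]] [j' [[l [l1 l2]] <-]]; exists (j ;; l); split.
  by apply: iso_comp => //; exists j'.
by rewrite -composeA (composeA l) l2 compose1m.
Qed.

Lemma kcp_uniq_r K B F F' (i : hom (mcat P) K B) (p : hom (ecat P) F B)
    (p' : hom (ecat P) F' B) :
  kcp X i p -> kcp X i p' -> exists j, is_iso j /\ p = j ;; p'.
Proof.
move=> /kcp_dual [j [ij <-]] /kcp_dual [j' [[l [l1 l2]] <-]].
exists (j ;; l); split; first by apply: iso_comp => //; exists j'.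
by rewrite /= -composeA (composeA l) l2 compose1m.
Qed.

Lemma good_of_sqr K K' B B' F F' (i : hom (mcat P) K B)
    (i' : hom (mcat P) K' B') (p : hom (ecat P) F B) (p' : hom (ecat P) F' B')
    (f : hom (mcat P) F F') (g : hom (mcat P) B B') :
  kcp X i p -> kcp X i' p' -> sqr f g p p' -> exists a, good (gm X) i a g i'.
Proof.
move=> [j [ij e]] [j' [[l [l1 l2]] e']] [s]; exists (j ;; kmap (kf X) s ;; l).
have s1 := kmap_good (kf X) s.
have t1 : good (gm X) i j (idm _ B) (kmor (kf X) p).
  by apply: good_triangle; rewrite ?composem1.
have t2 : good (gm X) (kmor (kf X) p') l (idm _ B') i'.
  apply: good_triangle; last by exists j'.
  by rewrite composem1 -e' composeA l2 compose1m.
by have := good_comp (good_comp t1 s1) t2; rewrite compose1m composem1.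
Qed.

Lemma sqr_of_good K K' B B' F F' (i : hom (mcat P) K B)
    (i' : hom (mcat P) K' B') (p : hom (ecat P) F B) (p' : hom (ecat P) F' B')
    (a : hom (mcat P) K K') (g : hom (mcat P) B B') :
  kcp X i p -> kcp X i' p' -> good (gm X) i a g i' -> exists f, sqr f g p p'.
Proof.
move=> [j [[l [l1 l2]] e]] [j' [ij' e']] s.
apply: (@kf_full _ X _ _ _ _ p p' (l ;; a ;; j')).
have t1 : good (gm X) (kmor (kf X) p) l (idm _ B) i.
  apply: good_triangle; last by exists j.
  by rewrite composem1 -e composeA l2 compose1m.
have t2 : good (gm X) i' j' (idm _ B') (kmor (kf X) p').
  by apply: good_triangle; rewrite ?composem1.
by have := good_comp (good_comp t1 s) t2; rewrite compose1m composem1.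
Qed.

Lemma kcp_iso_empty K B F (i : hom (mcat P) K B) (p : hom (ecat P) F B) :
  kcp X i p -> is_iso i -> is_empty F.
Proof.
move=> k ii; have k1 := kcp_iso_l ii (kcp_coker X (idm _ B)).
rewrite composem1 in k1; have [j [[j' [j1 j2]] _]] := kcp_uniq_r k k1.
exact: is_empty_e X _ _ _ (iso_inv j1 j2) (coker_id_empty X B).
Qed.

Lemma kcp_empty_iso K B F (i : hom (mcat P) K B) (p : hom (ecat P) F B) :
  kcp X i p -> is_empty F -> is_iso i.
Proof.
move=> k z; have [j [ij e]] := kcp_uniq_r k (kcp_coker X i).
by apply: (coker_empty_iso (X := X)); exact: is_empty_e X _ _ _ ij z.
Qed.

Definition dist A B A' B' (f : hom (mcat P) A B) (g : hom (mcat P) A' B')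
    (p : hom (ecat P) A A') (q : hom (ecat P) B B') : Prop :=
  exists s : sq P f g p q, distinguished (kf X) s.

(** The map of kernels of the square is the comparison of [i ;; g] with the kernel of [q]. *)
Lemma dist_kcp A B A' B' (f : hom (mcat P) A B) (g : hom (mcat P) A' B')
    (p : hom (ecat P) A A') (q : hom (ecat P) B B') K
    (i : hom (mcat P) K A') :
  kcp X i p -> (dist f g p q <-> sqr f g p q /\ kcp X (i ;; g) q).
Proof.
move=> [j [ij e]]; split=> [[s d]|[[s] [j' [ij' e']]]].
  split=> //; exists (j ;; kmap (kf X) s); split; first exact: iso_comp.
  by rewrite -e -!composeA -(good_comm (kmap_good (kf X) s)).
exists s; apply: (iso_cancel_l ij).
have -> : j ;; kmap (kf X) s = j' => //.
apply: (mm X (kmor (kf X) q)).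
by rewrite e' -composeA -(good_comm (kmap_good (kf X) s)) composeA e.
Qed.

End PairsAndSquares.

Lemma dist_tr (P : predouble) (X : core P) A B A' B' (f : hom (mcat P) A B)
    (g : hom (mcat P) A' B') (p : hom (ecat P) A A') (q : hom (ecat P) B B') :
  dist X f g p q <-> dist (dual X) p q f g.
Proof. by split=> [] [s d]; exists s; apply/(co_D X). Qed.

Section ThirdIsomorphism.
Context {P : predouble} (X : core P).

Lemma good_of_sqr_e K K' B B' F F' (i : hom (mcat P) K B)
    (i' : hom (mcat P) K' B') (p : hom (ecat P) F B) (p' : hom (ecat P) F' B')
    (a : hom (ecat P) K K') (r : hom (ecat P) B B') :
  kcp X i p -> kcp X i' p' -> sqr i i' a r -> exists b, good (ge X) p b r p'.
Proof.
move=> /kcp_dual k /kcp_dual k' s; exact: (good_of_sqr k k' s).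
Qed.

Lemma sqr_of_good_e K K' B B' F F' (i : hom (mcat P) K B)
    (i' : hom (mcat P) K' B') (p : hom (ecat P) F B) (p' : hom (ecat P) F' B')
    (b : hom (ecat P) F F') (r : hom (ecat P) B B') :
  kcp X i p -> kcp X i' p' -> good (ge X) p b r p' -> exists a, sqr i i' a r.
Proof.
move=> /kcp_dual k /kcp_dual k' s; exact: (sqr_of_good k k' s).
Qed.

Lemma dist_kcp_e A B A' B' (f : hom (mcat P) A B) (g : hom (mcat P) A' B')
    (p : hom (ecat P) A A') (q : hom (ecat P) B B') F (s : hom (ecat P) F B) :
  kcp X f s -> (dist X f g p q <-> sqr f g p q /\ kcp X g (s ;; q)).
Proof.
move=> /kcp_dual k; rewrite dist_tr (dist_kcp _ _ _ k).
by split=> -[t /kcp_dual u]; split.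
Qed.

Lemma dist_exists A' B' K (g : hom (mcat P) A' B') A (p : hom (ecat P) A A') B
    (q : hom (ecat P) B B') (i : hom (mcat P) K A') :
  kcp X i p -> kcp X (i ;; g) q -> exists f, dist X f g p q.
Proof.
move=> k k'.
have [f s] : exists f, sqr f g p q.
  apply: (sqr_of_good (a := idm _ K) k k'); apply: good_triangle (iso_id _).
  by rewrite compose1m.
by exists f; apply/(dist_kcp _ _ _ k).
Qed.

(* In the notation of quotients, [n : B/A -> C/A] and C/B = (C/A)/(B/A). *)
Lemma third_iso A B C F G H (i : hom (mcat P) A B) (m : hom (mcat P) B C)
    (p : hom (ecat P) F B) (q : hom (ecat P) G C) (r : hom (ecat P) H C) :
  kcp X i p -> kcp X (i ;; m) q -> kcp X m r ->
  exists n s, [/\ sqr n m p q, kcp X n s & s ;; q = r].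
Proof.
move=> k1 k2 k3; have [n d] := dist_exists k1 k2.
have kn := kcp_coker X n.
have [sn k4] := (dist_kcp_e _ _ _ kn).1 d.
have [j [ij e]] := kcp_uniq_r k3 k4.
exists n, (j ;; kmor (cf X) n); split=> //.
- exact: kcp_iso_r.
- by rewrite -composeA -e.
Qed.

End ThirdIsomorphism.

Section GoodCancellation.
Context {P : predouble} (X : core P).

(** Pass to cokernels. The two good squares give squares on [C/A] and [C/B]; since [C/B] is the
    quotient of [C/A] by [B/A], (PBL) in the e-direction relates them and yields a map of [B/A].
    Then (PBL) in the m-direction makes this a square over [b], which is the good square sought. *)
Lemma good_cancel A B C A' B' C' (f : hom (mcat P) A B) (m : hom (mcat P) B C)
    (f' : hom (mcat P) A' B') (m' : hom (mcat P) B' C') (a : hom (mcat P) A A')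
    (b : hom (mcat P) B B') (c : hom (mcat P) C C') :
  good (gm X) m b c m' -> good (gm X) (f ;; m) a c (f' ;; m') ->
  good (gm X) f a b f'.
Proof.
move=> g1 g2.
have kf1 := kcp_coker X f; have kf1' := kcp_coker X f'.
have km := kcp_coker X m; have km' := kcp_coker X m'.
have kc := kcp_coker X (f ;; m); have kc' := kcp_coker X (f' ;; m').
have [y sy] := sqr_of_good kc kc' g2.
have [z sz] := sqr_of_good km km' g1.
have [n [s [sn kn es]]] := third_iso kf1 kc km.
have [n' [s' [sn' kn' es']]] := third_iso kf1' kc' km'.
have syz : sqr z y s s'.
  by apply: (sqr_vcancel X sy); rewrite es es'.
have [w gw] := good_of_sqr kn kn' syz.
have [u su] : exists u, sqr u b (kmor (cf X) f : hom (ecat P) _ _) (kmor (cf X) f').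
  exists w; apply: (sqr_hcancel X sn').
  rewrite -(good_comm g1) -(good_comm gw); exact: sqr_hcomp sn sy.
have [a' ga] := good_of_sqr kf1 kf1' su.
have -> : a = a' => //; apply: (mm X f'); apply: (mm X m').
rewrite -composeA -(good_comm g2) -(good_comm ga) -!composeA.
by rewrite (good_comm g1).
Qed.

End GoodCancellation.

(** * Quotients of good squares and good cubes *)

Section Totals.
Context {P : predouble} (X : core P).

(** The axiom concerns the chosen cokernels; shared isomorphisms turn the comparisons with other
    representatives into m-isomorphisms that conjugate [n] to the induced map. *)
Lemma induced_iso_kcp A B C D (f : hom (mcat P) A B) (g : hom (mcat P) A C)
    (h : hom (mcat P) B D) (k : hom (mcat P) C D) F G (x : hom (ecat P) F B)
    (z : hom (ecat P) G D) (n : hom (mcat P) F G) :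
  is_star (gm X) f g h k -> kcp X f x -> kcp X k z -> sqr n h x z -> is_iso n.
Proof.
move=> st kx kz sn; have [[n' [sn' i']] _] := (@co_starm _ X _ _ _ f g
  (ex_intro _ D (ex_intro _ h (ex_intro _ k st.1)))).2 D h k st.
have [j [ij e]] := kcp_uniq_r kx (kcp_coker X f).
have [l [il e']] := kcp_uniq_r kz (kcp_coker X k).
have [jm jp] := iso_pair_e X ij.
have [lm lp] := iso_pair_e X il.
have sj : sqr jm (idm _ B) x (kmor (cf X) f).
  by apply/(iso_pair_sqr_m _ _ jp (iso_pair_id X B)); rewrite composem1.
have sl : sqr lm (idm _ D) z (kmor (cf X) k).
  by apply/(iso_pair_sqr_m _ _ lp (iso_pair_id X D)); rewrite composem1.
have e1 : n ;; lm = jm ;; n'.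
  apply: (top_uniq X (sqr_hcomp sn sl)); rewrite composem1 -(compose1m h).
  exact: sqr_hcomp sj sn'.
apply: (iso_cancel_r (iso_pair_iso_m lp)); rewrite e1.
by apply: iso_comp i'; exact: iso_pair_iso_m jp.
Qed.

(* For a good square with star-pushout S, the object D/S is the double quotient
   (D/C)/(B/A). *)
Lemma total_quotient A B C D S (f : hom (mcat P) A B) (g : hom (mcat P) A C)
    (h : hom (mcat P) B D) (k : hom (mcat P) C D) (p : hom (mcat P) B S)
    (q : hom (mcat P) C S) (u : hom (mcat P) S D) F G T
    (x : hom (ecat P) F B) (z : hom (ecat P) G D) (n : hom (mcat P) F G)
    (w : hom (ecat P) T D) :
  is_star (gm X) f g p q -> p ;; u = h -> q ;; u = k ->
  kcp X f x -> kcp X k z -> sqr n h x z -> kcp X u w ->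
  exists s, kcp X n s /\ s ;; z = w.
Proof.
move=> st eh ek kx kz sn kw.
have kq := kcp_coker X q; rewrite -ek in kz.
have [n' [s [sn' kn' e]]] := third_iso kq kz kw.
exists s; split=> //.
have [i si] := sqr_of_good kx kq st.1.
have ii := induced_iso_kcp st kx kq si.
have -> : n = i ;; n'.
  by apply: (top_uniq X sn); rewrite -eh; exact: sqr_hcomp si sn'.
exact: kcp_iso_l.
Qed.

Lemma good_star_exists A B C D (f : hom (mcat P) A B) (g : hom (mcat P) A C)
    (h : hom (mcat P) B D) (k : hom (mcat P) C D) :
  good (gm X) f g h k ->
  exists S (p : hom (mcat P) B S) (q : hom (mcat P) C S) u,
    [/\ is_star (gm X) f g p q, p ;; u = h & q ;; u = k].
Proof.
move=> s; have [[S [p [q st]]] _] := @co_starm _ X _ _ _ f g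
  (ex_intro _ D (ex_intro _ h (ex_intro _ k s))).
by have [u [e1 e2]] := star_desc st s; exists S, p, q, u; split.
Qed.

(** Exchanges a cokernel taken in one direction for one taken in the other, compatibly with the maps
    to [D]: both are cokernels of the same [u]. *)
Lemma nine A B C D (f : hom (mcat P) A B) (g : hom (mcat P) A C)
    (h : hom (mcat P) B D) (k : hom (mcat P) C D) F G H I T
    (x : hom (ecat P) F B) (z : hom (ecat P) G D) (n : hom (mcat P) F G)
    (x' : hom (ecat P) H C) (z' : hom (ecat P) I D) (n' : hom (mcat P) H I)
    (s : hom (ecat P) T G) :
  good (gm X) f g h k ->
  kcp X f x -> kcp X k z -> sqr n h x z ->
  kcp X g x' -> kcp X h z' -> sqr n' k x' z' ->
  kcp X n s -> exists s', kcp X n' s' /\ s' ;; z' = s ;; z.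
Proof.
move=> gd kx kz sn kx' kz' sn' ks.
have [S [p [q [u [st e1 e2]]]]] := good_star_exists gd.
have kw := kcp_coker X u.
have [t [kt et]] := total_quotient st e1 e2 kx kz sn kw.
have [t' [kt' et']] := total_quotient (star_tr st) e2 e1 kx' kz' sn' kw.
have [j [ij ej]] := kcp_uniq_r ks kt.
exists (j ;; t'); split; first exact: kcp_iso_r.
by rewrite -composeA et' -et composeA -ej.
Qed.

(** A converse of (star): the cokernel of [n] is also that of [u : S >-> D]. If [n] is invertible it
    is empty, so [u] is invertible. *)
Lemma star_of_quotient_iso A B C D (f : hom (mcat P) A B) (g : hom (mcat P) A C)
    (h : hom (mcat P) B D) (k : hom (mcat P) C D) F G
    (x : hom (ecat P) F B) (z : hom (ecat P) G D) (n : hom (mcat P) F G) :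
  good (gm X) f g h k ->
  kcp X f x -> kcp X k z -> sqr n h x z -> is_iso n -> is_star (gm X) f g h k.
Proof.
move=> gd kx kz sn iso_n.
have [S [p [q [u [st e1 e2]]]]] := good_star_exists gd.
have kw := kcp_coker X u.
have [s [ks _]] := total_quotient st e1 e2 kx kz sn kw.
rewrite -e1 -e2; apply: star_iso st _.
exact: kcp_empty_iso kw (kcp_iso_empty ks iso_n).
Qed.

Lemma quotient_map A B C D (f : hom (mcat P) A B) (g : hom (mcat P) A C)
    (h : hom (mcat P) B D) (k : hom (mcat P) C D) :
  good (gm X) f g h k -> exists n : hom (mcat P) (ker (cf X) f) (ker (cf X) k),
    sqr n h (kmor (cf X) f : hom (ecat P) _ _) (kmor (cf X) k).
Proof. exact: sqr_of_good (kcp_coker X f) (kcp_coker X k). Qed.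

Section Cube.
Context {A B C D A' B' C' D' : P}.
Context {f : hom (mcat P) A B} {g : hom (mcat P) A C} {h : hom (mcat P) B D}
  {k : hom (mcat P) C D} {f' : hom (mcat P) A' B'} {g' : hom (mcat P) A' C'}
  {h' : hom (mcat P) B' D'} {k' : hom (mcat P) C' D'} {a : hom (mcat P) A A'}
  {b : hom (mcat P) B B'} {c : hom (mcat P) C C'} {d : hom (mcat P) D D'}.

Definition good_faces : Prop :=
  [/\ good (gm X) f g h k, good (gm X) f' g' h' k',
      good (gm X) f a b f' /\ good (gm X) g a c g' &
      good (gm X) h b d h' /\ good (gm X) k c d k'].

Context {F G F' G' : P}.
Context {x : hom (ecat P) F B} {z : hom (ecat P) G D} {n : hom (mcat P) F G}
  {x' : hom (ecat P) F' B'} {z' : hom (ecat P) G' D'} {n' : hom (mcat P) F' G'}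
  {m : hom (mcat P) F F'} {l : hom (mcat P) G G'}.

(* [n, n', m, l] are the sides of the square of quotients in the direction of
   [f]. *)
Definition quotient_square : Prop :=
  [/\ kcp X f x /\ kcp X k z, kcp X f' x' /\ kcp X k' z',
      sqr n h x z /\ sqr n' h' x' z' & sqr m b x x' /\ sqr l d z z'].

(** The good square of quotients lifts to a square on the cokernels of [n] and [n']. Stacked on the
    square of [l] and [d] it becomes a square on the cokernels of [u] and [u'], whose map of kernels
    is [t]. *)
Lemma star_good_of_quotient S S' (p : hom (mcat P) B S) (q : hom (mcat P) C S)
    (p' : hom (mcat P) B' S') (q' : hom (mcat P) C' S') (u : hom (mcat P) S D)
    (u' : hom (mcat P) S' D') :
  good_faces -> quotient_square ->
  is_star (gm X) f g p q -> is_star (gm X) f' g' p' q' ->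
  p ;; u = h -> q ;; u = k -> p' ;; u' = h' -> q' ;; u' = k' ->
  good (gm X) n m l n' -> exists t, [/\ good (gm X) u t d u',
    p ;; t = b ;; p' & q ;; t = c ;; q'].
Proof.
move=> [_ _ [gb gc] [gh gk]] [[kx kz] [kx' kz'] [sn sn'] [sm sl]].
move=> st st' eh ek eh' ek' gn.
have kw := kcp_coker X u; have kw' := kcp_coker X u'.
have [s [ks es]] := total_quotient st eh ek kx kz sn kw.
have [s' [ks' es']] := total_quotient st' eh' ek' kx' kz' sn' kw'.
have [y sy] := sqr_of_good ks ks' gn.
have sw := sqr_vcomp sy sl; rewrite es es' in sw.
have [t gt] := good_of_sqr kw kw' sw.
have e := good_comm gt; exists t; split=> //; apply: (mm X u').
  by rewrite -composeA -e composeA eh -composeA eh' (good_comm gh).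
by rewrite -composeA -e composeA ek -composeA ek' (good_comm gk).
Qed.

(** The same passage backwards: (PBL) strips off the square of [l] and [d], and [top_uniq]
    recognizes [m] in the map obtained. *)
Lemma quotient_good_of_star S S' (p : hom (mcat P) B S) (q : hom (mcat P) C S)
    (p' : hom (mcat P) B' S') (q' : hom (mcat P) C' S') (u : hom (mcat P) S D)
    (u' : hom (mcat P) S' D') (t : hom (mcat P) S S') :
  good_faces -> quotient_square ->
  is_star (gm X) f g p q -> is_star (gm X) f' g' p' q' ->
  p ;; u = h -> q ;; u = k -> p' ;; u' = h' -> q' ;; u' = k' ->
  good (gm X) u t d u' -> good (gm X) n m l n'.
Proof.
move=> [_ _ _ [gh _]] [[kx kz] [kx' kz'] [sn sn'] [sm sl]].
move=> st st' eh ek eh' ek' gt.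
have kw := kcp_coker X u; have kw' := kcp_coker X u'.
have [s [ks es]] := total_quotient st eh ek kx kz sn kw.
have [s' [ks' es']] := total_quotient st' eh' ek' kx' kz' sn' kw'.
have [y sy] := sqr_of_good kw kw' gt; rewrite -es -es' in sy.
have [m' gm'] := good_of_sqr ks ks' (sqr_vcancel X sl sy).
have -> : m = m' => //; apply: (mm X n'); rewrite -(good_comm gm').
apply: (top_uniq X (sqr_hcomp sm sn')).
rewrite -(good_comm gh); exact: sqr_hcomp sn sl.
Qed.

Lemma good_cubeP :
  quotient_square ->
  (good_cube (gm X) f g h k f' g' h' k' a b c d <->
   good_faces /\ good (gm X) n m l n').
Proof.
move=> qs; split.
  move=> [g1 [g2 [g3 [g4 [g5 [g6 [S [p [q [S' [p' [q' [u [u' [t]]]]]]]]]]]]]]].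
  move=> [[st st'] [[e1 e2] [[e3 e4] [_ gt]]]].
  have gf : good_faces by [].
  by split=> //; exact: (quotient_good_of_star gf qs st st' e1 e2 e3 e4 gt).
move=> [gf gn]; have [g1 g2 [g3 g4] [g5 g6]] := gf.
do 6![split=> //].
have [S [p [q [u [st e1 e2]]]]] := good_star_exists g1.
have [S' [p' [q' [u' [st' e3 e4]]]]] := good_star_exists g2.
have [t [gt e5 e6]] := star_good_of_quotient gf qs st st' e1 e2 e3 e4 gn.
by exists S, p, q, S', p', q', u, u', t.
Qed.

Lemma good_cube_faces :
  good_cube (gm X) f g h k f' g' h' k' a b c d -> good_faces.
Proof. by move=> [? [? [? [? [? [? _]]]]]]. Qed.

(** With [D] as the star-pushout of the initial face, the remaining square has an identity as its
    first side. *)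
Lemma star_good_cube :
  good_faces -> is_star (gm X) f g h k ->
  good_cube (gm X) f g h k f' g' h' k' a b c d.
Proof.
move=> [g1 g2 [g3 g4] [g5 g6]] st; do 6![split=> //].
have [S' [p' [q' [u' [st' e3 e4]]]]] := good_star_exists g2.
have [t [e5 e6]] := star_desc st (good_legs g3 g4 st'.1).
exists D, h, k, S', p', q', (idm _ D), u', t; do 2![split; rewrite ?composem1 //].
split=> //; split=> //; apply: good_iso_top (iso_id _).
rewrite compose1m; apply: (star_epi st).
  by rewrite composeA e5 -composeA e3 (good_comm g5).
by rewrite composeA e6 -composeA e4 (good_comm g6).
Qed.

End Cube.

Lemma quotient_square_exists A B C D A' B' C' D'
    (f : hom (mcat P) A B) (g : hom (mcat P) A C) (h : hom (mcat P) B D)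
    (k : hom (mcat P) C D) (f' : hom (mcat P) A' B') (g' : hom (mcat P) A' C')
    (h' : hom (mcat P) B' D') (k' : hom (mcat P) C' D') (a : hom (mcat P) A A')
    (b : hom (mcat P) B B') (c : hom (mcat P) C C') (d : hom (mcat P) D D') :
  @good_faces A B C D A' B' C' D' f g h k f' g' h' k' a b c d ->
  exists n n' m l, @quotient_square A B C D A' B' C' D' f h k f' h' k' b d
    _ _ _ _ (kmor (cf X) f) (kmor (cf X) k) n (kmor (cf X) f')
    (kmor (cf X) k') n' m l.
Proof.
move=> [/quotient_map [n sn] /quotient_map [n' sn'] [/quotient_map [m sm] _]
  [_ /quotient_map [l sl]]].
by exists n, n', m, l; do !split=> //; exact: kcp_coker.
Qed.

Section CubeSymmetries.
Context {A B C D A' B' C' D' : P}.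
Context {f : hom (mcat P) A B} {g : hom (mcat P) A C} {h : hom (mcat P) B D}
  {k : hom (mcat P) C D} {f' : hom (mcat P) A' B'} {g' : hom (mcat P) A' C'}
  {h' : hom (mcat P) B' D'} {k' : hom (mcat P) C' D'} {a : hom (mcat P) A A'}
  {b : hom (mcat P) B B'} {c : hom (mcat P) C C'} {d : hom (mcat P) D D'}.

Lemma good_cube_swap12 :
  good_cube (gm X) f g h k f' g' h' k' a b c d ->
  good_cube (gm X) g f k h g' f' k' h' a c b d.
Proof.
move=> [g1 [g2 [g3 [g4 [g5 [g6 [S [p [q [S' [p' [q' [u [u' [t]]]]]]]]]]]]]]].
move=> [[st st'] [[e1 e2] [[e3 e4] [[e5 e6] gt]]]].
split; first exact: good_flip.
split; first exact: good_flip.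
do 4![split=> //].
exists S, q, p, S', q', p', u, u', t; split=> //.
by split; exact: star_tr.
Qed.

(** The two directions other than that of [f] enter the quotient square symmetrically, so exchanging
    them only transposes it. With [good_cube_swap12] this generates all permutations of the
    directions. *)
Lemma good_cube_swap23 :
  good_cube (gm X) f g h k f' g' h' k' a b c d ->
  good_cube (gm X) f a b f' k c d k' g h g' h'.
Proof.
move=> gc; have gf := good_cube_faces gc.
have [n [n' [m [l qs]]]] := quotient_square_exists gf.
have [_ gn] := (good_cubeP qs).1 gc.
have [[? ?] [? ?] [? ?] [? ?]] := qs; have [? ? [? ?] [? ?]] := gf.
apply/(good_cubeP (n := m) (n' := l) (m := n) (l := n')); last first.
  split; last exact: good_flip.
  by split=> //; split=> //; exact: good_flip.
by split; split; eassumption.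
Qed.

End CubeSymmetries.

Section QuotientFace.
Context {A B C D A' B' C' D' : P}.
Context {f : hom (mcat P) A B} {g : hom (mcat P) A C} {h : hom (mcat P) B D}
  {k : hom (mcat P) C D} {f' : hom (mcat P) A' B'} {g' : hom (mcat P) A' C'}
  {h' : hom (mcat P) B' D'} {k' : hom (mcat P) C' D'} {a : hom (mcat P) A A'}
  {b : hom (mcat P) B B'} {c : hom (mcat P) C C'} {d : hom (mcat P) D D'}.
Context {qA qB qC qD : P}.
Context {xA : hom (ecat P) qA A'} {xB : hom (ecat P) qB B'}
  {xC : hom (ecat P) qC C'} {xD : hom (ecat P) qD D'}
  {nf : hom (mcat P) qA qB} {ng : hom (mcat P) qA qC} {nh : hom (mcat P) qB qD}
  {nk : hom (mcat P) qC qD}.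

(* [nf, ng, nh, nk] is the square of quotients in the connecting direction. *)
Definition quotient_face : Prop :=
  [/\ kcp X a xA /\ kcp X b xB, kcp X c xC /\ kcp X d xD,
      sqr nf f' xA xB /\ sqr ng g' xA xC & sqr nh h' xB xD /\ sqr nk k' xC xD].

Lemma good_cube_faceP :
  quotient_face ->
  (good_cube (gm X) f g h k f' g' h' k' a b c d <->
   @good_faces A B C D A' B' C' D' f g h k f' g' h' k' a b c d /\
   good (gm X) nf ng nh nk).
Proof.
move=> [[? ?] [? ?] [? ?] [? ?]].
have qs : @quotient_square _ _ _ _ _ _ _ _ a f' b c k' d g' h' qA qB qC qD
    xA xB nf xC xD nk ng nh by [].
split=> [gc|[gf gn]].
  have gc' := good_cube_swap12 (good_cube_swap23 gc).
  by split; [exact: good_cube_faces gc | case: (proj1 (good_cubeP qs) gc')].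
have [? ? [? ?] [? ?]] := gf.
apply: good_cube_swap23; apply: good_cube_swap12; apply/(good_cubeP qs).
split; last by [].
by split; [exact: good_flip | exact: good_flip | split=> //; exact: good_flip..].
Qed.

End QuotientFace.

End Totals.

Arguments good_faces {P} X {A B C D A' B' C' D'} f g h k f' g' h' k' a b c d.
Arguments quotient_square {P} X {A B C D A' B' C' D'} f h k f' h' k' b d
  {F G F' G'} x z n x' z' n' m l.
Arguments quotient_face {P} X {A B C D A' B' C' D'} f' g' h' k' a b c d
  {qA qB qC qD} xA xB xC xD nf ng nh nk.

(** * Quotients of star-pushouts and e-morphisms between star-pushouts *)

Section StarQuotients.
Context {P : predouble} (X : core P).

Lemma sqr_of_good_iso K K' B B' F F' (i : hom (mcat P) K B)
    (i' : hom (mcat P) K' B') (p : hom (ecat P) F B) (p' : hom (ecat P) F' B')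
    (a : hom (mcat P) K K') (g : hom (mcat P) B B') (f : hom (mcat P) F F') :
  kcp X i p -> kcp X i' p' -> good (gm X) i a g i' -> sqr f g p p' ->
  is_iso a -> is_iso g -> is_iso f.
Proof.
move=> k k' s sf [a' [a1 a2]] [g' [g1 g2]].
have gi : good (gm X) i' a' g' i.
  apply: good_triangle; last by exists a.
  apply: (iso_epic (f := a)); first by exists a'.
  rewrite composeA -(good_comm s) -composeA g1 composem1.
  by rewrite composeA a1 compose1m.
have [f' sf'] := sqr_of_good k' k gi.
exact: (sqr_top_iso X sf sf').
Qed.

Section Face.
Context {A B C D A' B' C' D' : P}.
Context {f : hom (mcat P) A B} {g : hom (mcat P) A C} {h : hom (mcat P) B D}
  {k : hom (mcat P) C D} {f' : hom (mcat P) A' B'} {g' : hom (mcat P) A' C'}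
  {h' : hom (mcat P) B' D'} {k' : hom (mcat P) C' D'} {a : hom (mcat P) A A'}
  {b : hom (mcat P) B B'} {c : hom (mcat P) C C'} {d : hom (mcat P) D D'}.
Context {qA qB qC qD : P}.
Context {xA : hom (ecat P) qA A'} {xB : hom (ecat P) qB B'}
  {xC : hom (ecat P) qC C'} {xD : hom (ecat P) qD D'}
  {nf : hom (mcat P) qA qB} {ng : hom (mcat P) qA qC} {nh : hom (mcat P) qB qD}
  {nk : hom (mcat P) qC qD}.

(** The cube is good, hence so is the quotient face, and by [star_of_quotient_iso] it remains to
    invert its induced map on cokernels. By [nine] this is the induced map [y'] on the cokernels of
    [m] and [l], which is invertible because (star) makes [n] and [n'] so. *)
Lemma star_quotient :
  good_faces X f g h k f' g' h' k' a b c d ->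
  quotient_face X f' g' h' k' a b c d xA xB xC xD nf ng nh nk ->
  is_star (gm X) f g h k -> is_star (gm X) f' g' h' k' ->
  is_star (gm X) nf ng nh nk.
Proof.
move=> gf qf st st'.
have gc := star_good_cube gf st.
have [_ gn] := (good_cube_faceP qf).1 gc.
have [n [n' [m [l qs]]]] := quotient_square_exists gf.
have [_ gq] := (good_cubeP qs).1 gc.
have [[ka kb] [kc kd] [snf sng] [snh snk]] := qf.
have [[kf kk] [kf' kk'] [sn sn'] [sm sl]] := qs.
have [g1 g2 [g3 g4] [g5 g6]] := gf.
have iso_n := induced_iso_kcp st kf kk sn.
have iso_n' := induced_iso_kcp st' kf' kk' sn'.
have km := kcp_coker X m; have kl := kcp_coker X l.
have [t [kt et]] := nine g3 kf kf' sm ka kb snf km.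
have [t' [kt' et']] := nine g6 kk kk' sl kc kd snk kl.
have [y sy] := sqr_of_good kt kt' gn.
have [y' sy'] := sqr_of_good km kl (good_flip gq).
have iso_y' := sqr_of_good_iso km kl (good_flip gq) sy' iso_n iso_n'.
have ey : y = y'.
  apply: (top_uniq X (sqr_vcomp sy snh)); rewrite et et'.
  exact: sqr_vcomp sy' sn'.
rewrite -ey in iso_y'.
exact: (star_of_quotient_iso gn kt kt' sy iso_y').
Qed.

End Face.

(** This is (POL), its outer square being pasted from the square of [g] and [c] and the target
    square. *)
Lemma star_nat A B C S A' B' C' D' (f : hom (mcat P) A B) (g : hom (mcat P) A C)
    (p : hom (mcat P) B S) (q : hom (mcat P) C S) (f' : hom (mcat P) A' B')
    (g' : hom (mcat P) A' C') (h' : hom (mcat P) B' D') (k' : hom (mcat P) C' D')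
    (a : hom (mcat P) A A') (b : hom (mcat P) B B') (c : hom (mcat P) C C')
    (t : hom (mcat P) S D') :
  is_star (gm X) f g p q -> good (gm X) f a b f' -> good (gm X) g a c g' ->
  good (gm X) f' g' h' k' -> p ;; t = b ;; h' -> q ;; t = c ;; k' ->
  good (gm X) p b t h'.
Proof.
move=> st gb gc gd ep eq; apply: good_flip.
apply: (@co_POLm _ X _ _ _ _ _ _ f g p q b t h' st (esym ep)).
rewrite (good_comm gb) eq.
exact: (good_hcomp (good_flip gc) gd).
Qed.

Section StarOfE.
Context {A B C S A' B' C' S' : P}.
Context {f : hom (mcat P) A B} {g : hom (mcat P) A C} {p : hom (mcat P) B S}
  {q : hom (mcat P) C S} {f' : hom (mcat P) A' B'} {g' : hom (mcat P) A' C'}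
  {p' : hom (mcat P) B' S'} {q' : hom (mcat P) C' S'} {al : hom (ecat P) A A'}
  {be : hom (ecat P) B B'} {ga : hom (ecat P) C C'}.
Context {KA KB KC : P} {iA : hom (mcat P) KA A'} {iB : hom (mcat P) KB B'}
  {iC : hom (mcat P) KC C'} {uf : hom (mcat P) KA KB} {ug : hom (mcat P) KA KC}.

Hypotheses (st : is_star (gm X) f g p q) (st' : is_star (gm X) f' g' p' q')
  (sf : sqr f f' al be) (sg : sqr g g' al ga).
Hypotheses (kA : kcp X iA al) (kB : kcp X iB be) (kC : kcp X iC ga)
  (gf : good (gm X) iA uf f' iB) (gg : good (gm X) iA ug g' iC).

(* An e-morphism of star-pushouts is the cokernel of the induced m-morphism
   between the star-pushout of the kernels and the target.  For uniqueness, any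
   other one factors through it by some [s], which (D) shows to be invertible:
   [s] is an isomorphism on cokernels by (star). *)
Lemma star_e_exists_unique :
  exists sg : hom (ecat P) S S', [/\ sqr p p' be sg, sqr q q' ga sg,
    (forall sg', sqr p p' be sg' -> sqr q q' ga sg' -> sg' = sg) &
    exists KS (vp : hom (mcat P) KB KS) (vq : hom (mcat P) KC KS)
      (iS : hom (mcat P) KS S'),
      [/\ is_star (gm X) uf ug vp vq, kcp X iS sg, vp ;; iS = iB ;; p' &
        vq ;; iS = iC ;; q']].
Proof.
have [KS [vp [vq [iS [sv ep eq]]]]] :=
  good_star_exists (good_legs (good_flip gf) (good_flip gg) st'.1).
have gp := star_nat sv (good_flip gf) (good_flip gg) st'.1 ep eq.
have gq := star_nat (star_tr sv) (good_flip gg) (good_flip gf)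
  (good_flip st'.1) eq ep.
have kS := kcp_coker X iS; set ta : hom (ecat P) _ S' := kmor (cf X) iS in kS.
have [fB sB] := sqr_of_good kB kS (good_flip gp).
have [fC sC] := sqr_of_good kC kS (good_flip gq).
have st0 : is_star (gm X) f g fB fC.
  apply: (@star_quotient _ _ _ _ _ _ _ _ uf ug vp vq f' g' p' q' iA iB iC iS
    _ _ _ _ al be ga ta f g fB fC) => //.
  by split; [exact: sv.1 | exact: st'.1 | split; exact: good_flip | split].
have [thm [ith [eB eC]]] := star_uniq st st0.
have [th pth] := iso_pair_m X ith.
exists (th ;; ta); split.
- rewrite -(compose1m be); apply: sqr_vcomp sB.
  by apply/(iso_pair_sqr_e _ _ (iso_pair_id X B) pth); rewrite compose1m.
- rewrite -(compose1m ga); apply: sqr_vcomp sC.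
  by apply/(iso_pair_sqr_e _ _ (iso_pair_id X C) pth); rewrite compose1m.
- move=> sg' sp sq'.
  have k' := kcp_ker X sg'; set i' := kmor (kf X) sg' in k'.
  have [wp gwp] := good_of_sqr kB k' sp.
  have [wq gwq] := good_of_sqr kC k' sq'.
  have gw : good (gm X) uf ug wp wq.
    apply: (good_cancel gwp); rewrite -(good_comm gf) -(good_comm gwq).
    exact: good_hcomp gg st'.1.
  have [v [evp evq]] := star_desc sv gw.
  have ev : v ;; i' = iS.
    apply: (star_epi sv).
      by rewrite composeA evp -(good_comm gwp) ep.
    by rewrite composeA evq -(good_comm gwq) eq.
  have kv : kcp X (v ;; i') ta by rewrite ev.
  have [n [s [_ _ es]]] := third_iso (kcp_coker X v) kv k'.
  have sBs : sqr p fB (idm _ B) s.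
    by apply: (sqr_vcancel X sB); rewrite compose1m es.
  have sCs : sqr q fC (idm _ C) s.
    by apply: (sqr_vcancel X sC); rewrite compose1m es.
  have kg := kcp_coker X g; have kp := kcp_coker X p.
  have kfB := kcp_coker X fB.
  have [b gb] := good_of_sqr_e kp kfB sBs.
  have [l1 sl1] := sqr_of_good kg kp (good_flip st.1).
  have [l2 sl2] := sqr_of_good kg kfB (good_flip st0.1).
  have [v1 pv1] := iso_pair_m X (induced_iso_kcp (star_tr st) kg kp sl1).
  have [v2 pv2] := iso_pair_m X (induced_iso_kcp (star_tr st0) kg kfB sl2).
  have sb : sqr l1 l2 (idm _ _) b.
    apply: (sqr_vcancel X sl2); rewrite compose1m -(good_comm gb).
    by rewrite -(composem1 (kmor (cf X) g : hom (ecat P) _ _));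
       exact: sqr_vcomp sl1 sCs.
  (* By (star), [v1] and [v2] come from isomorphisms of the cokernel of [g] with those of [p] and
     [fB]; [b] carries one to the other. *)
  have ib : is_iso b.
    have /(iso_pair_sqr_m _ _ pv1 pv2) := sb; rewrite compose1m => e.
    apply: (iso_cancel_l (iso_pair_iso_e pv1)); rewrite -e.
    exact: iso_pair_iso_e pv2.
  (* Invertibility of [b] on cokernels makes the square distinguished. On the kernel side, the
     kernel of [s] is then that of the identity of [B], which is empty. *)
  have d : dist X p fB (idm _ B) s.
    apply/(dist_kcp_e _ _ _ kp); split=> //.
    by rewrite (good_comm gb); exact: kcp_iso_r.
  have kid := kcp_ker X (idm (ecat P) B).
  have [_ ks] := (dist_kcp _ _ _ kid).1 d.
  have iss : is_iso s.
    apply: (@kcp_empty_iso _ (dual X)); first exact: (kcp_dual _ _ _).1 ks.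
    have [z1 z2] := @coker_id_empty _ (dual X) B.
    by split.
  have [sm psm] := iso_pair_e X iss.
  (* The m-counterpart of [s] has the same composites with [p] and [q] as [thm]. *)
  have em : sm = thm.
    apply: (star_epi st).
      have /(iso_pair_sqr_e _ _ (iso_pair_id X B) psm) := sBs.
      by rewrite compose1m eB.
    have /(iso_pair_sqr_e _ _ (iso_pair_id X C) psm) := sCs.
    by rewrite compose1m eC.
  by rewrite em in psm; rewrite -es (iso_pair_uniq_e psm pth).
- exists KS, vp, vq, iS; split=> //; apply: kcp_iso_r kS.
  exact: iso_pair_iso_e pth.
Qed.

End StarOfE.

Section StarOfE2.
Context {A B C S A' B' C' S' : P}.
Context {f : hom (mcat P) A B} {g : hom (mcat P) A C} {p : hom (mcat P) B S}
  {q : hom (mcat P) C S} {f' : hom (mcat P) A' B'} {g' : hom (mcat P) A' C'}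
  {p' : hom (mcat P) B' S'} {q' : hom (mcat P) C' S'} {al : hom (ecat P) A A'}
  {be : hom (ecat P) B B'} {ga : hom (ecat P) C C'}.
Hypotheses (st : is_star (gm X) f g p q) (st' : is_star (gm X) f' g' p' q')
  (sf : sqr f f' al be) (sg : sqr g g' al ga).

Lemma star_e_exists : exists si, sqr p p' be si /\ sqr q q' ga si.
Proof.
have kA := kcp_ker X al; have kB := kcp_ker X be; have kC := kcp_ker X ga.
have [uf gf] := good_of_sqr kA kB sf; have [ug gg] := good_of_sqr kA kC sg.
by have [si [? ? _ _]] := star_e_exists_unique st st' sf sg kA kB kC gf gg; exists si.
Qed.

Lemma star_e_unique (si si' : hom (ecat P) S S') :
  sqr p p' be si -> sqr q q' ga si -> sqr p p' be si' -> sqr q q' ga si' ->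
  si = si'.
Proof.
have kA := kcp_ker X al; have kB := kcp_ker X be; have kC := kcp_ker X ga.
have [uf gf] := good_of_sqr kA kB sf; have [ug gg] := good_of_sqr kA kC sg.
have [s0 [_ _ e _]] := star_e_exists_unique st st' sf sg kA kB kC gf gg.
by move=> s1 s2 s3 s4; rewrite (e si) // (e si').
Qed.

(** By uniqueness [si] is the cokernel constructed above, whose kernel is the star-pushout of
    kernels; kernels are unique up to isomorphism. *)
Lemma star_e_kernel (si : hom (ecat P) S S') KA KB KC KS
    (iA : hom (mcat P) KA A') (iB : hom (mcat P) KB B')
    (iC : hom (mcat P) KC C') (iS : hom (mcat P) KS S')
    (uf : hom (mcat P) KA KB) (ug : hom (mcat P) KA KC)
    (up : hom (mcat P) KB KS) (uq : hom (mcat P) KC KS) :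
  sqr p p' be si -> sqr q q' ga si ->
  kcp X iA al -> kcp X iB be -> kcp X iC ga -> kcp X iS si ->
  good (gm X) iA uf f' iB -> good (gm X) iA ug g' iC ->
  iB ;; p' = up ;; iS -> iC ;; q' = uq ;; iS ->
  is_star (gm X) uf ug up uq.
Proof.
move=> sp sq' kA kB kC kS gf gg ep eq.
have [s0 [_ _ e [K0 [vp [vq [i0 [sv k0 ep0 eq0]]]]]]] :=
  star_e_exists_unique st st' sf sg kA kB kC gf gg.
rewrite -(e si) // in k0; have [j [ij ej]] := kcp_uniq_l k0 kS.
have <- : vp ;; j = up.
  by apply: (mm X iS); rewrite -composeA -ej ep0 ep.
have <- : vq ;; j = uq.
  by apply: (mm X iS); rewrite -composeA -ej eq0 eq.
exact: star_iso.
Qed.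

End StarOfE2.

End StarQuotients.

Notation cid := constructive_indefinite_description.

Lemma dep_choice (A : Type) (T : A -> Type) (R : forall a, T a -> Prop) :
  (forall a, exists t, R a t) -> exists f : forall a, T a, forall a, R a (f a).
Proof. by move=> e; exists (fun a => sval (cid _ (e a))) => a; case: cid. Qed.

Lemma sqr_pick_subproof (P : predouble) A B A' B' (f : hom (mcat P) A B)
    (g : hom (mcat P) A' B') (p : hom (ecat P) A A') (q : hom (ecat P) B B') :
  sqr f g p q -> exists s : sq P f g p q, True.
Proof. by move=> [s]; exists s. Qed.

Definition sqr_pick (P : predouble) A B A' B' (f : hom (mcat P) A B)
    (g : hom (mcat P) A' B') (p : hom (ecat P) A A') (q : hom (ecat P) B B')
    (s : sqr f g p q) : sq P f g p q :=
  sval (cid _ (sqr_pick_subproof s)).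

(** * Good cubes as good squares of good maps *)

Section CubeClass.
Context {P : predouble} (X : core P).

Local Notation AG := (good_arrows (gm X)).

Definition cube_good (a b c d : arrow (mcat P)) (f : hom AG a b) (g : hom AG a c)
    (h : hom AG b d) (k : hom AG c d) : Prop :=
  good_cube (gm X) (gm_dom f) (gm_dom g) (gm_dom h) (gm_dom k)
    (gm_cod f) (gm_cod g) (gm_cod h) (gm_cod k) (arr a) (arr b) (arr c) (arr d).

Lemma arrow_iso (a b : arrow (mcat P)) (f : hom AG a b) :
  is_iso f <-> is_iso (gm_dom f) /\ is_iso (gm_cod f).
Proof.
split=> [[g [e1 e2]]|[[g1 [e1 e2]] [g2 [e3 e4]]]].
  by split; [exists (gm_dom g) | exists (gm_cod g)]; split;
    move: e1 e2 => [? ?] [? ?].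
have gg : good (gm X) (arr b) g1 g2 (arr a).
  apply: good_triangle; last by exists (gm_dom f).
  apply: (iso_epic (f := gm_dom f)); first by exists g1.
  rewrite composeA -(good_comm (gm_good f)) -composeA e3 composem1.
  by rewrite composeA e1 compose1m.
by exists (GoodMap gg); split; apply: good_map_ext.
Qed.

Definition quotient_of (a b : arrow (mcat P)) (f : hom AG a b)
    (n : hom (mcat P) (ker (cf X) (arr a)) (ker (cf X) (arr b))) : Prop :=
  sqr n (gm_cod f) (kmor (cf X) (arr a) : hom (ecat P) _ _)
    (kmor (cf X) (arr b)).

Lemma quotient_of_exists (a b : arrow (mcat P)) (f : hom AG a b) :
  exists n, quotient_of f n.
Proof. exact: quotient_map (gm_good f). Qed.

(** The side faces are good because the edges are good maps. What remains are three squares in [P],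
    so closure properties of good squares can be checked on each of them. *)
Lemma cube_goodP (a b c d : arrow (mcat P)) (f : hom AG a b) (g : hom AG a c)
    (h : hom AG b d) (k : hom AG c d) nf ng nh nk :
  quotient_of f nf -> quotient_of g ng -> quotient_of h nh ->
  quotient_of k nk ->
  (cube_good f g h k <->
   [/\ good (gm X) (gm_dom f) (gm_dom g) (gm_dom h) (gm_dom k),
       good (gm X) (gm_cod f) (gm_cod g) (gm_cod h) (gm_cod k) &
       good (gm X) nf ng nh nk]).
Proof.
move=> qf qg qh qk; rewrite /cube_good.
rewrite (good_cube_faceP (nf := nf) (ng := ng) (nh := nh) (nk := nk)
  (xA := kmor (cf X) (arr a)) (xB := kmor (cf X) (arr b))
  (xC := kmor (cf X) (arr c)) (xD := kmor (cf X) (arr d))).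
  split=> [[[? ? _ _] ?]|[g1 g2 g3]] //; split=> //.
  by split=> //; split; exact: good_flip (gm_good _).
by split; split=> //; exact: kcp_coker.
Qed.

Lemma quotient_of_comm (a b c d : arrow (mcat P)) (f : hom AG a b)
    (g : hom AG a c) (h : hom AG b d) (k : hom AG c d) nf ng nh nk :
  quotient_of f nf -> quotient_of g ng -> quotient_of h nh ->
  quotient_of k nk -> gm_cod f ;; gm_cod h = gm_cod g ;; gm_cod k ->
  nf ;; nh = ng ;; nk.
Proof.
move=> qf qg qh qk e; apply: (top_uniq X (sqr_hcomp qf qh)).
rewrite e; exact: sqr_hcomp qg qk.
Qed.

Lemma cube_comm (a b c d : arrow (mcat P)) (f : hom AG a b) (g : hom AG a c)
    (h : hom AG b d) (k : hom AG c d) :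
  cube_good f g h k -> f ;; h = g ;; k.
Proof.
move=> /good_cube_faces [g1 g2 _ _].
by apply: good_map_ext; [exact: good_comm g1 | exact: good_comm g2].
Qed.

(** Goodness of a factorization through a good map is automatic, by [good_cancel]. *)
Lemma good_map_lift (a b x : arrow (mcat P)) (f : hom AG a b) (u : hom AG x b)
    wd wc : wd ;; gm_dom f = gm_dom u -> wc ;; gm_cod f = gm_cod u ->
  good (gm X) (arr x) wd wc (arr a).
Proof.
move=> e1 e2; apply: good_flip.
apply: (good_cancel (good_flip (gm_good f))).
by rewrite e1 e2; exact: good_flip (gm_good u).
Qed.

Lemma cube_pullback (a b c d : arrow (mcat P)) (f : hom AG a b) (g : hom AG a c)
    (h : hom AG b d) (k : hom AG c d) :
  cube_good f g h k -> is_pullback f g h k.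
Proof.
move=> cg; split; first exact: cube_comm.
have [g1 g2 _ _] := good_cube_faces cg.
have [_ p1] := good_pullback g1; have [_ p2] := good_pullback g2.
move=> x u v e.
have [wd [[d1 d2] du]] := p1 _ _ _ (f_equal (fun w : hom AG _ _ => gm_dom w) e).
have [wc [[c1 c2] cu]] := p2 _ _ _ (f_equal (fun w : hom AG _ _ => gm_cod w) e).
exists (GoodMap (good_map_lift d1 c1)); split.
  by split; apply: good_map_ext.
move=> w' e1 e2; apply: good_map_ext => /=.
  by apply: du; [rewrite -e1 | rewrite -e2].
by apply: cu; [rewrite -e1 | rewrite -e2].
Qed.

Lemma cube_triangle (a b c d : arrow (mcat P)) (f : hom AG a b) (g : hom AG a c)
    (h : hom AG b d) (k : hom AG c d) :
  f ;; h = g ;; k -> is_iso g -> cube_good f g h k.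
Proof.
move=> e /arrow_iso [i1 i2].
have [nf qf] := quotient_of_exists f; have [ng qg] := quotient_of_exists g.
have [nh qh] := quotient_of_exists h; have [nk qk] := quotient_of_exists k.
apply/(cube_goodP qf qg qh qk).
have e1 := f_equal (fun w : hom AG _ _ => gm_dom w) e; have e2 := f_equal (fun w : hom AG _ _ => gm_cod w) e.
split; [exact: good_triangle | exact: good_triangle | apply: good_triangle].
  exact: quotient_of_comm e2.
exact: sqr_of_good_iso (kcp_coker X _) (kcp_coker X _) (gm_good g) qg i1 i2.
Qed.

Lemma cube_comp (a b c d a' b' : arrow (mcat P)) (f : hom AG a b)
    (g : hom AG a c) (h : hom AG b d) (k : hom AG c d) (g' : hom AG c a')
    (h' : hom AG d b') (k' : hom AG a' b') :
  cube_good f g h k -> cube_good k g' h' k' ->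
  cube_good f (g ;; g') (h ;; h') k'.
Proof.
have [nf qf] := quotient_of_exists f; have [ng qg] := quotient_of_exists g.
have [nh qh] := quotient_of_exists h; have [nk qk] := quotient_of_exists k.
have [ng' qg'] := quotient_of_exists g'; have [nh' qh'] := quotient_of_exists h'.
have [nk' qk'] := quotient_of_exists k'.
move=> /(cube_goodP qf qg qh qk) [d1 c1 n1].
move=> /(cube_goodP qk qg' qh' qk') [d2 c2 n2].
apply/(cube_goodP qf (ng := ng ;; ng') (nh := nh ;; nh') _ _ qk').
- exact: sqr_hcomp qg qg'.
- exact: sqr_hcomp qh qh'.
- by split; [exact: good_comp d1 d2 | exact: good_comp c1 c2 | exact: good_comp n1 n2].
Qed.

(** Makes the general lemmas on good squares, in particular [good_legs], available for cubes. *)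
Definition cube_class : good_class AG :=
  @GoodClass _ AG cube_good cube_comm cube_pullback
    (fun a b c d f g h k s => good_cube_swap12 s) cube_triangle cube_comp.

(** Frees [good_cube] from its existential: the last square is good for every choice of
    star-pushouts and induced maps. *)
Lemma good_cube_desc A B C D A' B' C' D' (f : hom (mcat P) A B)
    (g : hom (mcat P) A C) (h : hom (mcat P) B D) (k : hom (mcat P) C D)
    (f' : hom (mcat P) A' B') (g' : hom (mcat P) A' C') (h' : hom (mcat P) B' D')
    (k' : hom (mcat P) C' D') (a : hom (mcat P) A A') (b : hom (mcat P) B B')
    (c : hom (mcat P) C C') (d : hom (mcat P) D D') S S' (p : hom (mcat P) B S)
    (q : hom (mcat P) C S) (p' : hom (mcat P) B' S') (q' : hom (mcat P) C' S')
    (u : hom (mcat P) S D) (u' : hom (mcat P) S' D') (t : hom (mcat P) S S') :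
  good_cube (gm X) f g h k f' g' h' k' a b c d ->
  is_star (gm X) f g p q -> is_star (gm X) f' g' p' q' ->
  p ;; u = h -> q ;; u = k -> p' ;; u' = h' -> q' ;; u' = k' ->
  p ;; t = b ;; p' -> q ;; t = c ;; q' -> good (gm X) u t d u'.
Proof.
move=> gc st st' e1 e2 e3 e4 e5 e6; have gf := good_cube_faces gc.
have [n [n' [m [l qs]]]] := quotient_square_exists gf.
have [_ gn] := (good_cubeP qs).1 gc.
have [t' [gt e7 e8]] := star_good_of_quotient gf qs st st' e1 e2 e3 e4 gn.
by have -> : t = t' by apply: (star_epi st); rewrite ?e5 ?e6 ?e7 ?e8.
Qed.

(** The quotient face in the connecting direction is the given square [f, g, h, k], which is good;
    the face of kernels is good by cancellation. *)
Lemma sqr_good_cube A B C D A' B' C' D' (f : hom (mcat P) A B)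
    (g : hom (mcat P) A C) (h : hom (mcat P) B D) (k : hom (mcat P) C D)
    (f' : hom (mcat P) A' B') (g' : hom (mcat P) A' C') (h' : hom (mcat P) B' D')
    (k' : hom (mcat P) C' D') (xA : hom (ecat P) A A') (xB : hom (ecat P) B B')
    (xC : hom (ecat P) C C') (xD : hom (ecat P) D D') KA KB KC KD
    (a : hom (mcat P) KA A') (b : hom (mcat P) KB B') (c : hom (mcat P) KC C')
    (d : hom (mcat P) KD D') (uf : hom (mcat P) KA KB) (ug : hom (mcat P) KA KC)
    (uh : hom (mcat P) KB KD) (uk : hom (mcat P) KC KD) :
  good (gm X) f g h k -> good (gm X) f' g' h' k' ->
  kcp X a xA /\ kcp X b xB -> kcp X c xC /\ kcp X d xD ->
  sqr f f' xA xB /\ sqr g g' xA xC -> sqr h h' xB xD /\ sqr k k' xC xD ->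
  good (gm X) a uf f' b -> good (gm X) a ug g' c ->
  good (gm X) b uh h' d -> good (gm X) c uk k' d ->
  good_cube (gm X) uf ug uh uk f' g' h' k' a b c d.
Proof.
move=> g1 g2 kab kcd sfg shk gf gg gh gk.
have qf : quotient_face X f' g' h' k' a b c d xA xB xC xD f g h k by [].
apply/(good_cube_faceP qf); split=> //; split=> //; try by split; exact: good_flip.
apply: (good_cancel gh); rewrite -(good_comm gf) -(good_comm gk).
exact: good_hcomp gg g2.
Qed.

End CubeClass.

(** * Functor categories *)

(** Up to conversion both sides of the staircase category have this form, with [phi] the underlying
    functor or its transpose, so they share one development. *)
Definition pull_cat (ob ob' : Type) (phi : ob -> ob') (K : category ob') :
    category ob :=
  @Category ob (fun a b => hom K (phi a) (phi b)) (fun a => idm K (phi a))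
    (fun a b c f g => compose K f g) (fun a b f => compose1m f)
    (fun a b f => composem1 f) (fun a b c d f g h => composeA f g h).

Section FunctorCategories.
Context {D P : predouble} (X : core P) (tP : thin P).

Program Definition thin_dfunctor (o : D -> P)
    (m : forall x y, hom (mcat D) x y -> hom (mcat P) (o x) (o y))
    (e : forall x y, hom (ecat D) x y -> hom (ecat P) (o x) (o y))
    (s : forall x y x' y' (f : hom (mcat D) x y) (g : hom (mcat D) x' y')
       (p : hom (ecat D) x x') (q : hom (ecat D) y y'), sq D f g p q ->
       sqr (m _ _ f) (m _ _ g) (e _ _ p) (e _ _ q))
    (m1 : forall x, m _ _ (idm (mcat D) x) = idm (mcat P) (o x))
    (m2 : forall x y z (f : hom (mcat D) x y) (g : hom (mcat D) y z),
       m _ _ (f ;; g) = m _ _ f ;; m _ _ g)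
    (e1 : forall x, e _ _ (idm (ecat D) x) = idm (ecat P) (o x))
    (e2 : forall x y z (f : hom (ecat D) x y) (g : hom (ecat D) y z),
       e _ _ (f ;; g) = e _ _ f ;; e _ _ g) : dfunctor D P :=
  @DFunctor D P o m e
    (fun _ _ _ _ _ _ _ _ t => sqr_pick (s _ _ _ _ _ _ _ _ t))
    m1 m2 e1 e2 _ _ _ _.
Next Obligation. by move=> *; apply: (HSq_ext tP) => /=. Qed.
Next Obligation. by move=> *; apply: (HSq_ext (thin_tr tP)) => /=. Qed.
Next Obligation. by move=> *; apply: (HSq_ext tP) => /=. Qed.
Next Obligation. by move=> *; apply: (HSq_ext (thin_tr tP)) => /=. Qed.

Local Notation MN := (mnat_category D tP (gm X)).

Lemma mnat_at (F F' : dfunctor D P) (a b : mnat (gm X) F F') x :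
  a = b -> a x = b x.
Proof. by move=> ->. Qed.

Definition mk_mnat (F F' : dfunctor D P) (n : forall x, hom (mcat P) (F x) (F' x))
    (s : forall x y (e : hom (ecat D) x y), sqr (n x) (n y) (de F e) (de F' e))
    (g : forall x y (h : hom (mcat D) x y),
       good (gm X) (dm F h) (n x) (n y) (dm F' h)) : mnat (gm X) F F' :=
  thin_mnat tP (fun x y e => sqr_pick (s x y e)) g.

Definition ev (x y : D) (h : hom (mcat D) x y) (F F' : dfunctor D P)
    (a : hom MN F F') :
    hom (good_arrows (gm X)) (Arrow (dm F h)) (Arrow (dm F' h)) :=
  @GoodMap _ _ (gm X) (Arrow (dm F h)) (Arrow (dm F' h)) (nt a x) (nt a y)
    (nt_good a h).

Section Factor.
Context (U A B : dfunctor D P) (f : mnat (gm X) A B) (u : mnat (gm X) U B)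
  (w : forall x, hom (mcat P) (U x) (A x)) (ew : forall x, w x ;; f x = u x).

Lemma factor_sqr x y (e : hom (ecat D) x y) : sqr (w x) (w y) (de U e) (de A e).
Proof.
apply: (sqr_hcancel X (inhabits (nt_sq f e))).
rewrite !ew; exact: inhabits (nt_sq u e).
Qed.

Lemma factor_good x y (h : hom (mcat D) x y) :
  good (gm X) (dm U h) (w x) (w y) (dm A h).
Proof.
exact: (@good_map_lift _ X _ _ _ (ev h f) (ev h u) _ _ (ew x) (ew y)).
Qed.

Definition factor_mnat : mnat (gm X) U A := mk_mnat factor_sqr factor_good.

End Factor.

(** No naturality is asked of [w]: its squares follow from (PBL), and its naturality squares are
    good by [good_map_lift]. *)
Lemma mnat_factor (U A B : dfunctor D P) (f : mnat (gm X) A B)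
    (u : mnat (gm X) U B) (w : forall x, hom (mcat P) (U x) (A x)) :
  (forall x, w x ;; f x = u x) ->
  exists w' : mnat (gm X) U A, forall x, w' x = w x.
Proof. by move=> ew; exists (factor_mnat ew). Qed.

(** The entrywise inverses factor an identity through [a], hence form a transformation. *)
Lemma mnat_iso (F F' : dfunctor D P) (a : hom MN F F') :
  is_iso a <-> forall x, is_iso (nt a x).
Proof.
split=> [[b [e1 e2]] x|ia].
  by exists (nt b x); split; [move: e1 => /(@mnat_at _ _ _ _ x) |
    move: e2 => /(@mnat_at _ _ _ _ x)].
have [b eb] := dep_choice (T := fun x => hom (mcat P) (F' x) (F x)) ia.
have [b' eb'] := @mnat_factor _ _ _ a (idm MN F') b (fun x => (eb x).2).
exists b'; split; apply: (mnat_ext tP) => x /=; rewrite eb'; by have [] := eb x.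
Qed.

(** Agrees by conversion with [fun_goodm], but is stated over a [predouble] so that it can be
    dualized. *)
Definition fgood (F F' H H' : dfunctor D P) (a : hom MN F F') (b : hom MN F H)
    (c : hom MN F' H') (d : hom MN H H') : Prop :=
  forall x y (h : hom (mcat D) x y),
    good_cube (gm X) (nt a x) (nt b x) (nt c x) (nt d x)
      (nt a y) (nt b y) (nt c y) (nt d y) (dm F h) (dm F' h) (dm H h) (dm H' h).

(** The square at [x] is the initial face of the cube at the identity of [x]. *)
Lemma fgood_at (F F' H H' : dfunctor D P) (a : hom MN F F') (b : hom MN F H)
    (c : hom MN F' H') (d : hom MN H H') x :
  fgood a b c d -> good (gm X) (nt a x) (nt b x) (nt c x) (nt d x).
Proof. by move=> /(_ _ _ (idm _ x)) []. Qed.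

Lemma mnat_monic (F F' : dfunctor D P) (a : hom MN F F') : is_monic a.
Proof.
move=> H u v e; apply: (mnat_ext tP) => x; apply: (mm X (nt a x)).
exact: mnat_at x e.
Qed.

Section Pull.
Context {ob : Type} (phi : ob -> dfunctor D P).

Local Notation K := (pull_cat phi MN).

Definition pgood (F F' H H' : ob) (a : hom K F F') (b : hom K F H)
  (c : hom K F' H') (d : hom K H H') : Prop := fgood a b c d.

Lemma pull_iso (F F' : ob) (a : hom K F F') :
  is_iso a <-> is_iso (a : hom MN (phi F) (phi F')).
Proof. by split=> [] [b e]; exists b. Qed.

Lemma pgood_comm (F F' H H' : ob) (a : hom K F F') (b : hom K F H)
    (c : hom K F' H') (d : hom K H H') : pgood a b c d -> a ;; c = b ;; d.
Proof.
by move=> gd; apply: (mnat_ext tP) => x; exact: good_comm (fgood_at x gd).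
Qed.

Lemma pgood_pullback (F F' H H' : ob) (a : hom K F F') (b : hom K F H)
    (c : hom K F' H') (d : hom K H H') :
  pgood a b c d -> is_pullback a b c d.
Proof.
move=> gd; split; first exact: pgood_comm.
move=> U u v e.
have pb x := (good_pullback (fgood_at x gd)).2 _ _ _ (mnat_at x e).
have [w ew] := dep_choice pb.
have [w' ew'] := @mnat_factor (phi U) (phi F) (phi F') a u w
  (fun x => (ew x).1.1).
exists w'; split.
  by split; apply: (mnat_ext tP) => x /=; rewrite ew'; have [[]] := ew x.
move=> w2 e1 e2; apply: (mnat_ext tP) => x; rewrite ew'; apply: (ew x).2.
  exact: mnat_at x e1.
exact: mnat_at x e2.
Qed.

Lemma pgood_triangle (F F' H H' : ob) (a : hom K F F') (b : hom K F H)
    (c : hom K F' H') (d : hom K H H') :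
  a ;; c = b ;; d -> is_iso b -> pgood a b c d.
Proof.
move=> e /pull_iso /mnat_iso ib x y h.
have := @cube_triangle _ X _ _ _ _ (ev h a) (ev h b) (ev h c) (ev h d).
apply; last by apply/arrow_iso; split; exact: ib.
by apply: good_map_ext; [exact: mnat_at x e |
  exact: mnat_at y e].
Qed.

Lemma pgood_comp (F F' H H' A B : ob) (a : hom K F F') (b : hom K F H)
    (c : hom K F' H') (d : hom K H H') (b' : hom K H A) (c' : hom K H' B)
    (d' : hom K A B) :
  pgood a b c d -> pgood d b' c' d' -> pgood a (b ;; b') (c ;; c') d'.
Proof.
move=> g1 g2 x y h.
exact: (@cube_comp _ X _ _ _ _ _ _ (ev h a) (ev h b) (ev h c) (ev h d)
  (ev h b') (ev h c') (ev h d') (g1 x y h) (g2 x y h)).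
Qed.

Lemma pgood_tr (F F' H H' : ob) (a : hom K F F') (b : hom K F H)
    (c : hom K F' H') (d : hom K H H') : pgood a b c d -> pgood b a d c.
Proof. by move=> gd x y h; apply: good_cube_swap12; exact: gd. Qed.

Definition fun_class : good_class K :=
  @GoodClass _ K pgood pgood_comm pgood_pullback pgood_tr pgood_triangle pgood_comp.

End Pull.

End FunctorCategories.

Arguments ev {D P X} tP {x y} h {F F'} a.

Lemma star_iso_source (ob : Type) (Y : category ob) (G : good_class Y)
    A B C D A' B' C' (f : hom Y A B) (g : hom Y A C) (f' : hom Y A' B')
    (g' : hom Y A' C') (h : hom Y B' D) (k : hom Y C' D) (u : hom Y A A')
    (v : hom Y B B') (w : hom Y C C') :
  is_star G f' g' h k -> f ;; v = u ;; f' -> g ;; w = u ;; g' ->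
  is_iso u -> is_iso v -> is_iso w -> is_star G f g (v ;; h) (w ;; k).
Proof.
move=> st ef eg iu iv iw; split.
  apply: (good_legs _ _ st.1); first exact: good_triangle ef iu.
  exact: good_triangle eg iu.
move=> E h' k' gd; have [u' [u1 u2]] := iu.
have [v' [v1 v2]] := iv; have [w' [w1 w2]] := iw.
have ef' : f' ;; v' = u' ;; f.
  apply: (iso_epic iu); rewrite !composeA u1 compose1m -ef.
  by rewrite -composeA v1 composem1.
have eg' : g' ;; w' = u' ;; g.
  apply: (iso_epic iu); rewrite !composeA u1 compose1m -eg.
  by rewrite -composeA w1 composem1.
have iu' := iso_inv u1 u2.
have [t [[t1 t2] tu]] := st.2 _ _ _
  (good_legs (good_triangle G ef' iu') (good_triangle G eg' iu') gd).
exists t; split; first by rewrite -!composeA t1 t2 !composeA v1 w1 !compose1m.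
move=> t' [e1 e2]; apply: tu; rewrite -e1 -e2 !composeA v2 w2 !compose1m.
by [].
Qed.

(** * Entrywise star-pushouts of functors *)

Section FunctorStars.
Context {D P : predouble} (X : core P) (tP : thin P).

Local Notation MN := (mnat_category D tP (gm X)).

Section Span.
Context (A B C : dfunctor D P) (a : mnat (gm X) A B) (b : mnat (gm X) A C).

(** Joint epicness and [star_e_unique] make [tS] and [sS] functorial. The real content is [cells]:
    the square of [S] is obtained from a good square between the kernels of its e-sides. *)
Lemma starF_exists :
  (forall x, completable (gm X) (a x) (b x)) ->
  exists (S : dfunctor D P) (p : mnat (gm X) B S) (q : mnat (gm X) C S),
    forall x, is_star (gm X) (a x) (b x) (p x) (q x).
Proof.
move=> cab.
have [So [po [qo st]]] : exists (So : D -> P)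
    (po : forall x, hom (mcat P) (B x) (So x))
    (qo : forall x, hom (mcat P) (C x) (So x)),
    forall x, is_star (gm X) (a x) (b x) (po x) (qo x).
  have [s es] := @dep_choice D
    (fun x => {S : P & hom (mcat P) (B x) S * hom (mcat P) (C x) S}%type)
    (fun x s => is_star (gm X) (a x) (b x) (projT2 s).1 (projT2 s).2)
    (fun x => let: ex_intro S0 (ex_intro p (ex_intro q st)) :=
       (@co_starm _ X _ _ _ _ _ (cab x)).1 in
       ex_intro _ (existT _ S0 (p, q)) st).
  by exists (fun x => projT1 (s x)), (fun x => (projT2 (s x)).1),
    (fun x => (projT2 (s x)).2).
have ex_t x y (h : hom (mcat D) x y) : exists t : hom (mcat P) (So x) (So y),
    po x ;; t = dm B h ;; po y /\ qo x ;; t = dm C h ;; qo y.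
  apply: (star_desc (st x)).
  exact: good_legs (good_flip (nt_good a h)) (good_flip (nt_good b h)) (st y).1.
pose tS x y (h : hom (mcat D) x y) := sval (cid _ (ex_t x y h)).
have tp x y (h : hom (mcat D) x y) : po x ;; tS _ _ h = dm B h ;; po y.
  by rewrite /tS; case: cid => ? [].
have tq x y (h : hom (mcat D) x y) : qo x ;; tS _ _ h = dm C h ;; qo y.
  by rewrite /tS; case: cid => ? [].
have ex_s x y (e : hom (ecat D) x y) : exists s : hom (ecat P) (So x) (So y),
    sqr (po x) (po y) (de B e) s /\ sqr (qo x) (qo y) (de C e) s.
  exact: star_e_exists (st x) (st y) (inhabits (nt_sq a e)) (inhabits (nt_sq b e)).
pose sS x y (e : hom (ecat D) x y) := sval (cid _ (ex_s x y e)).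
have sp x y (e : hom (ecat D) x y) : sqr (po x) (po y) (de B e) (sS _ _ e).
  by rewrite /sS; case: cid => ? [].
have sq' x y (e : hom (ecat D) x y) : sqr (qo x) (qo y) (de C e) (sS _ _ e).
  by rewrite /sS; case: cid => ? [].
have cells x y x' y' (h : hom (mcat D) x y) (h' : hom (mcat D) x' y')
    (e : hom (ecat D) x x') (e' : hom (ecat D) y y') :
    sq D h h' e e' -> sqr (tS _ _ h) (tS _ _ h') (sS _ _ e) (sS _ _ e').
  move=> s.
  pose U (F : dfunctor D P) := Arrow (kmor (kf X) (de F e)).
  pose V (F : dfunctor D P) := Arrow (kmor (kf X) (de F e')).
  pose AG := good_arrows (gm X).
  pose ka (F : dfunctor D P) : hom AG (U F) (V F) :=
    @GoodMap _ _ (gm X) (U F) (V F) _ _ (kmap_good (kf X) (dsq F s)).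
  pose Ua (F F' : dfunctor D P) (c : mnat (gm X) F F') : hom AG (U F) (U F') :=
    @GoodMap _ _ (gm X) (U F) (U F') _ _ (kmap_good (kf X) (nt_sq c e)).
  pose Va (F F' : dfunctor D P) (c : mnat (gm X) F F') : hom AG (V F) (V F') :=
    @GoodMap _ _ (gm X) (V F) (V F') _ _ (kmap_good (kf X) (nt_sq c e')).
  have leg (F F' : dfunctor D P) (c : mnat (gm X) F F') :
      good (cube_class X) (Ua _ _ c) (ka F) (ka F') (Va _ _ c).
    apply: (sqr_good_cube (f := c x) (g := dm F h) (h := dm F' h) (k := c y)
      (xA := de F e) (xB := de F' e) (xC := de F e') (xD := de F' e')).
    - exact: good_flip (nt_good c h).
    - exact: good_flip (nt_good c h').
    - by split; exact: kcp_ker.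
    - by split; exact: kcp_ker.
    - by split; [exact: (inhabits (nt_sq c e)) | exact: (inhabits (dsq F s))].
    - by split; [exact: (inhabits (dsq F' s)) | exact: (inhabits (nt_sq c e'))].
    - exact: kmap_good.
    - exact: kmap_good.
    - exact: kmap_good.
    - exact: kmap_good.
  have k1 z z' (l : hom (ecat D) z z') := kcp_ker X (sS _ _ l).
  have [vp gvp] := good_of_sqr (kcp_ker X (de B e)) (k1 _ _ e) (sp _ _ e).
  have [vq gvq] := good_of_sqr (kcp_ker X (de C e)) (k1 _ _ e) (sq' _ _ e).
  have [vp' gvp'] := good_of_sqr (kcp_ker X (de B e')) (k1 _ _ e') (sp _ _ e').
  have [vq' gvq'] := good_of_sqr (kcp_ker X (de C e')) (k1 _ _ e') (sq' _ _ e').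
  pose VS := Arrow (kmor (kf X) (sS _ _ e')).
  pose wp : hom AG (V B) VS := @GoodMap _ _ (gm X) (V B) VS _ _ gvp'.
  pose wq : hom AG (V C) VS := @GoodMap _ _ (gm X) (V C) VS _ _ gvq'.
  have tip : good (cube_class X) (Va _ _ a) (Va _ _ b) wp wq.
    apply: (sqr_good_cube (f := a y) (g := b y) (h := po y) (k := qo y)
      (xA := de A e') (xB := de B e') (xC := de C e') (xD := sS _ _ e')) => //.
    - exact: (st y).1.
    - exact: (st y').1.
    - by split; exact: kcp_ker.
    - by split; exact: kcp_ker.
    - by split; [exact: (inhabits (nt_sq a e')) | exact: (inhabits (nt_sq b e'))].
    - exact: kmap_good.
    - exact: kmap_good.
  (* Pasting in [cube_class]: the span of kernels at [e] maps to the one at [e'], which [tip]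
     completes by the kernel of [sS e']. *)
  have cube : good_cube (gm X) _ _ _ _ _ _ _ _ _ _ _ _ :=
    good_legs (leg _ _ a) (leg _ _ b) tip.
  have stK : is_star (gm X) (kmap (kf X) (nt_sq a e)) (kmap (kf X) (nt_sq b e)) vp vq.
    apply: (star_e_kernel (st x) (st x') (inhabits (nt_sq a e))
      (inhabits (nt_sq b e)) (sp _ _ e) (sq' _ _ e) (kcp_ker X _) (kcp_ker X _)
      (kcp_ker X _) (k1 _ _ e) (kmap_good _ _) (kmap_good _ _)).
      exact: good_comm gvp.
    exact: good_comm gvq.
  have [u [eu1 eu2]] := star_desc stK (proj1 cube).
  (* The kernel of [sS e] is the star-pushout of kernels, so the cube descends to a good square from
     it to the kernel of [sS e'], over [tS h']. Fullness lifts this to a square with top [f0]. *)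
  have gu := good_cube_desc cube stK (st x') eu1 eu2 (tp _ _ h') (tq _ _ h')
    (esym (good_comm gvp)) (esym (good_comm gvq)).
  have [f0 sf0] := sqr_of_good (k1 _ _ e) (k1 _ _ e') (good_flip gu).
  have -> // : tS _ _ h = f0.
  (* Two pastings with the same bottom and e-sides have the same top, which identifies [f0] after
     composition with each leg. *)
  apply: (star_epi (st x)).
    rewrite tp; apply: (top_uniq X _ (sqr_hcomp (sp _ _ e) sf0)).
    rewrite tp; exact: sqr_hcomp (inhabits (dsq B s)) (sp _ _ e').
  rewrite tq; apply: (top_uniq X _ (sqr_hcomp (sq' _ _ e) sf0)).
  rewrite tq; exact: sqr_hcomp (inhabits (dsq C s)) (sq' _ _ e').
have t1 x : tS _ _ (idm (mcat D) x) = idm _ (So x).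
  by apply: (star_epi (st x)); rewrite ?tp ?tq dm_id composem1 compose1m.
have t2 x y z (f : hom (mcat D) x y) (g : hom (mcat D) y z) :
    tS _ _ (f ;; g) = tS _ _ f ;; tS _ _ g.
  apply: (star_epi (st x)).
    by rewrite tp composeA tp -composeA tp composeA dm_comp.
  by rewrite tq composeA tq -composeA tq composeA dm_comp.
have su x y (e : hom (ecat D) x y) s : sqr (po x) (po y) (de B e) s ->
    sqr (qo x) (qo y) (de C e) s -> sS _ _ e = s.
  apply: (star_e_unique (st x) (st y) (inhabits (nt_sq a e))
    (inhabits (nt_sq b e))); [exact: sp | exact: sq'].
have s1 x : sS _ _ (idm (ecat D) x) = idm _ (So x).
  by apply: su; rewrite de_id; exact: sqr_vid.
have s2 x y z (f : hom (ecat D) x y) (g : hom (ecat D) y z) :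
    sS _ _ (f ;; g) = sS _ _ f ;; sS _ _ g.
  by apply: su; rewrite de_comp; apply: sqr_vcomp; [exact: sp.. | exact: sq' | exact: sq'].
pose S := thin_dfunctor tP cells t1 t2 s1 s2.
have gp x y (h : hom (mcat D) x y) : good (gm X) (dm B h) (po x) (po y) (tS _ _ h).
  apply: good_flip; apply: (star_nat (st x) (good_flip (nt_good a h))
    (good_flip (nt_good b h)) (st y).1 (tp _ _ h) (tq _ _ h)).
have gq x y (h : hom (mcat D) x y) : good (gm X) (dm C h) (qo x) (qo y) (tS _ _ h).
  apply: good_flip; apply: (star_nat (star_tr (st x)) (good_flip (nt_good b h))
    (good_flip (nt_good a h)) (star_tr (st y)).1 (tq _ _ h) (tp _ _ h)).
by exists S, (@mk_mnat D P X tP B S po sp gp), (@mk_mnat D P X tP C S qo sq' gq).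
Qed.

Context (S : dfunctor D P) (p : mnat (gm X) B S) (q : mnat (gm X) C S).
Hypothesis st : forall x, is_star (gm X) (a x) (b x) (p x) (q x).

Lemma starF_good : @fgood D P X tP _ _ _ _ a b p q.
Proof.
move=> x y h; apply: star_good_cube (st x).
split; [exact: (st x).1 | exact: (st y).1 | |].
  by split; [exact: good_flip (nt_good a h) | exact: good_flip (nt_good b h)].
by split; [exact: good_flip (nt_good p h) | exact: good_flip (nt_good q h)].
Qed.

Lemma starF_kernel x y (e : hom (ecat D) x y) :
  is_star (gm X) (kmap (kf X) (nt_sq a e)) (kmap (kf X) (nt_sq b e))
    (kmap (kf X) (nt_sq p e)) (kmap (kf X) (nt_sq q e)).
Proof.
apply: (star_e_kernel (st x) (st y) (inhabits (nt_sq a e))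
  (inhabits (nt_sq b e)) (inhabits (nt_sq p e)) (inhabits (nt_sq q e))
  (kcp_ker X _) (kcp_ker X _) (kcp_ker X _) (kcp_ker X _)
  (kmap_good _ _) (kmap_good _ _)).
  exact: good_comm (kmap_good _ _).
exact: good_comm (kmap_good _ _).
Qed.

(** Along m-morphisms, goodness is descent of the given cube. Along an e-morphism the cube of
    kernels descends in the same way, and the square it lifts to has top [u x] because the legs are
    jointly epic. *)
Lemma starF_desc (S' : dfunctor D P) (p' : mnat (gm X) B S')
    (q' : mnat (gm X) C S') :
  @fgood D P X tP _ _ _ _ a b p' q' -> exists u : mnat (gm X) S S',
    forall x, p x ;; u x = p' x /\ q x ;; u x = q' x.
Proof.
move=> gd; have gx x : good (gm X) (a x) (b x) (p' x) (q' x) := fgood_at x gd.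
have [u eu] := dep_choice (fun x => star_desc (st x) (gx x)).
have gu x y (h : hom (mcat D) x y) : good (gm X) (dm S h) (u x) (u y) (dm S' h).
  apply: good_flip.
  apply: (good_cube_desc (gd _ _ h) (st x) (st y)); try by [case: (eu x) | case: (eu y)].
    exact: (good_comm (good_flip (nt_good p h))).
  exact: (good_comm (good_flip (nt_good q h))).
have su x y (e : hom (ecat D) x y) : sqr (u x) (u y) (de S e) (de S' e).
  have cube := @sqr_good_cube _ X _ _ _ _ _ _ _ _ _ _ _ _ _ _ _ _
    (de A e) (de B e) (de C e) (de S' e) _ _ _ _ _ _ _ _ _ _ _ _ (gx x) (gx y)
    (conj (kcp_ker X _) (kcp_ker X _)) (conj (kcp_ker X _) (kcp_ker X _))
    (conj (inhabits (nt_sq a e)) (inhabits (nt_sq b e)))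
    (conj (inhabits (nt_sq p' e)) (inhabits (nt_sq q' e)))
    (kmap_good _ (nt_sq a e)) (kmap_good _ (nt_sq b e))
    (kmap_good _ (nt_sq p' e)) (kmap_good _ (nt_sq q' e)).
  have stK := starF_kernel e.
  have [v [ev1 ev2]] := star_desc stK (proj1 cube).
  have gv := good_cube_desc cube stK (st y) ev1 ev2 (eu y).1 (eu y).2
    (esym (good_comm (kmap_good _ _))) (esym (good_comm (kmap_good _ _))).
  have [f0 sf0] := sqr_of_good (kcp_ker X _) (kcp_ker X _) (good_flip gv).
  have -> // : u x = f0.
  apply: (star_epi (st x)).
    rewrite (eu x).1; apply: (top_uniq X (inhabits (nt_sq p' e))).
    by have := sqr_hcomp (inhabits (nt_sq p e)) sf0; rewrite (eu y).1.
  rewrite (eu x).2; apply: (top_uniq X (inhabits (nt_sq q' e))).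
  by have := sqr_hcomp (inhabits (nt_sq q e)) sf0; rewrite (eu y).2.
by exists (mk_mnat tP su gu).
Qed.

End Span.

End FunctorStars.

(** * Entrywise kernels of functors *)

Section FunctorKernels.
Context {D P : predouble} (X : core P) (tP : thin P).

Local Notation MN := (mnat_category D tP (gm X)).

Section Kernel.
Context (F H : dfunctor D P) (p : enat (ge X) F H).

Local Notation pe x := (nt p x : hom (ecat P) (F x) (H x)).

Definition ker_m x y (h : hom (mcat D) x y) :
    hom (mcat P) (ker (kf X) (pe x)) (ker (kf X) (pe y)) :=
  kmap (kf X) (nt_sq p h : sq P (dm F h) (dm H h) (pe x) (pe y)).

(** Here the condition that naturality squares be good is used: a good square in the e-direction
    lifts, by fullness of [c], to a square with an e-morphism between the kernels. *)
Lemma ker_e_exists x y (e : hom (ecat D) x y) :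
  exists s : hom (ecat P) (ker (kf X) (pe x)) (ker (kf X) (pe y)),
    sqr (kmor (kf X) (pe x)) (kmor (kf X) (pe y)) s (de H e).
Proof.
exact: (sqr_of_good_e (kcp_ker X (pe x)) (kcp_ker X (pe y))
  (good_flip (nt_good p e))).
Qed.

Definition ker_e x y (e : hom (ecat D) x y) := sval (cid _ (ker_e_exists e)).

Lemma ker_e_sqr x y (e : hom (ecat D) x y) :
  sqr (kmor (kf X) (pe x)) (kmor (kf X) (pe y)) (ker_e e) (de H e).
Proof. by rewrite /ker_e; case: cid. Qed.

Lemma ker_m_good x y (h : hom (mcat D) x y) :
  good (gm X) (ker_m h) (kmor (kf X) (pe x)) (kmor (kf X) (pe y)) (dm H h).
Proof. exact: good_flip (kmap_good _ _). Qed.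

Lemma ker_cells x y x' y' (f : hom (mcat D) x y) (g : hom (mcat D) x' y')
    (e : hom (ecat D) x x') (e' : hom (ecat D) y y') :
  sq D f g e e' -> sqr (ker_m f) (ker_m g) (ker_e e) (ker_e e').
Proof.
move=> s; apply: (sqr_hcancel X (ker_e_sqr e')).
rewrite !(good_comm (ker_m_good _)).
exact: sqr_hcomp (ker_e_sqr e) (inhabits (dsq H s)).
Qed.

Lemma ker_m_id x : ker_m (idm _ x) = idm _ (ker (kf X) (pe x)).
Proof.
apply: (mm X (kmor (kf X) (pe x))).
by rewrite (good_comm (ker_m_good _)) dm_id composem1 compose1m.
Qed.

Lemma ker_m_comp x y z (f : hom (mcat D) x y) (g : hom (mcat D) y z) :
  ker_m (f ;; g) = ker_m f ;; ker_m g.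
Proof.
apply: (mm X (kmor (kf X) (pe z))); rewrite (good_comm (ker_m_good _)).
rewrite -composeA (good_comm (ker_m_good _)) composeA.
by rewrite (good_comm (ker_m_good _)) dm_comp composeA.
Qed.

Lemma ker_e_id x : ker_e (idm _ x) = idm _ (ker (kf X) (pe x)).
Proof.
apply: (left_uniq X (ker_e_sqr _)); rewrite de_id; exact: sqr_vid.
Qed.

Lemma ker_e_comp x y z (f : hom (ecat D) x y) (g : hom (ecat D) y z) :
  ker_e (f ;; g) = ker_e f ;; ker_e g.
Proof.
apply: (left_uniq X (ker_e_sqr _)); rewrite de_comp.
exact: sqr_vcomp (ker_e_sqr f) (ker_e_sqr g).
Qed.

Definition kerF : dfunctor D P :=
  thin_dfunctor tP ker_cells ker_m_id ker_m_comp ker_e_id ker_e_comp.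

Definition kmorF : mnat (gm X) kerF H :=
  @mk_mnat D P X tP kerF H (fun x => kmor (kf X) (pe x)) ker_e_sqr ker_m_good.

End Kernel.

Section KernelMap.
Context (F F' H H' : dfunctor D P) (p : enat (ge X) F H) (q : enat (ge X) F' H')
  (a : mnat (gm X) F F') (b : mnat (gm X) H H')
  (s : forall x, sq P (a x) (b x) (nt p x : hom (ecat P) _ _) (nt q x)).

Lemma kmapF_factor x :
  kmap (kf X) (s x) ;; kmorF q x = nt ((kmorF p : hom MN _ _) ;; (b : hom MN _ _)) x.
Proof. exact: esym (good_comm (kmap_good (kf X) (s x))). Qed.

Definition kmapF : mnat (gm X) (kerF p) (kerF q) :=
  @factor_mnat D P X tP (kerF p) (kerF q) H' (kmorF q)
    ((kmorF p : hom MN _ _) ;; (b : hom MN _ _))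
    (fun x => kmap (kf X) (s x)) kmapF_factor.

End KernelMap.

Section KernelGood.
Context (F F' H H' : dfunctor D P) (p : enat (ge X) F H) (q : enat (ge X) F' H').

(** In the direction of the kernel inclusions, the quotient square of the cube at [h] is the
    naturality square of [a], which is good. *)
Lemma kmapF_good (a : mnat (gm X) F F') (b : mnat (gm X) H H')
    (k : mnat (gm X) (kerF p) (kerF q)) :
  (forall x, sqr (a x) (b x) (nt p x : hom (ecat P) _ _) (nt q x)) ->
  (forall x, good (gm X) (kmorF p x) (k x) (b x) (kmorF q x)) ->
  @fgood D P X tP _ _ _ _ (kmorF p) k b (kmorF q).
Proof.
move=> s gk x y h.
have qs : quotient_square X (kmorF p x) (b x) (kmorF q x) (kmorF p y) (b y)
    (kmorF q y) (dm H h) (dm H' h) (nt p x : hom (ecat P) _ _) (nt q x) (a x)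
    (nt p y) (nt q y) (a y) (dm F h) (dm F' h).
  split; [by split; exact: kcp_ker.. | by split; exact: s |].
  by split; [exact: (inhabits (nt_sq p h)) | exact: (inhabits (nt_sq q h))].
apply/(good_cubeP qs); split; last exact: good_flip (nt_good a h).
split; [exact: gk | exact: gk | |].
  by split; [exact: good_flip (nt_good (kmorF p) h) | exact: good_flip (nt_good k h)].
by split; [exact: good_flip (nt_good b h) | exact: good_flip (nt_good (kmorF q) h)].
Qed.

(** Components are lifted entrywise. The quotient square used in [kmapF_good], read the other way,
    shows their naturality squares to be good; (PBL) gives the squares along e-morphisms. *)
Lemma kerF_full (b : mnat (gm X) H H') (k : mnat (gm X) (kerF p) (kerF q)) :
  @fgood D P X tP _ _ _ _ (kmorF p) k b (kmorF q) ->
  exists a : mnat (gm X) F F',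
    forall x, sqr (a x) (b x) (nt p x : hom (ecat P) _ _) (nt q x).
Proof.
move=> gd; have gx x := fgood_at x gd.
have [a s] := dep_choice
  (fun x => sqr_of_good (kcp_ker X (nt p x)) (kcp_ker X (nt q x)) (gx x)).
have ga x y (h : hom (mcat D) x y) : good (gm X) (dm F h) (a x) (a y) (dm F' h).
  have qs : quotient_square X (kmorF p x) (b x) (kmorF q x) (kmorF p y) (b y)
      (kmorF q y) (dm H h) (dm H' h) (nt p x : hom (ecat P) _ _) (nt q x) (a x)
      (nt p y) (nt q y) (a y) (dm F h) (dm F' h).
    split; [by split; exact: kcp_ker.. | by split; exact: s |].
    by split; [exact: (inhabits (nt_sq p h)) | exact: (inhabits (nt_sq q h))].
  exact: good_flip ((good_cubeP qs).1 (gd _ _ h)).2.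
have sa x y (e : hom (ecat D) x y) : sqr (a x) (a y) (de F e) (de F' e).
  apply: (sqr_vcancel X (s y)).
  have e1 : de F e ;; (nt p y : hom (ecat P) _ _) = nt p x ;; de H e :=
    good_comm (nt_good p e).
  have e2 : de F' e ;; (nt q y : hom (ecat P) _ _) = nt q x ;; de H' e :=
    good_comm (nt_good q e).
  rewrite e1 e2; exact: sqr_vcomp (s x) (inhabits (nt_sq b e)).
by exists (mk_mnat tP sa ga).
Qed.

End KernelGood.

End FunctorKernels.

(** * Functors to distinguished squares *)

(** The index [D] and the predicate [diag] are arbitrary so that closure lemmas apply to transposed
    functors as well. *)
Definition stairlike (D P : predouble) (X : core P) (diag : D -> Prop)
    (F : dfunctor D P) : Prop :=
  (forall x, diag x -> is_empty (F x)) /\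
  (forall x y x' y' (f : hom (mcat D) x y) (g : hom (mcat D) x' y')
     (p : hom (ecat D) x x') (q : hom (ecat D) y y') (s : sq D f g p q),
     dist X (dm F f) (dm F g) (de F p) (de F q)).

Lemma stairlike_tr (D P : predouble) (X : core P) (diag : D -> Prop)
    (F : dfunctor D P) :
  stairlike X diag F <-> @stairlike (tr D) (tr P) (dual X) diag (tr_dfunctor F).
Proof.
split=> [] [e d]; split=> [x /e [? ?] //|].
  by move=> x y x' y' f g p q s; apply/dist_tr; exact: (d x x' y y' p q f g s).
move=> x y x' y' f g p q s; apply/dist_tr; exact: (d x x' y y' p q f g s).
Qed.

Lemma kcp_from_empty (P : predouble) (X : core P) (Z B : P)
    (u : hom (mcat P) Z B) : is_empty Z -> kcp X u (idm _ B).
Proof.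
move=> z; have [w _] := z.1 (ker (kf X) (idm (ecat P) B)).
have [z1 z2] := @coker_id_empty _ (dual X) B.
by exists w; split; [exact: is_empty_m_iso | exact: initial_uniq z.1].
Qed.

Section Closure.
Context {D P : predouble} (X : core P) (tP : thin P) (diag : D -> Prop).

Lemma dist_coker_iso A B A' B' (f : hom (mcat P) A B) (g : hom (mcat P) A' B')
    (p : hom (ecat P) A A') (q : hom (ecat P) B B') E E' (s : hom (ecat P) E B)
    (s' : hom (ecat P) E' B') (c : hom (ecat P) E E') :
  sqr f g p q -> kcp X f s -> kcp X g s' -> c ;; s' = s ;; q ->
  (dist X f g p q <-> is_iso c).
Proof.
move=> sf k k' e; rewrite (dist_kcp_e _ _ _ k); split=> [[_ k2]|ic].
  have [j [ij ej]] := kcp_uniq_r k2 k'.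
  by have -> : c = j by apply: (me X s'); rewrite e ej.
by split=> //; rewrite -e; exact: kcp_iso_r.
Qed.

(** By (D) it suffices to invert the map [cK] between cokernels of m-sides. The corresponding maps
    [cF] and [cH] are invertible, and the cokernels for [K] are kernels of the e-morphisms from
    those for [F] to those for [H]. *)
Lemma stairlike_ker (F H : dfunctor D P) (p : enat (ge X) F H) :
  stairlike X diag F -> stairlike X diag H -> stairlike X diag (kerF tP p).
Proof.
move=> [eF dF] [eH dH]; split=> [x dx|x y x' y' f g e e' s].
  exact: (is_empty_below_m X (kmor (kf X) (nt p x)) (eH x dx)).2.
set K := kerF tP p; pose pe z := nt p z : hom (ecat P) (F z) (H z).
pose kp z := kmor (kf X) (pe z).
have kK z z' (h : hom (mcat D) z z') := kcp_coker X (dm K h).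
have kH z z' (h : hom (mcat D) z z') := kcp_coker X (dm H h).
have kF z z' (h : hom (mcat D) z z') := kcp_coker X (dm F h).
have sK : sqr (dm K f) (dm K g) (de K e) (de K e') := inhabits (dsq K s).
have sH : sqr (dm H f) (dm H g) (de H e) (de H e') := inhabits (dsq H s).
have sF : sqr (dm F f) (dm F g) (de F e) (de F e') := inhabits (dsq F s).
have [cK gK] := good_of_sqr_e (kK _ _ f) (kK _ _ g) sK.
have [cH gH] := good_of_sqr_e (kH _ _ f) (kH _ _ g) sH.
have [cF gF] := good_of_sqr_e (kF _ _ f) (kF _ _ g) sF.
have iH := (dist_coker_iso sH (kH _ _ f) (kH _ _ g) (esym (good_comm gH))).1
  (dH _ _ _ _ _ _ _ _ s).
have iF := (dist_coker_iso sF (kF _ _ f) (kF _ _ g) (esym (good_comm gF))).1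
  (dF _ _ _ _ _ _ _ _ s).
apply/(dist_coker_iso sK (kK _ _ f) (kK _ _ g) (esym (good_comm gK))).
(* By [nine], the quotient of [H z' / H z] by [K z' / K z] is [F z' / F z]. *)
have quot z z' (h : hom (mcat D) z z') :
    exists n t, [/\ sqr n (kp z') (kmor (cf X) (dm K h) : hom (ecat P) _ _)
        (kmor (cf X) (dm H h)), kcp X n t &
      t ;; (kmor (cf X) (dm H h) : hom (ecat P) _ _) =
        (kmor (cf X) (dm F h) : hom (ecat P) _ _) ;; pe z'].
  have gk := ker_m_good p h.
  have [n sn] := quotient_map gk; exists n.
  have [t [kt et]] := nine (good_flip gk) (kcp_ker X (pe z)) (kcp_ker X (pe z'))
    (inhabits (nt_sq p h)) (kK _ _ h) (kH _ _ h) sn (kF _ _ h).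
  by exists t.
have [n [t [sn kt et]]] := quot _ _ f.
have [n' [t' [sn' kt' et']]] := quot _ _ g.
have gt : good (ge X) t cF cH t'.
  apply: good_triangle iF; apply: (me X (kmor (cf X) (dm H g))).
  rewrite -!composeA et' -(good_comm gH) !composeA et -(good_comm gF).
  rewrite -!composeA; congr (_ ;; _); exact: (esym (good_comm (nt_good p e'))).
have [a sa] := sqr_of_good_e kt kt' gt.
have ia : is_iso a.
  exact: (@sqr_of_good_iso _ (dual X) _ _ _ _ _ _ t t' n n' cF cH a
    ((kcp_dual _ _ _).1 kt) ((kcp_dual _ _ _).1 kt') gt sa iF iH).
have -> // : cK = a.
apply: (left_uniq X _ sa); apply: (sqr_vcancel X sn').
rewrite -(good_comm gK) -(good_comm gH).
exact: sqr_vcomp sn (ker_e_sqr p e').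
Qed.

(** On the diagonal, (star) makes the quotient of [S] by [C] empty, so [S] is isomorphic to [C]. For
    a square, the kernel map of [S] is induced between star-pushouts of kernels by the invertible
    kernel maps of [A], [B] and [C]. *)
Lemma stairlike_star (A B C S : dfunctor D P) (a : mnat (gm X) A B)
    (b : mnat (gm X) A C) (p : mnat (gm X) B S) (q : mnat (gm X) C S) :
  (forall x, is_star (gm X) (a x) (b x) (p x) (q x)) ->
  stairlike X diag A -> stairlike X diag B -> stairlike X diag C ->
  stairlike X diag S.
Proof.
move=> st [eA dA] [eB dB] [eC dC]; split=> [x dx|x y x' y' f g e e' s].
  have ka := kcp_coker X (a x); have kq := kcp_coker X (q x).
  have za := kcp_iso_empty ka (is_empty_m_iso (a x) (eA _ dx) (eB _ dx)).
  have [n sn] := quotient_map (st x).1.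
  have iq := kcp_empty_iso kq
    (is_empty_m X (induced_iso_kcp (st x) ka kq sn) za).
  exact: is_empty_m X _ _ _ iq (eC _ dx).
have iso_k (F : dfunctor D P) : stairlike X diag F -> is_iso (kmap (kf X) (dsq F s)).
  move=> [_ /(_ _ _ _ _ _ _ _ _ s) [t]]; by rewrite (co_thin X t (dsq F s)).
have stK := starF_kernel st e; have stK' := starF_kernel st e'.
exists (dsq S s).
have comm (F F' : dfunctor D P) (c : mnat (gm X) F F') :
    kmap (kf X) (nt_sq c e) ;; kmap (kf X) (dsq F' s) =
    kmap (kf X) (dsq F s) ;; kmap (kf X) (nt_sq c e').
  apply: (mm X (kmor (kf X) (de F' e'))).
  rewrite -!composeA -!(good_comm (kmap_good _ _)) !composeA.
  rewrite -!(good_comm (kmap_good _ _)) -!composeA.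
  by rewrite (nt_nat c g).
apply: (star_desc_iso stK).
- by apply: (star_iso_source stK' (comm _ _ a) (comm _ _ b)); exact: iso_k.
- exact: comm.
- exact: comm.
Qed.

Definition constF (Z : P) : dfunctor D P :=
  @thin_dfunctor D P tP (fun _ => Z) (fun _ _ _ => idm _ Z) (fun _ _ _ => idm _ Z)
    (fun _ _ _ _ _ _ _ _ _ => sqr_hid (idm (ecat P) Z))
    (fun _ => erefl) (fun _ _ _ _ _ => esym (compose1m _))
    (fun _ => erefl) (fun _ _ _ _ _ => esym (compose1m _)).

Lemma stairlike_const (Z : P) : is_empty Z -> stairlike X diag (constF Z).
Proof.
move=> z; split=> // x y x' y' f g p q s.
exists (hid P (idm _ Z)); rewrite /distinguished kmap_id; exact: iso_id.
Qed.

Lemma empty_initial (Z F : dfunctor D P) :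
  (forall x, is_empty (Z x)) -> exists u : mnat (gm X) Z F, True.
Proof.
move=> z; have ex_u x : exists u : hom (mcat P) (Z x) (F x), True.
  by have [u _] := (z x).1 (F x); exists u.
have [u _] := dep_choice ex_u.
have gu x y (h : hom (mcat D) x y) : good (gm X) (dm Z h) (u x) (u y) (dm F h).
  apply: good_iso_top; last exact: is_empty_m_iso.
  exact: initial_uniq (z x).1.
have su x y (e : hom (ecat D) x y) : sqr (u x) (u y) (de Z e) (de F e).
  (* The identity is a cokernel of a map from the empty object, so [de F e] itself is the map of
     cokernels to be lifted. *)
  have [s ss] : exists s, sqr (u x) (u y) s (de F e).
    apply: (sqr_of_good_e (b := de F e) (kcp_from_empty X (u x) (z x))
      (kcp_from_empty X (u y) (z y))).
    by apply: good_iso_top (iso_id _); rewrite compose1m composem1.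
  by rewrite (initial_uniq s (de Z e) (z x).2) in ss.
by exists (mk_mnat tP su gu).
Qed.

End Closure.

(** * Star-pushouts in full subcategories of functors *)

Section PulledStars.
Context {D P : predouble} (X : core P) (tP : thin P).

Local Notation MN := (mnat_category D tP (gm X)).

Context {ob : Type} (phi : ob -> dfunctor D P).

Local Notation K := (pull_cat phi MN).

(** Closure is asked up to equality of functors, not isomorphism, so that the legs can be
    transported along it. *)
Hypothesis phi_star : forall (A B C : ob) (S : dfunctor D P)
  (a : mnat (gm X) (phi A) (phi B)) (b : mnat (gm X) (phi A) (phi C))
  (p : mnat (gm X) (phi B) S) (q : mnat (gm X) (phi C) S),
  (forall x, is_star (gm X) (a x) (b x) (p x) (q x)) -> exists s, phi s = S.

Lemma pull_star (A B C S : ob) (f : hom K A B) (g : hom K A C) (h : hom K B S)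
    (k : hom K C S) :
  (forall x, is_star (gm X) (nt f x) (nt g x) (nt h x) (nt k x)) ->
  is_star (fun_class X tP phi) f g h k.
Proof.
move=> st; split=> [|S' h' k' gd]; first exact: (@starF_good D P X tP).
have [u eu] := @starF_desc D P X tP _ _ _ _ _ _ _ _ st _ _ _ gd.
exists u; split.
  by split; apply: (mnat_ext tP) => x; have [] := eu x.
move=> v [e1 e2]; apply: (mnat_ext tP) => x.
apply: (star_epi (st x)).
  by rewrite (eu x).1 -(mnat_at x e1).
by rewrite (eu x).2 -(mnat_at x e2).
Qed.

Lemma pull_star_exists (A B C : ob) (f : hom K A B) (g : hom K A C) :
  (forall x, completable (gm X) (nt f x) (nt g x)) ->
  exists (S : ob) (h : hom K B S) (k : hom K C S),
    (forall x, is_star (gm X) (nt f x) (nt g x) (nt h x) (nt k x)) /\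
    is_star (fun_class X tP phi) f g h k.
Proof.
move=> cfg; have [S [p [q st]]] := starF_exists tP cfg.
have [s es] := phi_star st; case: _ / es in p q st *.
by exists s, p, q; split=> //; exact: pull_star.
Qed.

Lemma pull_completable (A B C : ob) (f : hom K A B) (g : hom K A C) x :
  completable (fun_class X tP phi) f g ->
  completable (gm X) (nt f x) (nt g x).
Proof.
by move=> [S [h [k gd]]]; exists (phi S x), (nt h x), (nt k x); exact: (fgood_at x gd).
Qed.

(** Every star-pushout is isomorphic to the entrywise one, and isomorphisms are entrywise. *)
Lemma pull_star_at (A B C S : ob) (f : hom K A B) (g : hom K A C)
    (h : hom K B S) (k : hom K C S) :
  is_star (fun_class X tP phi) f g h k ->
  forall x, is_star (gm X) (nt f x) (nt g x) (nt h x) (nt k x).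
Proof.
move=> st x.
have cfg : completable (fun_class X tP phi) f g by exists S, h, k; exact: st.1.
have [S' [h' [k' [st1 st2]]]] := pull_star_exists (fun x => pull_completable x cfg).
have [u [iu [<- <-]]] := star_uniq st2 st.
apply: star_iso (st1 x) _.
by move: iu => /pull_iso /mnat_iso; apply.
Qed.

(** (POL) is applied to the three squares of [cube_goodP]; on quotients this is possible because
    they form a star-pushout by [star_quotient]. *)
Lemma pull_POL : axiom_POL (fun_class X tP phi).
Proof.
move=> A B C S E F f g h k m n v st e gd x y l.
have st0 := pull_star_at st.
have ex z := mnat_at z e.
have g0 := gd _ _ l.
have [nf qf] := quotient_of_exists (ev tP l f).
have [ng qg] := quotient_of_exists (ev tP l g).
have [nh qh] := quotient_of_exists (ev tP l h).
have [nk qk] := quotient_of_exists (ev tP l k).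
have [nm qm] := quotient_of_exists (ev tP l m).
have [nn qn] := quotient_of_exists (ev tP l n).
have [nv qv] := quotient_of_exists (ev tP l v).
have qfm : quotient_of (ev tP l f ;; ev tP l m) (nf ;; nm).
  exact: sqr_hcomp qf qm.
have qkn : quotient_of (ev tP l k ;; ev tP l n) (nk ;; nn).
  exact: sqr_hcomp qk qn.
have [_ _ go] := (@cube_goodP _ X _ _ _ _ (ev tP l f ;; ev tP l m) (ev tP l g)
  (ev tP l v) (ev tP l k ;; ev tP l n) _ _ _ _ qfm qg qv qkn).1 g0.
apply/(@cube_goodP _ X _ _ _ _ (ev tP l m) (ev tP l h) (ev tP l v) (ev tP l n)
  _ _ _ _ qm qh qv qn).
have stn : is_star (gm X) nf ng nh nk.
  apply: (star_quotient (good_cube_faces (st.1 _ _ l)) _ (st0 x) (st0 y)).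
  by split; (try by split; exact: kcp_coker); split; eassumption.
split.
- exact: (@co_POLm _ X _ _ _ _ _ _ _ _ _ _ _ _ _ (st0 x) (ex x) (fgood_at x gd)).
- exact: (@co_POLm _ X _ _ _ _ _ _ _ _ _ _ _ _ _ (st0 y) (ex y) (fgood_at y gd)).
- apply: (@co_POLm _ X _ _ _ _ _ _ _ _ _ _ _ _ _ stn _ go).
  exact: (quotient_of_comm qm qh qv qn (ex y)).
Qed.

End PulledStars.

(** * Isomorphisms between functors *)

Section Isomorphisms.
Context {D P : predouble} (X : core P) (tP : thin P).

Lemma iso_pair_uniq_m A B (u u' : hom (mcat P) A B) v :
  iso_pair X u v -> iso_pair X u' v -> u = u'.
Proof. by move=> /iso_pair_tr i /iso_pair_tr; exact: iso_pair_uniq_e i. Qed.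

(** Shared isomorphisms exchange commuting diagrams and squares, so the naturality data of [a]
    become those of [v]; the required good squares have an invertible side. *)
Lemma mate_exists (F H : dfunctor D P) (a : mnat (gm X) F H) :
  (forall x, is_iso (a x)) ->
  exists v : enat (ge X) F H, forall x, iso_pair X (a x) (nt v x).
Proof.
move=> ia; have [v pv] := dep_choice (fun x => iso_pair_m X (ia x)).
have sv x y (h : hom (mcat D) x y) : sqr (dm F h) (dm H h) (v x) (v y).
  by apply/(iso_pair_sqr_e _ _ (pv x) (pv y)); exact: esym (nt_nat a h).
have gv x y (e : hom (ecat D) x y) :
    good (ge X) (de F e) (v x) (v y) (de H e).
  apply: good_triangle; last exact: iso_pair_iso_e (pv x).
  apply/(iso_pair_sqr_m _ _ (pv x) (pv y)); exact: (inhabits (nt_sq a e)).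
by exists (@mk_mnat (tr D) (tr P) (dual X) (thin_tr tP) (tr_dfunctor F)
  (tr_dfunctor H) v sv gv).
Qed.

Definition mate (F H : dfunctor D P) (a : mnat (gm X) F H)
    (ia : forall x, is_iso (a x)) : enat (ge X) F H := sval (cid _ (mate_exists ia)).

Lemma mateP (F H : dfunctor D P) (a : mnat (gm X) F H)
    (ia : forall x, is_iso (a x)) x : iso_pair X (a x) (nt (mate ia) x).
Proof. by rewrite /mate; case: cid. Qed.

End Isomorphisms.

Section QuotientIso.
Context {D P : predouble} (X : core P) (tP : thin P).

(** Components are invertible by (star), so naturality squares are good once they commute. *)
Lemma induced_isoF (A B C S QA QC : dfunctor D P) (a : mnat (gm X) A B)
    (b : mnat (gm X) A C) (p : mnat (gm X) B S) (q : mnat (gm X) C S)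
    (u : enat (ge X) QA B) (v : enat (ge X) QC S) :
  (forall x, is_star (gm X) (a x) (b x) (p x) (q x)) ->
  (forall x, kcp X (a x) (nt u x)) -> (forall x, kcp X (q x) (nt v x)) ->
  exists n : mnat (gm X) QA QC,
    forall x, is_iso (n x) /\ sqr (n x) (p x) (nt u x : hom (ecat P) _ _) (nt v x).
Proof.
move=> st ka kq.
have [n sn] := dep_choice (fun x => sqr_of_good (ka x) (kq x) (st x).1).
have ni x : is_iso (n x) := induced_iso_kcp (st x) (ka x) (kq x) (sn x).
have gn x y (h : hom (mcat D) x y) :
    good (gm X) (dm QA h) (n x) (n y) (dm QC h).
  apply: good_triangle; last exact: ni.
  have su : sqr (dm QA h) (dm B h) (nt u x : hom (ecat P) _ _) (nt u y) :=
    inhabits (nt_sq u h).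
  have sv : sqr (dm QC h) (dm S h) (nt v x : hom (ecat P) _ _) (nt v y) :=
    inhabits (nt_sq v h).
  apply: (top_uniq X (sqr_hcomp su (sn y))).
  rewrite (nt_nat p h); exact: sqr_hcomp (sn x) sv.
have sN x y (e : hom (ecat D) x y) : sqr (n x) (n y) (de QA e) (de QC e).
  apply: (sqr_vcancel X (sn y)).
  have e1 : de QA e ;; (nt u y : hom (ecat P) _ _) = nt u x ;; de B e := nt_nat u e.
  have e2 : de QC e ;; (nt v y : hom (ecat P) _ _) = nt v x ;; de S e := nt_nat v e.
  rewrite e1 e2; exact: sqr_vcomp (sn x) (inhabits (nt_sq p e)).
by exists (@mk_mnat D P X tP QA QC n sN gn).
Qed.

End QuotientIso.

(** * Equivalences of categories and the functor of kernels *)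

Section Equivalences.
Context {ob ob' : Type} {Y : category ob} {Z : category ob'} (F : functor Y Z).

Lemma equivalence_faithful a b (f f' : hom Y a b) :
  is_equivalence F -> fmap F f = fmap F f' -> f = f'.
Proof.
move=> [G [[eta [ie ne]] _]] e; apply: (iso_epic (ie a)).
apply: etrans (esym (ne _ _ f)) (etrans _ (ne _ _ f')).
by rewrite /= e.
Qed.

Lemma equivalence_full a b (g : hom Z (fobj F a) (fobj F b)) :
  is_equivalence F -> exists f, fmap F f = g.
Proof.
move=> [G [[eta [ie ne]] [th [ith nth]]]].
have [ei [e1 e2]] := ie a.
exists (ei ;; fmap G g ;; eta b).
have e : fmap G (fmap F (ei ;; fmap G g ;; eta b)) = fmap G g.
  apply: (iso_monic (ie b)); apply: etrans (ne _ _ _) _.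
  rewrite !composeA; apply: etrans (f_equal (fun w => w ;; _ ;; _) e1) _.
  by rewrite compose1m.
have ith' := ith (fobj F a); apply: (iso_epic ith').
apply: etrans (esym (nth _ _ _)) (etrans _ (nth _ _ g)).
by rewrite /= e.
Qed.

Lemma equivalence_of_ff_eso :
  (forall a b (g : hom Z (fobj F a) (fobj F b)), exists f, fmap F f = g) ->
  (forall a b (f f' : hom Y a b), fmap F f = fmap F f' -> f = f') ->
  (forall z, exists a (u : hom Z (fobj F a) z), is_iso u) ->
  is_equivalence F.
Proof.
move=> full faith eso.
have [o [u iu]] : exists (o : ob' -> ob) (u : forall z, hom Z (fobj F (o z)) z),
    forall z, is_iso (u z).
  have [s es] := @dep_choice ob' (fun z => {a : ob & hom Z (fobj F a) z})
    (fun z s => is_iso (projT2 s))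
    (fun z => let: ex_intro a (ex_intro u iu) := eso z in
       ex_intro _ (existT _ a u) iu).
  by exists (fun z => projT1 (s z)), (fun z => projT2 (s z)).
have [v ev] := dep_choice iu.
pose m z z' (g : hom Z z z') :=
  sval (cid _ (full _ _ (u z ;; g ;; v z'))).
have mE z z' (g : hom Z z z') : fmap F (m _ _ g) = u z ;; g ;; v z'.
  by rewrite /m; case: cid.
have m1 z : m _ _ (idm Z z) = idm Y (o z).
  apply: faith; rewrite mE fmap_id composem1; exact: (ev z).1.
have m2 z z' z'' (g : hom Z z z') (g' : hom Z z' z'') :
    m _ _ (g ;; g') = m _ _ g ;; m _ _ g'.
  apply: faith; rewrite fmap_comp !mE -!composeA; congr (_ ;; (_ ;; _)).
  by rewrite composeA (ev z').2 compose1m.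
exists (Functor m1 m2); split.
  have ex_eta a : exists f : hom Y (o (fobj F a)) a, fmap F f = u (fobj F a).
    exact: full.
  have [eta ee] := dep_choice ex_eta.
  exists eta; split=> [a|a b f].
    have [w ew] := full _ _ (v (fobj F a)).
    exists w; split; apply: faith; rewrite fmap_comp ee ew fmap_id.
      exact: (ev _).1.
    exact: (ev _).2.
  apply: faith => /=; rewrite !fmap_comp mE !ee -composeA (ev (fobj F b)).2.
  by rewrite composem1.
exists u; split=> // a b f /=.
by rewrite mE -composeA (ev b).2 composem1.
Qed.

End Equivalences.

Section KernelEquivalence.
Context (P : predouble) (L : hcomp_laws P) (G : good_class (mcat P))
  (k : kernel_functor G).

Hypothesis mono : forall A B (f : hom (mcat P) A B), is_monic f.

Lemma kernel_full_of_equiv :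
  is_equivalence (kernel_as_functor L k) -> kernel_full k.
Proof.
move=> eq A B A' B' p q a g gd.
have [s es] := @equivalence_full _ _ _ _ (kernel_as_functor L k) (Arrow p) (Arrow q)
  (@GoodMap _ _ G (Arrow (kmor k p)) (Arrow (kmor k q)) a g gd) eq.
exists (htop s).
have <- : hbot s = g := f_equal (fun m : good_map G _ _ => gm_cod m) es.
exact: (inhabits (hcell s)).
Qed.

Lemma top_unique_of_equiv :
  is_equivalence (kernel_as_functor L k) -> top_unique P.
Proof.
move=> eq A B A' B' f f' g p q [s] [s'].
have e : HSq s = HSq s'.
  apply: (@equivalence_faithful _ _ _ _ (kernel_as_functor L k) (Arrow p) (Arrow q) _ _ eq).
  apply: good_map_ext => //=; apply: (@mono _ _ (kmor k q)).
  rewrite -(good_comm (kmap_good k s)); exact: good_comm (kmap_good k s').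
exact: (f_equal (fun z => htop z) e).
Qed.

(** Monicity of [kmor] makes a map of kernels depend only on its codomain component, so fullness and
    faithfulness can be tested on bottom sides. *)
Lemma kernel_equiv :
  thin P -> top_unique P -> kernel_full k ->
  (forall K B (i : hom (mcat P) K B), exists F (p : hom (ecat P) F B)
     (j : hom (mcat P) (ker k p) K), is_iso j /\ j ;; i = kmor k p) ->
  is_equivalence (kernel_as_functor L k).
Proof.
move=> tP tu fu eso; apply: equivalence_of_ff_eso.
- move=> p q g; have [f [s]] := fu _ _ _ _ (arr p) (arr q) _ _ (gm_good g).
  exists (HSq s); apply: good_map_ext => //=.
  apply: (@mono _ _ (kmor k (arr q))).
  rewrite -(good_comm (kmap_good k s)); exact: good_comm (gm_good g).
- move=> p q [f g s] [f' g' s'] e.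
  have eg : g = g' := f_equal (fun m : good_map G _ _ => gm_cod m) e.
  apply: (HSq_ext tP) => //=; case: _ / eg in s' e *.
  exact: tu (inhabits s) (inhabits s').
- move=> i; have [F [p [j [[j' [e1 e2]] ej]]]] := eso _ _ (arr i).
  exists (Arrow p).
  have gd : good G (kmor k p) j (idm _ _) (arr i).
    by apply: good_triangle; [rewrite composem1 | exists j'].
  exists (@GoodMap _ _ G (Arrow (kmor k p)) i _ _ gd).
  have gd' : good G (arr i) j' (idm _ _) (kmor k p).
    apply: good_triangle; last by exists j.
    by rewrite composem1 -ej composeA e2 compose1m.
  exists (@GoodMap _ _ G i (Arrow (kmor k p)) _ _ gd').
  by split; apply: good_map_ext => //=; rewrite compose1m.
Qed.

End KernelEquivalence.

Section CoreOfEcgw.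
Context (C : double_category) (X : ecgw C).

Definition core_of_ecgw : core C :=
  @Core C (ecgw_thin X) (goodm X) (goode X) (kerf X) (cokf X)
    (kernel_full_of_equiv (kerf_equiv X)) (kernel_full_of_equiv (cokf_equiv X))
    (top_unique_of_equiv (@ecgw_Mm _ X) (kerf_equiv X))
    (@top_unique_of_equiv (tr C) _ _ _ (@ecgw_Me _ X) (cokf_equiv X))
    (ecgw_isos X) (ecgw_Z X) (@ecgw_Mm _ X) (@ecgw_Me _ X) (@ecgw_D _ X)
    (@ecgw_Km _ X) (@ecgw_Ke _ X) (@ecgw_starm _ X) (@ecgw_stare _ X)
    (@ecgw_PBLm _ X) (@ecgw_PBLe _ X) (@ecgw_POLm _ X) (@ecgw_POLe _ X).

End CoreOfEcgw.

(* The ECGW structure on staircases *)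
#[local] Obligation Tactic := idtac.

Section StaircaseCategory.
Context (C : double_category) (X : ecgw C) (n : nat).

Let X0 : core C := core_of_ecgw X.
Let tC : thin C := ecgw_thin X.
Let St := stair n.
Let SX := Sn X n.

Definition on_diagonal (x : stair n) : Prop := (sval x).1 = (sval x).2.

Lemma staircaseP (F : dfunctor (stair n) C) :
  is_staircase X F <-> stairlike X0 on_diagonal F.
Proof.
split=> [] [e d]; split=> // x y x' y' f g p q s.
  by exists (dsq F s); exact: (d _ _ _ _ _ _ _ _ s).
by have [t] := d _ _ _ _ _ _ _ _ s; rewrite (tC t (dsq F s)).
Qed.

Definition phi_e (F : SX) : dfunctor (tr St) (tr C) := tr_dfunctor (sval F).

Definition Sn_goodm : good_class (mcat SX) :=
  fun_class X0 tC (fun F : SX => sval F).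

Definition Sn_goode : good_class (ecat SX) :=
  @fun_class (tr St) (tr C) (dual X0) (thin_tr tC) SX phi_e.

Lemma staircase_tr (F : dfunctor (tr St) (tr C)) :
  @stairlike (tr St) (tr C) (dual X0) on_diagonal F ->
  is_staircase X (tr_dfunctor F : dfunctor St C).
Proof. by move=> s; apply/staircaseP; apply/stairlike_tr. Qed.

Lemma stairlike_e (F : SX) :
  @stairlike (tr St) (tr C) (dual X0) on_diagonal (phi_e F).
Proof. apply/(stairlike_tr X0 on_diagonal (sval F)); apply/staircaseP; exact: (svalP F). Qed.

Lemma stairlike_m (F : SX) : stairlike X0 on_diagonal (sval F).
Proof. apply/staircaseP; exact: (svalP F). Qed.

Definition Sn_ker (F H : SX) (p : hom (ecat SX) F H) : SX :=
  exist _ (@kerF St C X0 tC (sval F) (sval H) p : dfunctor St C)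
    ((staircaseP _).2 (@stairlike_ker St C X0 tC on_diagonal
      (sval F) (sval H) p (stairlike_m F) (stairlike_m H))).

Definition Sn_coker (F H : SX) (a : hom (mcat SX) F H) : SX :=
  exist _ (tr_dfunctor (@kerF (tr St) (tr C) (dual X0) (thin_tr tC)
      (phi_e F) (phi_e H) a) : dfunctor St C)
    (staircase_tr (@stairlike_ker (tr St) (tr C) (dual X0) (thin_tr tC)
      on_diagonal (phi_e F) (phi_e H) a (stairlike_e F) (stairlike_e H))).

Lemma Sn_sqr (F F' H H' : SX) (a : hom (mcat SX) F F') (b : hom (mcat SX) H H')
    (p : hom (ecat SX) F H) (q : hom (ecat SX) F' H') :
  sqr (P := SX) a b p q <->
  forall x, sqr (nt a x) (nt b x) (nt p x : hom (ecat C) _ _) (nt q x).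
Proof.
split=> [[s] x|s]; first exact: (inhabits (md s x)).
exact: (inhabits (@thin_modification C X St _ _ _ _ a b p q
  (fun x => sqr_pick (s x)))).
Qed.

Program Definition Sn_kerf : @kernel_functor SX Sn_goodm :=
  @KernelFunctor SX Sn_goodm Sn_ker (fun F H p => @kmorF St C X0 tC (sval F) (sval H) p)
    (fun F F' H H' a b p q s =>
       @kmapF St C X0 tC (sval F) (sval F') (sval H) (sval H') p q a b (md s)) _ _ _.
Next Obligation.
move=> F F' H H' a b p q s.
apply: (@kmapF_good St C X0 tC _ _ _ _ p q a b) => x; first exact: (inhabits (md s x)).
exact: (kmap_good (kf X0) (md s x)).
Qed.
Next Obligation.
by move=> F H p; apply: (mnat_ext tC) => x; exact: kmap_id.
Qed.
Next Obligation.
by move=> *; apply: (mnat_ext tC) => x; exact: kmap_comp.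
Qed.

Program Definition Sn_cokf : @kernel_functor (tr SX) Sn_goode :=
  @KernelFunctor (tr SX) Sn_goode Sn_coker
    (fun F H a => @kmorF (tr St) (tr C) (dual X0) (thin_tr tC) (phi_e F) (phi_e H) a)
    (fun F F' H H' p q a b s =>
       @kmapF (tr St) (tr C) (dual X0) (thin_tr tC) (phi_e F) (phi_e F')
         (phi_e H) (phi_e H') a b p q (md s)) _ _ _.
Next Obligation.
move=> F F' H H' p q a b s.
apply: (@kmapF_good (tr St) (tr C) (dual X0) (thin_tr tC) (phi_e F) (phi_e F')
  (phi_e H) (phi_e H') a b p q _) => x.
  exact: (inhabits (md s x)).
exact: (kmap_good (cf X0) (md s x : @sq (tr C) _ _ _ _ _ _ _ _)).
Qed.
Next Obligation.
by move=> F H p; apply: (mnat_ext (thin_tr tC)) => x; exact: (kmap_id (cf X0)).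
Qed.
Next Obligation.
move=> *; apply: (mnat_ext (thin_tr tC)) => x.
exact: (@kmap_comp (tr C) _ (cf X0)).
Qed.

Lemma Sn_top_uniq : top_unique SX.
Proof.
move=> A B A' B' f f' g p q /Sn_sqr s /Sn_sqr s'.
by apply: (mnat_ext tC) => x; have := top_uniq X0 (s x) (s' x).
Qed.

Lemma Sn_left_uniq : top_unique (tr SX).
Proof.
move=> A B A' B' f f' g p q s s'; apply: (mnat_ext (thin_tr tC)) => x.
exact: (@left_uniq _ X0 _ _ _ _ _ _ _ _ _ ((Sn_sqr p q f g).1 s x)
  ((Sn_sqr p q f' g).1 s' x)).
Qed.

Lemma Sn_mono_m (A B : SX) (f : hom (mcat SX) A B) : is_monic f.
Proof.
move=> U u v; exact: (@mnat_monic St C X0 tC (sval A) (sval B) f (sval U) u v).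
Qed.

Lemma Sn_mono_e (A B : SX) (f : hom (ecat SX) A B) : is_monic f.
Proof.
move=> U u v; exact: (@mnat_monic (tr St) (tr C) (dual X0) (thin_tr tC)
  (phi_e A) (phi_e B) f (phi_e U) u v).
Qed.

Lemma Sn_iso_m (A B : SX) (f : hom (mcat SX) A B) :
  is_iso f <-> forall x, is_iso (nt f x).
Proof.
by rewrite -(@mnat_iso St C X0 tC (sval A) (sval B) f); split=> [] [g e]; exists g.
Qed.

Lemma Sn_iso_e (A B : SX) (f : hom (ecat SX) A B) :
  is_iso f <-> forall x, is_iso (nt f x : hom (ecat C) _ _).
Proof.
apply: (iff_trans _ (@mnat_iso (tr St) (tr C) (dual X0) (thin_tr tC)
  (phi_e A) (phi_e B) f)).
by split=> [] [g e]; exists g.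
Qed.

Lemma Sn_ker_full : kernel_full Sn_kerf.
Proof.
move=> A B A' B' p q a g gd.
have [f sf] := @kerF_full St C X0 tC (sval A) (sval B) (sval A') (sval B') p q g a gd.
by exists f; apply/Sn_sqr.
Qed.

Lemma Sn_coker_full : kernel_full Sn_cokf.
Proof.
move=> A B A' B' p q a g gd.
have [f sf] := @kerF_full (tr St) (tr C) (dual X0) (thin_tr tC)
  (phi_e A) (phi_e B) (phi_e A') (phi_e B') p q g a gd.
by exists f; apply/(Sn_sqr p q f g).
Qed.

(** Take the entrywise cokernel of [i]. Each entry of [i] is a kernel of it, and [mnat_factor]
    assembles the comparison isomorphisms. *)
Lemma Sn_ker_eso K B (i : hom (mcat SX) K B) :
  exists F (p : hom (ecat SX) F B) (j : hom (mcat SX) (ker Sn_kerf p) K),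
    is_iso j /\ j ;; i = kmor Sn_kerf p.
Proof.
pose p : hom (ecat SX) (Sn_coker i) B := kmor Sn_cokf i.
exists (Sn_coker i), p.
have ex x : exists w : hom (mcat C) (ker (kf X0) (nt p x)) (sval K x),
    is_iso w /\ w ;; nt i x = kmor (kf X0) (nt p x).
  have [j [[j' [e1 e2]] e]] := kcp_coker X0 (nt i x).
  exists j'; split; first by exists j.
  by rewrite -e composeA e2 compose1m.
have [w ew] := dep_choice ex.
have [w' ew'] := @mnat_factor St C X0 tC (sval (Sn_ker p)) (sval K) (sval B) i
  (kmor Sn_kerf p) w (fun x => (ew x).2).
exists w'; split.
  by apply/Sn_iso_m => x; rewrite ew'; exact: (ew x).1.
by apply: (mnat_ext tC) => x; rewrite /= ew'; exact: (ew x).2.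
Qed.

Lemma Sn_coker_eso K B (i : hom (ecat SX) K B) :
  exists F (p : hom (mcat SX) F B) (j : hom (ecat SX) (ker Sn_cokf p) K),
    is_iso j /\ j ;; i = (kmor Sn_cokf p : hom (ecat SX) _ _).
Proof.
pose p : hom (mcat SX) (Sn_ker i) B := kmor Sn_kerf i.
exists (Sn_ker i), p.
have ex x : exists w : hom (ecat C) (ker (cf X0) (nt p x)) (sval K x),
    is_iso w /\ w ;; (nt i x : hom (ecat C) _ _) = kmor (cf X0) (nt p x).
  have [j [[j' [e1 e2]] e]] := @kcp_coker _ (dual X0) _ _ (nt i x).
  exists j'; split; first by exists j.
  by rewrite -e composeA e2 compose1m.
have [w ew] := dep_choice ex.
have [w' ew'] := @mnat_factor (tr St) (tr C) (dual X0) (thin_tr tC)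
  (phi_e (Sn_coker p)) (phi_e K) (phi_e B) i
  (kmor Sn_cokf p) w (fun x => (ew x).2).
exists w'; split.
  by apply/Sn_iso_e => x; rewrite ew'; exact: (ew x).1.
by apply: (mnat_ext (thin_tr tC)) => x; rewrite /= ew'; exact: (ew x).2.
Qed.

Lemma Sn_kerf_equiv :
  is_equivalence (kernel_as_functor (dl_h (double_lawsP SX)) Sn_kerf).
Proof.
apply: kernel_equiv; [exact: Sn_mono_m | exact: Sn_thin | exact: Sn_top_uniq |
  exact: Sn_ker_full | exact: Sn_ker_eso].
Qed.

Lemma Sn_cokf_equiv :
  is_equivalence (kernel_as_functor (dl_v (double_lawsP SX)) Sn_cokf).
Proof.
apply: kernel_equiv; [exact: Sn_mono_e | exact: (thin_tr (@Sn_thin C X n)) |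
  exact: Sn_left_uniq | exact: Sn_coker_full | exact: Sn_coker_eso].
Qed.

(** The shared groupoid is that of the m-isomorphisms; its functor to e-morphisms is [Sn_mate]. *)
Definition Sn_iso (F H : SX) : Type := {f : hom (mcat SX) F H | is_iso f}.

Lemma Sn_iso_ext (F H : SX) (f g : Sn_iso F H) : sval f = sval g -> f = g.
Proof.
case: f g => [f i] [g j] /= e; case: _ / e in j *.
by rewrite (proof_irrelevance _ i j).
Qed.

Program Definition Sn_isos_cat : category SX :=
  @Category SX Sn_iso (fun F => exist _ (idm (mcat SX) F) (iso_id F))
    (fun F H K f g => exist _ (sval f ;; sval g) (iso_comp (svalP f) (svalP g)))
    _ _ _.
Next Obligation. by move=> F H f; apply: Sn_iso_ext; exact: compose1m. Qed.
Next Obligation. by move=> F H f; apply: Sn_iso_ext; exact: composem1. Qed.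
Next Obligation. by move=> *; apply: Sn_iso_ext; exact: composeA. Qed.

Definition Sn_mate (F H : SX) (f : Sn_iso F H) : hom (ecat SX) F H :=
  @mate St C X0 tC (sval F) (sval H) (sval f) ((Sn_iso_m (sval f)).1 (svalP f)).

Lemma Sn_mateP (F H : SX) (f : Sn_iso F H) x :
  iso_pair X0 (nt (sval f) x) (nt (Sn_mate f) x).
Proof. exact: mateP. Qed.

Program Definition Sn_isos : shared_isos SX :=
  @SharedIsos SX Sn_isos_cat _ (fun F H f => sval f) _ _ Sn_mate _ _ _ _ _ _ _ _.
Next Obligation.
move=> F H [f [g [e1 e2]]].
have ig : is_iso g by exists f.
by exists (exist _ g ig); split; exact: Sn_iso_ext.
Qed.
Next Obligation. by []. Qed.
Next Obligation. by []. Qed.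
Next Obligation.
move=> F; apply: (mnat_ext (thin_tr tC)) => x.
exact (iso_pair_uniq_e (u := idm (mcat C) (sval F x))
  (Sn_mateP (idm Sn_isos_cat F) x) (iso_pair_id X0 (sval F x))).
Qed.
Next Obligation.
move=> F H K f g; apply: (mnat_ext (thin_tr tC)) => x.
exact (iso_pair_uniq_e (u := nt (sval f) x ;; nt (sval g) x)
  (Sn_mateP ((f : hom Sn_isos_cat F H) ;; g) x)
  (iso_pair_comp (Sn_mateP f x) (Sn_mateP g x))).
Qed.
Next Obligation.
move=> F H f i; exists (exist _ f i); split=> // g e.
exact (@Sn_iso_ext F H (exist _ f i) g (esym e)).
Qed.
Next Obligation.
move=> F H f /Sn_iso_e i.
have [u eu] := @mate_exists (tr St) (tr C) (dual X0) (thin_tr tC) (phi_e F)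
  (phi_e H) f i.
have iu : is_iso (u : hom (mcat SX) F H).
  by apply/Sn_iso_m => x; exact: iso_pair_iso_e (eu x).
have pu x : iso_pair X0 (nt u x) (nt f x) by apply/iso_pair_tr; exact: eu.
exists (exist _ (u : hom (mcat SX) F H) iu); split.
  apply: (mnat_ext (thin_tr tC)) => x.
  exact (iso_pair_uniq_e (u := nt u x)
    (Sn_mateP (exist _ (u : hom (mcat SX) F H) iu : Sn_iso F H) x) (pu x)).
move=> g e; apply: (@Sn_iso_ext F H (exist _ (u : hom (mcat SX) F H) iu) g).
apply: (mnat_ext tC) => x; have pg := Sn_mateP g x.
have eg : Sn_mate g = f := e; rewrite eg in pg.
exact (iso_pair_uniq_m (pu x) pg).
Qed.
Next Obligation.
move=> A B A' B' f f' g g'; split=> [/Sn_sqr s|e].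
  apply: (mnat_ext tC) => x.
  exact: (iso_pair_sqr_e _ _ (Sn_mateP f x) (Sn_mateP f' x)).1 (s x).
apply/Sn_sqr => x; apply/(iso_pair_sqr_e _ _ (Sn_mateP f x) (Sn_mateP f' x)).
exact (@mnat_at St C X0 (sval A) (sval B') _ _ x e).
Qed.
Next Obligation. by move=> *; exact: Sn_thin. Qed.
Next Obligation.
move=> A B A' B' f f' g g'; split=> [/Sn_sqr s|e].
  apply: (mnat_ext (thin_tr tC)) => x.
  exact: (iso_pair_sqr_m _ _ (Sn_mateP f x) (Sn_mateP f' x)).1 (s x).
apply/Sn_sqr => x; apply/(iso_pair_sqr_m _ _ (Sn_mateP f x) (Sn_mateP f' x)).
exact (@mnat_at (tr St) (tr C) (dual X0) (phi_e A) (phi_e B') _ _ x e).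
Qed.
Next Obligation. by move=> *; exact: Sn_thin. Qed.

Lemma Sn_empty_of_pointwise (Z : SX) :
  (forall x, is_empty (sval Z x)) -> is_empty (P := SX) Z.
Proof.
move=> z; split=> F.
  have [u _] := @empty_initial St C X0 tC (sval Z) (sval F) z.
  by exists u => g; apply: (mnat_ext tC) => x; exact: initial_uniq (z x).1.
have z' x : is_empty (P := tr C) (phi_e Z x) by have [z1 z2] := z x; split.
have [u _] := @empty_initial (tr St) (tr C) (dual X0) (thin_tr tC) (phi_e Z)
  (phi_e F) z'.
by exists u => g; apply: (mnat_ext (thin_tr tC)) => x; exact: initial_uniq (z x).2.
Qed.

Definition Sn_const (Z : C) (z : is_empty Z) : SX :=
  exist _ (constF tC Z : dfunctor St C)
    ((staircaseP _).2 (@stairlike_const St C X0 tC on_diagonal Z z)).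

Lemma Sn_Z : exists Z : SX, is_empty (P := SX) Z.
Proof.
by have [Z z] := co_Z X0; exists (Sn_const z); exact: Sn_empty_of_pointwise.
Qed.

(** An initial staircase is isomorphic to a constant empty one. *)
Lemma Sn_empty_at (Z : SX) x : is_empty (P := SX) Z -> is_empty (sval Z x).
Proof.
move=> [z _]; have [Z0 z0] := co_Z X0.
have [z1 _] : is_empty (P := SX) (Sn_const z0) by exact: Sn_empty_of_pointwise.
have [u _] := z1 Z.
have iu : is_iso u by exact: initial_iso.
exact (is_empty_m X0 ((Sn_iso_m u).1 iu x) z0).
Qed.

Lemma Sn_D : axiom_D Sn_kerf Sn_cokf.
Proof.
move=> A B A' B' f g p q s.
apply: iff_trans (Sn_iso_m (kmap Sn_kerf s)) _.
apply: iff_trans _ (iff_sym (Sn_iso_e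
  (kmap Sn_cokf (s : @sq (tr SX) _ _ _ _ p q f g) : hom (ecat SX) _ _))).
by split=> d x; apply/(co_D X0 (md s x)); exact: d.
Qed.

(** Initiality provides [u] and [v]; at each entry they must coincide with the sides that (K) gives
    there. *)
Lemma Sn_Km : axiom_K Sn_kerf Sn_cokf.
Proof.
move=> A B f Z z; have zx x := Sn_empty_at x z.
have [u _] := z.1 (Sn_coker f); have [v _] := z.2 A.
have dx x : dist X0 (nt u x) (nt f x) (nt v x : hom (ecat C) _ _)
    (kmor (cf X0) (nt f x)).
  have [u' [v' [s d]]] := co_Km X0 (nt f x) (zx x).
  rewrite (initial_uniq (nt u x) u' (zx x).1).
  rewrite (initial_uniq (nt v x : hom (ecat C) _ _) v' (zx x).2).
  by exists s.
have [s] : sqr (P := SX) u f v (kmor Sn_cokf f : hom (ecat SX) _ _).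
  by apply/Sn_sqr => x; have [s _] := dx x; exact: (inhabits s).
exists u, v, s; apply/Sn_iso_m => x; have [t d] := dx x.
by have -> : nt (kmap Sn_kerf s) x = kmap (kf X0) t by rewrite /= (tC t (md s x)).
Qed.

Lemma Sn_Ke : @axiom_K (tr SX) Sn_goode Sn_goodm Sn_cokf Sn_kerf.
Proof.
move=> A B f Z [ze zm]; have zx x := Sn_empty_at x (conj zm ze).
have [u _] := ze (Sn_ker f); have [v _] := zm A.
have dx x : dist (dual X0) (nt u x) (nt f x) (nt v x : hom (mcat C) _ _)
    (kmor (kf X0) (nt f x)).
  have [u' [v' [s d]]] := co_Ke X0 (nt f x) (conj (zx x).2 (zx x).1).
  rewrite (initial_uniq (nt u x : hom (ecat C) _ _) u' (zx x).2).
  rewrite (initial_uniq (nt v x : hom (mcat C) _ _) v' (zx x).1).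
  by exists s.
have [s] : sqr (P := SX) v (kmor Sn_kerf f) u f.
  by apply/Sn_sqr => x; have [s _] := dx x; exact: (inhabits s).
exists u, v, s; apply/Sn_iso_e => x; have [t d] := dx x.
have -> : (nt (kmap Sn_cokf (s : @sq (tr SX) _ _ _ _ u f v (kmor Sn_kerf f))) x
    : hom (ecat C) _ _) = kmap (cf X0) t by rewrite /= (thin_tr tC t (md s x)).
exact: d.
Qed.

Lemma Sn_star_m (A B D : SX) (S : dfunctor St C)
    (a : mnat (goodm X) (sval A) (sval B)) (b : mnat (goodm X) (sval A) (sval D))
    (p : mnat (goodm X) (sval B) S) (q : mnat (goodm X) (sval D) S) :
  (forall x, is_star (goodm X) (a x) (b x) (p x) (q x)) ->
  exists s : SX, sval s = S.
Proof.
move=> st; unshelve eexists (exist _ S _) => //; apply/staircaseP.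
exact (@stairlike_star St C X0 on_diagonal _ _ _ _ a b p q st
  (stairlike_m A) (stairlike_m B) (stairlike_m D)).
Qed.

Lemma Sn_star_e (A B D : SX) (S : dfunctor (tr St) (tr C))
    (a : @mnat (tr St) (tr C) (goode X) (phi_e A) (phi_e B))
    (b : @mnat (tr St) (tr C) (goode X) (phi_e A) (phi_e D))
    (p : @mnat (tr St) (tr C) (goode X) (phi_e B) S)
    (q : @mnat (tr St) (tr C) (goode X) (phi_e D) S) :
  (forall x, is_star (goode X) (nt a x) (nt b x) (nt p x) (nt q x)) ->
  exists s : SX, phi_e s = S.
Proof.
move=> st; have sS := @stairlike_star (tr St) (tr C) (dual X0) on_diagonal
  _ _ _ _ a b p q st (stairlike_e A) (stairlike_e B) (stairlike_e D).
by exists (exist _ (tr_dfunctor S : dfunctor St C) (staircase_tr sS)).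
Qed.

Lemma Sn_star_at_m (A B D S : SX) (f : hom (mcat SX) A B) (g : hom (mcat SX) A D)
    (h : hom (mcat SX) B S) (k : hom (mcat SX) D S) :
  is_star Sn_goodm f g h k ->
  forall x, is_star (goodm X) (nt f x) (nt g x) (nt h x) (nt k x).
Proof. exact (@pull_star_at St C X0 tC _ _ Sn_star_m A B D S f g h k). Qed.

Lemma Sn_star_at_e (A B D S : SX) (f : hom (ecat SX) A B) (g : hom (ecat SX) A D)
    (h : hom (ecat SX) B S) (k : hom (ecat SX) D S) :
  is_star Sn_goode f g h k ->
  forall x, is_star (goode X) (nt f x) (nt g x) (nt h x) (nt k x).
Proof.
exact (@pull_star_at (tr St) (tr C) (dual X0) (thin_tr tC) _ _ Sn_star_e
  A B D S f g h k).
Qed.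

Lemma Sn_induced_m (A B D S : SX) (f : hom (mcat SX) A B) (g : hom (mcat SX) A D)
    (h : hom (mcat SX) B S) (k : hom (mcat SX) D S) :
  is_star Sn_goodm f g h k -> induced_iso Sn_cokf f h k.
Proof.
move=> st.
have [m em] := @induced_isoF St C X0 tC _ _ _ _ (sval (Sn_coker f))
  (sval (Sn_coker k)) f g h k (kmor Sn_cokf f) (kmor Sn_cokf k) (Sn_star_at_m st)
  (fun x => kcp_coker X0 (nt f x)) (fun x => kcp_coker X0 (nt k x)).
exists m; split; first by apply/Sn_sqr => x; exact: (em x).2.
by apply/Sn_iso_m => x; exact: (em x).1.
Qed.

Lemma Sn_induced_e (A B D S : SX) (f : hom (ecat SX) A B) (g : hom (ecat SX) A D)
    (h : hom (ecat SX) B S) (k : hom (ecat SX) D S) :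
  is_star Sn_goode f g h k -> @induced_iso (tr SX) Sn_goodm Sn_kerf _ _ _ _ f h k.
Proof.
move=> st.
have [m em] := @induced_isoF (tr St) (tr C) (dual X0) (thin_tr tC)
  _ _ _ _ (phi_e (Sn_ker f)) (phi_e (Sn_ker k)) f g h k
  (kmor Sn_kerf f) (kmor Sn_kerf k) (Sn_star_at_e st)
  (fun x => @kcp_coker _ (dual X0) _ _ (nt f x))
  (fun x => @kcp_coker _ (dual X0) _ _ (nt k x)).
exists m; split; last by apply/Sn_iso_e => x; exact: (em x).1.
by apply/(Sn_sqr (kmor Sn_kerf f) (kmor Sn_kerf k) m h) => x; exact: (em x).2.
Qed.

Lemma Sn_starm : axiom_star Sn_goodm Sn_cokf.
Proof.
move=> A B D f g cfg; split.
  have [S [h [k [_ st]]]] := @pull_star_exists St C X0 tC SX (fun F : SX => sval F) Sn_star_m A B D f g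
    (fun x => @pull_completable St C X0 tC SX (fun F : SX => sval F) A B D f g x cfg).
  by exists S, h, k.
by move=> S h k st; split; [exact: Sn_induced_m st | exact: Sn_induced_m (star_tr st)].
Qed.

Lemma Sn_stare : @axiom_star (tr SX) Sn_goode Sn_goodm Sn_kerf.
Proof.
move=> A B D f g cfg; split.
  have [S [h [k [_ st]]]] := @pull_star_exists (tr St) (tr C) (dual X0) (thin_tr tC) SX phi_e Sn_star_e A B D f g
    (fun x => @pull_completable (tr St) (tr C) (dual X0) (thin_tr tC) SX phi_e A B D f g x cfg).
  by exists S, h, k.
by move=> S h k st; split; [exact: Sn_induced_e st | exact: Sn_induced_e (star_tr st)].
Qed.

Lemma Sn_PO : axiom_PO Sn_goodm.
Proof.
move=> A B D f g.
have [S [h [k [_ st]]]] := @pull_star_exists St C X0 tC SX (fun F : SX => sval F) Sn_star_m A B D f g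
  (fun x => @ecgw_PO _ X _ _ _ (nt f x) (nt g x)).
by exists S, h, k; exact: st.1.
Qed.

Lemma Sn_PBLm : axiom_PBL SX.
Proof.
move=> A B D A' B' D' f g f' g' p q r /Sn_sqr s /Sn_sqr t.
by apply/Sn_sqr => x; exact (sqr_hcancel X0 (s x) (t x)).
Qed.

Lemma Sn_PBLe : axiom_PBL (tr SX).
Proof.
move=> A B D A' B' D' f g f' g' p q r s t.
have s' := (Sn_sqr q r g g').1 s.
have t' := (Sn_sqr p r (f ;; g) (f' ;; g')).1 t.
by apply/(Sn_sqr p q f f') => x; exact (sqr_vcancel X0 (s' x) (t' x)).
Qed.

Definition Sn_ecgw : ecgw SX :=
  @Ecgw SX Sn_goodm Sn_goode Sn_kerf Sn_cokf Sn_kerf_equiv Sn_cokf_equiv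
    Sn_isos Sn_Z Sn_mono_m Sn_mono_e Sn_D Sn_Km Sn_Ke Sn_starm Sn_stare Sn_PO
    Sn_PBLm Sn_PBLe (@pull_POL St C X0 tC SX (fun F : SX => sval F) Sn_star_m) (@pull_POL (tr St) (tr C) (dual X0) (thin_tr tC) SX phi_e Sn_star_e).

(** Good squares, kernels and cokernels are entrywise by definition, so only the clauses on
    star-pushouts require an argument. *)
Lemma Sn_inherited : inherited Sn_ecgw.
Proof.
split=> //; first exact: Sn_star_at_m.
exact: Sn_star_at_e.
Qed.

(** Cokernels and isomorphisms are entrywise, so a kernel-cokernel pair of staircases restricts to
    one at each entry. *)
Lemma Sn_acyclic (W : C -> Prop) :
  acyclic_class X W ->
  acyclic_class Sn_ecgw (pointwise_acyclic (X := X) (n := n) W).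
Proof.
move=> w; split=> [Z z x|A B K i p [j [ij e]]].
  exact (ac_empty w (Sn_empty_at x z)).
have pair x : kernel_cokernel_pair X (nt i x) (nt p x).
  exists (nt j x); split; first exact: (Sn_iso_e j).1 ij x.
  by rewrite -e.
have w3 x := ac_two_of_three w (pair x).
by split=> [|]; [|split] => a b x; have [? [? ?]] := w3 x; eauto.
Qed.

End StaircaseCategory.

Theorem theorem5p4 (C : double_category) (X : ecgw C) (W : C -> Prop)
    (HW : acyclic_class X W) (n : nat) :
  exists Y : ecgw (Sn X n),
    inherited Y /\ acyclic_class Y (pointwise_acyclic (X := X) (n := n) W).
Proof.
by exists (Sn_ecgw X n); split; [exact: Sn_inherited | exact: Sn_acyclic].
Qed.
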